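(* Let $(A,\mathfrak{m})$ be a Noetherian local ring with $\dim A\ge 1$ and let $I$ be a proper ideal of $A$. Let $\mathscr{R}_+(I)=A[It]$ be the Rees ring, $\mathscr{R}(I)=A[It,t^{-1}]$ the extended Rees ring, and $G(I)=\bigoplus_{n\ge 0}I^n/I^{n+1}$ the associated graded ring of $I$. Then: (1) If $G(I)$ is seminormal, then $\mathscr{R}_+(I)$, $\mathscr{R}(I)$ and $A$ are seminormal. (2) If $G(I)$ is weakly normal, then $\mathscr{R}_+(I)$, $\mathscr{R}(I)$ and $A$ are weakly normal.
   Context: All rings are commutative with unit. Let $t$ be an indeterminate over $A$ and set $I^n=A$ for $n\le 0$. Then $\mathscr{R}_+(I)=A[It]=\bigoplus_{n\ge 0}I^nt^n\subseteq A[t]$, $\mathscr{R}(I)=A[It,t^{-1}]=\bigoplus_{n\in\mathbb{Z}}I^nt^n\subseteq A[t,t^{-1}]$, and $G(I)=\mathscr{R}_+(I)/I\mathscr{R}_+(I)=\mathscr{R}(I)/t^{-1}\mathscr{R}(I)=\bigoplus_{n\ge 0}I^n/I^{n+1}$. For a reduced Noetherian ring $B$ consider the conditions: (i) for any $y,z\in B$ with $y^3=z^2$, there is $x\in B$ with $y=x^2$ and $z=x^3$; (ii) for any $y,z,w\in B$, any nonzero divisor $d\in B$ and any prime integer $p$ with $z^p=yd^p$ and $pz=dw$, there is $x\in B$ with $y=x^p$ and $w=px$. A Noetherian ring is called seminormal if it is reduced and satisfies (i), and weakly normal if it is reduced and satisfies both (i) and (ii). *)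

(* Defs.v *)
From HB Require Import structures.
From mathcomp Require Import all_boot all_order all_algebra.
From mathcomp Require Import finmap zify.
From mathcomp.multinomials Require Import xfinmap monalg.
From mathcomp Require Import mathcomp_extra boolp.

Set Implicit Arguments.
Unset Strict Implicit.
Unset Printing Implicit Defensive.

Import GRing.Theory.

Local Open Scope fset_scope.
Local Open Scope ring_scope.

(* [idealr R] and [prime_idealr R] are the proper ideals, resp. the prime
   ideals, of [R]. They are boolean predicates; membership in the ideals built
   below is made boolean by [asbool], so classically every proper ideal of [R]
   is an [idealr R]. *)

Section CommutativeRings.
Variable R : comNzRingType.

(* The unit ideal, which is not an [idealr], is generated by 1. *)
Definition noetherian : Prop :=
  forall J : idealr R, exists s : seq R, forall x : R,
    x \in J <-> exists c : 'I_(size s) -> R, x = \sum_i c i * s`_i.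

Definition maximal_ideal (M : idealr R) : Prop :=
  forall J : idealr R, {subset M <= J} -> J =i M.

Definition local_ring (M : idealr R) : Prop :=
  maximal_ideal M /\ (forall N : idealr R, maximal_ideal N -> N =i M).

(* There is a chain P_0 < ... < P_n of prime ideals. *)
Definition krull_dim_ge (n : nat) : Prop :=
  exists P : 'I_n.+1 -> prime_idealr R, forall i j : 'I_n.+1, (i < j)%N ->
    {subset P i <= P j} /\ ~ {subset P j <= P i}.

Definition reduced : Prop := forall (x : R) (n : nat), x ^+ n = 0 -> x = 0.

Definition seminormal_cond : Prop :=
  forall y z : R, y ^+ 3 = z ^+ 2 -> exists x : R, y = x ^+ 2 /\ z = x ^+ 3.

(* As [R] is commutative, [GRing.lreg d] says that [d] is a nonzero divisor. *)
Definition weakly_normal_cond : Prop :=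
  forall (y z w d : R) (p : nat), GRing.lreg d -> prime p ->
    z ^+ p = y * d ^+ p -> p%:R * z = d * w ->
    exists x : R, y = x ^+ p /\ w = p%:R * x.

Definition seminormal : Prop := [/\ noetherian, reduced & seminormal_cond].

Definition weakly_normal : Prop :=
  [/\ noetherian, reduced, seminormal_cond & weakly_normal_cond].

Definition ideal_mul (I J : {pred R}) : {pred R} := fun x =>
  `[< exists n : nat, exists a b : 'I_n -> R,
      [/\ forall i, a i \in I, forall i, b i \in J & x = \sum_i a i * b i] >].

Fixpoint ideal_exp (I : {pred R}) (n : nat) : {pred R} :=
  if n is m.+1 then ideal_mul I (ideal_exp I m) else predT.

Definition ideal_expz (I : {pred R}) (n : int) : {pred R} :=
  if n is Posz m then ideal_exp I m else predT.

Lemma ideal_mul_sum (I J : {pred R}) (T : Type) (r : seq T) (P : pred T)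
    (F : T -> R) :
  (forall t, P t -> F t \in ideal_mul I J) ->
  \sum_(t <- r | P t) F t \in ideal_mul I J.
Proof.
move=> HF; elim/big_ind: _ => //.
- by apply/asboolP; exists 0%N, (fun=> 0), (fun=> 0); split=> [[]|[]|]; rewrite ?big_ord0.
- move=> _ _ /asboolP[m [a [b [aI bJ ->]]]] /asboolP[n [a' [b' [aI' bJ' ->]]]].
  apply/asboolP; exists (m + n)%N.
  exists (fun i => match split i with inl j => a j | inr j => a' j end).
  exists (fun i => match split i with inl j => b j | inr j => b' j end).
  split=> [i|i|]; [by case: (split i)|by case: (split i)|].
  rewrite big_split_ord /=; congr (_ + _); apply: eq_bigr => i _.
    by rewrite (unsplitK (inl i)).
  by rewrite (unsplitK (inr i)).
Qed.

Lemma mem_ideal_mul (I J : {pred R}) a b :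
  a \in I -> b \in J -> a * b \in ideal_mul I J.
Proof.
move=> aI bJ; apply/asboolP; exists 1%N, (fun=> a), (fun=> b).
by split=> //; rewrite big_ord1.
Qed.

Variable I : idealr R.

Lemma ideal_exp_sum n (T : Type) (r : seq T) (P : pred T) (F : T -> R) :
  (forall t, P t -> F t \in ideal_exp I n) ->
  \sum_(t <- r | P t) F t \in ideal_exp I n.
Proof. by case: n => // n; apply: ideal_mul_sum. Qed.

Lemma ideal_exp0 n : 0 \in ideal_exp I n.
Proof.
have -> : 0 = \sum_(i <- [::] : seq R | pred0 i) i by rewrite big_nil.
exact: ideal_exp_sum.
Qed.

Lemma ideal_expD n x y :
  x \in ideal_exp I n -> y \in ideal_exp I n -> x + y \in ideal_exp I n.
Proof.
move=> xI yI; have -> : x + y = \sum_(i <- [:: x; y] | i \in ideal_exp I n) i.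
  by rewrite !big_cons big_nil xI yI addr0.
by apply: ideal_exp_sum.
Qed.

Lemma ideal_expMr n x y : y \in ideal_exp I n -> x * y \in ideal_exp I n.
Proof.
case: n => // n /asboolP[m [a [b [aI bI ->]]]]; rewrite mulr_sumr.
apply: ideal_mul_sum => i _; rewrite mulrA; apply: mem_ideal_mul => //.
exact: idealMr.
Qed.

Lemma ideal_expM m n x y : x \in ideal_exp I m -> y \in ideal_exp I n ->
  x * y \in ideal_exp I (m + n).
Proof.
elim: m x => [|m IHm] x; first by move=> _; apply: ideal_expMr.
move=> /asboolP[k [a [b [aI bI ->]]]] yI; rewrite mulr_suml addSn.
by apply: ideal_mul_sum => i _; rewrite -mulrA mem_ideal_mul ?IHm.
Qed.

Lemma ideal_expS n x : x \in ideal_exp I n.+1 -> x \in ideal_exp I n.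
Proof.
move=> /asboolP[k [a [b [aI bI ->]]]].
by apply: ideal_exp_sum => i _; apply: ideal_expMr.
Qed.

Lemma ideal_exp_le m n x :
  (m <= n)%N -> x \in ideal_exp I n -> x \in ideal_exp I m.
Proof.
move=> /subnK <-; elim: (n - m)%N => // k IHk.
by rewrite addSn => /ideal_expS.
Qed.

Let posn (n : int) := if n is Posz m then m else 0%N.

Let ideal_expzE n : ideal_expz I n = ideal_exp I (posn n).
Proof. by case: n. Qed.

Lemma ideal_expz0 n : 0 \in ideal_expz I n.
Proof. by rewrite ideal_expzE ideal_exp0. Qed.

Lemma ideal_expz_sum n (T : Type) (r : seq T) (P : pred T) (F : T -> R) :
  (forall t, P t -> F t \in ideal_expz I n) ->
  \sum_(t <- r | P t) F t \in ideal_expz I n.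
Proof. by rewrite ideal_expzE; apply: ideal_exp_sum. Qed.

Lemma ideal_expzD n x y :
  x \in ideal_expz I n -> y \in ideal_expz I n -> x + y \in ideal_expz I n.
Proof. by rewrite ideal_expzE; apply: ideal_expD. Qed.

Lemma ideal_expzMr n x y : y \in ideal_expz I n -> x * y \in ideal_expz I n.
Proof. by rewrite ideal_expzE; apply: ideal_expMr. Qed.

Lemma ideal_expzM m n x y : x \in ideal_expz I m -> y \in ideal_expz I n ->
  x * y \in ideal_expz I (m + n).
Proof.
rewrite !ideal_expzE => xI yI.
apply: (@ideal_exp_le _ (posn m + posn n)); last exact: ideal_expM.
by case: m n {xI yI} => [m|m] [n|n] //=; rewrite -?[(_ + _)%R]/(intZmod.addz _ _) /=;
  case: ifP => _ /=; lia.
Qed.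

End CommutativeRings.

(* The monoid algebra of the additive group of integers: the coefficient of
   [t^n] in [f] is [f@_n], and [<< a *g n >>] is [a t^n]. *)
Definition laurent (R : comNzRingType) : Type := {malg R[int]}.

Section Laurent.
Variable R : comNzRingType.
Implicit Types (f g h : {malg R[int]}) (a b : R) (m n : int).

HB.instance Definition _ := GRing.Lmodule.copy (laurent R) {malg R[int]}.

Definition laurent_mul f g : {malg R[int]} :=
  \sum_(m <- msupp f) \sum_(n <- msupp g) << f@_m * g@_n *g (m + n)%R >>.

Let mulw (d1 d2 : {fset int}) f g :
  msupp f `<=` d1 -> msupp g `<=` d2 ->
  laurent_mul f g =
    \sum_(m <- d1) \sum_(n <- d2) << f@_m * g@_n *g (m + n)%R >>.
Proof.
move=> le_d1 le_d2; rewrite /laurent_mul (big_fset_incl _ le_d1) /=.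
  apply/eq_bigr=> m _; apply/big_fset_incl => // n _ /mcoeff_outdom ->.
  by rewrite mulr0 monalgU0.
move=> m _ /mcoeff_outdom fm.
by rewrite big1 => // n _; rewrite fm mul0r monalgU0.
Qed.

Let mulUU a b m n :
  laurent_mul << a *g m >> << b *g n >> = << a * b *g (m + n)%R >>.
Proof. by rewrite (mulw msuppU_le msuppU_le) !big_seq_fset1 !mcoeffUU. Qed.

Let mulC : commutative laurent_mul.
Proof.
move=> f g; rewrite /laurent_mul exchange_big; apply: eq_bigr => n _.
by apply: eq_bigr => m _; rewrite mulrC addrC.
Qed.

Let mulDl : left_distributive laurent_mul +%R.
Proof.
move=> f g h.
rewrite (mulw (msuppD_le f g) (fsubset_refl _)).
rewrite (mulw (fsubsetUl _ (msupp g)) (fsubset_refl (msupp h))).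
rewrite (mulw (fsubsetUr (msupp f) _) (fsubset_refl (msupp h))).
rewrite -big_split; apply: eq_bigr => m _ /=.
rewrite -big_split; apply: eq_bigr => n _ /=.
by rewrite mcoeffD mulrDl monalgUD.
Qed.

Let mul0l : left_zero 0 laurent_mul.
Proof. by move=> f; rewrite /laurent_mul msupp0 big_seq_fset0. Qed.

Let mul_suml (T : Type) (r : seq T) (F : T -> {malg R[int]}) g :
  laurent_mul (\sum_(i <- r) F i) g = \sum_(i <- r) laurent_mul (F i) g.
Proof. exact: (big_morph (laurent_mul^~ g) (fun _ _ => mulDl _ _ _) (mul0l g)). Qed.

Let mul_sumr (T : Type) (r : seq T) (F : T -> {malg R[int]}) g :
  laurent_mul g (\sum_(i <- r) F i) = \sum_(i <- r) laurent_mul g (F i).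
Proof. by rewrite mulC mul_suml; apply: eq_bigr => i _; rewrite mulC. Qed.

Let mulA : associative laurent_mul.
Proof.
move=> f g h; rewrite [f]monalgE [g]monalgE [h]monalgE.
rewrite !mul_suml; apply: eq_bigr => i _.
rewrite !(mul_sumr _ _ << f@_i *g i >>) [RHS]mul_suml; apply: eq_bigr => j _.
rewrite !mul_sumr; apply: eq_bigr => k _.
by rewrite !mulUU mulrA addrA.
Qed.

Let mul1l : left_id << 1 *g 0%R >> laurent_mul.
Proof.
move=> f; rewrite [f]monalgE mul_sumr; apply: eq_bigr => i _.
by rewrite mulUU mul1r add0r.
Qed.

Let one_neq0 : << 1 *g 0%R >> != 0 :> {malg R[int]}.
Proof. by rewrite monalgU_eq0 oner_neq0. Qed.

HB.instance Definition _ := GRing.Zmodule_isComNzRing.Build (laurent R)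
  mulA mulC mul1l mulDl one_neq0.

Let scaleU a b n : a *: << b *g n >> = << a * b *g n >> :> {malg R[int]}.
Proof. by apply/malgP => k; rewrite mcoeffZ !mcoeffU mulrnAr. Qed.

Let scaleAl a f g : a *: laurent_mul f g = laurent_mul (a *: f) g.
Proof.
rewrite [f]monalgE mul_suml !scaler_sumr mul_suml; apply: eq_bigr => i _.
rewrite [g]monalgE !mul_sumr scaler_sumr; apply: eq_bigr => j _.
by rewrite scaleU !mulUU scaleU mulrA.
Qed.

HB.instance Definition _ := GRing.Lmodule_isLalgebra.Build R (laurent R) scaleAl.
HB.instance Definition _ := GRing.Lalgebra_isComAlgebra.Build R (laurent R).

Lemma mcoeff_laurentM (f g : laurent R) n :
  (f * g : laurent R)@_n =
    \sum_(i <- msupp f) \sum_(j <- msupp g) (f@_i * g@_j) *+ ((i + j)%R == n).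
Proof.
rewrite raddf_sum; apply: eq_bigr => i _; rewrite raddf_sum.
by apply: eq_bigr => j _; rewrite /= mcoeffU.
Qed.

Lemma laurentMUU a b m n :
  (<< a *g m >> : laurent R) * << b *g n >> = << a * b *g (m + n)%R >>.
Proof. exact: mulUU. Qed.

Lemma mcoeff_laurent1 n : (1 : laurent R)@_n = (n == 0)%:R.
Proof. by rewrite mcoeffU eq_sym. Qed.

End Laurent.

Section ReesRings.
Variables (A : comNzRingType) (I : idealr A).

Definition rees_pred : {pred {poly A}} :=
  fun p => `[< forall n : nat, p`_n \in ideal_exp I n >].

Let rees_subalg : subalg_closed rees_pred.
Proof.
split=> [|a p q /asboolP pI /asboolP qI|p q /asboolP pI /asboolP qI];
  apply/asboolP => n.
- by rewrite coef1; case: n => [|n] //; exact: ideal_exp0.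
- by rewrite coefD coefZ ideal_expD ?ideal_expMr.
- rewrite coefM; apply: ideal_exp_sum => i _.
  have := ideal_expM (pI i) (qI (n - i)%N).
  by rewrite subnKC // -ltnS ltn_ord.
Qed.

HB.instance Definition _ := GRing.isSubalgClosed.Build A {poly A} rees_pred
  rees_subalg.

Record rees := Rees { rees_val : {poly A}; reesP : rees_val \in rees_pred }.

HB.instance Definition _ := [isSub for rees_val].
HB.instance Definition _ := [Choice of rees by <:].
HB.instance Definition _ := [SubChoice_isSubComNzRing of rees by <:].
HB.instance Definition _ := [SubZmodule_isSubLmodule of rees by <:].
HB.instance Definition _ := [SubNzRing_SubLmodule_isSubLalgebra of rees by <:].
HB.instance Definition _ := [SubLalgebra_isSubAlgebra of rees by <:].

Definition ext_rees_pred : {pred laurent A} :=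
  fun f => `[< forall n : int, f@_n \in ideal_expz I n >].

Let ext_rees_subalg : subalg_closed ext_rees_pred.
Proof.
split=> [|a p q /asboolP pI /asboolP qI|p q /asboolP pI /asboolP qI];
  apply/asboolP => n.
- by rewrite mcoeff_laurent1; case: eqP => [->|_] //; exact: ideal_expz0.
- by rewrite mcoeffD mcoeffZ ideal_expzD ?ideal_expzMr.
- rewrite mcoeff_laurentM; do 2![apply: ideal_expz_sum => ? _].
  by case: eqP => [<-|_]; rewrite ?ideal_expzM ?ideal_expz0.
Qed.

HB.instance Definition _ := GRing.isSubalgClosed.Build A (laurent A)
  ext_rees_pred ext_rees_subalg.

Record ext_rees := ExtRees {
  ext_rees_val : laurent A;
  ext_reesP : ext_rees_val \in ext_rees_pred
}.

HB.instance Definition _ := [isSub for ext_rees_val].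
HB.instance Definition _ := [Choice of ext_rees by <:].
HB.instance Definition _ := [SubChoice_isSubComNzRing of ext_rees by <:].
HB.instance Definition _ := [SubZmodule_isSubLmodule of ext_rees by <:].
HB.instance Definition _ :=
  [SubNzRing_SubLmodule_isSubLalgebra of ext_rees by <:].
HB.instance Definition _ := [SubLalgebra_isSubAlgebra of ext_rees by <:].

(* The extension of [I] to [rees]. *)
Definition rees_ideal : {pred rees} := fun x =>
  `[< exists n : nat, exists (a : 'I_n -> A) (b : 'I_n -> rees),
      (forall i, a i \in I) /\ x = \sum_i a i *: b i >].

Let rees_ideal_sum (T : Type) (r : seq T) (F : T -> rees) :
  (forall t, F t \in rees_ideal) -> \sum_(t <- r) F t \in rees_ideal.
Proof.
move=> HF; elim/big_ind: _ => //.
- by apply/asboolP; exists 0%N, (fun=> 0), (fun=> 0); split=> [[]|]; rewrite ?big_ord0.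
- move=> _ _ /asboolP[m [a [b [aI ->]]]] /asboolP[n [a' [b' [aI' ->]]]].
  apply/asboolP; exists (m + n)%N.
  exists (fun i => match split i with inl j => a j | inr j => a' j end).
  exists (fun i => match split i with inl j => b j | inr j => b' j end).
  split=> [i|]; first by case: (split i).
  rewrite big_split_ord /=; congr (_ + _); apply: eq_bigr => i _.
    by rewrite (unsplitK (inl i)).
  by rewrite (unsplitK (inr i)).
Qed.

Let monom_subproof n b :
  (if `[< b \in ideal_exp I n >] then b *: 'X^n else 0) \in rees_pred.
Proof.
apply/asboolP => k; case: asboolP => [bI|_]; last by rewrite coef0 ideal_exp0.
by rewrite coefZ coefXn; case: eqP => [->|_]; rewrite ?mulr1 ?mulr0 ?ideal_exp0.
Qed.

(* In degree [n], the extension of [I] is [I^(n+1)], so that the quotient of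
   [rees] by it is the direct sum of the [I^n / I^(n+1)]. *)
Lemma rees_idealP (x : rees) :
  reflect (forall n : nat, (rees_val x)`_n \in ideal_exp I n.+1)
          (x \in rees_ideal).
Proof.
rewrite unfold_in; apply: (iffP (asboolP _)) => [[m [a [b [aI ->]]]] n|xI].
  rewrite -[rees_val _]/(val _) raddf_sum coef_sum.
  apply: ideal_exp_sum => i _; rewrite /= coefZ.
  by apply: mem_ideal_mul => //; have /asboolP := reesP (b i).
apply/asboolP.
have -> : x = \sum_(n < size (rees_val x)) Rees (monom_subproof n (rees_val x)`_n).
  apply: val_inj; rewrite raddf_sum /= -[LHS]coefK poly_def.
  apply: eq_bigr => n _; case: asboolP => // - [].
  by have /asboolP := reesP x.
apply: rees_ideal_sum => n; apply/asboolP.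
have /asboolP[m [a [b [aI bI xn]]]] := xI n.
exists m, a, (fun i => Rees (monom_subproof n (b i))); split=> //.
apply: val_inj; rewrite raddf_sum /=; case: asboolP => [_|[]]; last first.
  by have /asboolP := reesP x.
rewrite xn scaler_suml; apply: eq_bigr => i _.
by rewrite /=; case: asboolP => [_|[]//]; rewrite scalerA.
Qed.

Let rees_ideal_closed : idealr_closed rees_ideal.
Proof.
split.
- by apply/rees_idealP => n; rewrite coef0 ideal_exp0.
- apply/negP => /rees_idealP/(_ 0%N); rewrite coef1 /=.
  move=> /asboolP[m [a [b [aI _ e]]]].
  have : (1 : A) \in I by rewrite (e : 1 = _) rpred_sum // => i _; rewrite mulrC idealMr.
  by rewrite idealr1.
- move=> a u v /rees_idealP uI /rees_idealP vI; apply/rees_idealP => n.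
  rewrite coefD; apply: ideal_expD (vI n).
  rewrite coefM; apply: ideal_exp_sum => i _.
  have /asboolP aI := reesP a.
  have := ideal_expM (aI i) (uI (n - i)%N).
  by rewrite addnS subnKC // -ltnS ltn_ord.
Qed.

HB.instance Definition _ := isIdealr.Build rees rees_ideal rees_ideal_closed.

Definition assoc_graded : comNzRingType := {ideal_quot rees_ideal}.

End ReesRings.

Arguments rees_ideal {A} I _.

(* Main.v *)
Require Import Defs.
From HB Require Import structures.
From mathcomp Require Import all_boot all_order all_algebra.
From mathcomp Require Import finmap zify ring.
From mathcomp.multinomials Require Import monalg.
From mathcomp Require Import boolp classical_sets.
Set Implicit Arguments.
Unset Strict Implicit.
Unset Printing Implicit Defensive.
Import GRing.Theory.
Local Open Scope ring_scope.

(* Let R be the extended Rees ring of I and let u be the inverse of the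
   indeterminate, so that G(I) = R / u R. Let X in a reduced extension of A be such
   that X^2 and X^3 lie in A, and let Q = (R : X). If Q + u R = R, then X lies in A
   because A is local. Otherwise let P be a minimal prime over Q + u R, and let N be
   the set of the s such that s Q is contained in R and u^k s lies in Q + R X for
   some k. It is a finitely generated R-module and N N is contained in Q; hence
   seminormality of R / u R provides, for s in N, some x in P such that
   (s - x) Q is contained in u R, and x can lie in Q + u R only if s lies in Q + u N.
   So N / (Q + u N) embeds into P / (Q + u R), and its length at P is less than the
   length of R / (Q + u R). But N / Q is commensurable with (Q + R X) / Q, which is
   isomorphic to R / Q, so that both lengths are equal: a contradiction.

   If X^p and p X lie in A instead, then Q is replaced by the conductor of R in R[X]
   and N by the ring of all s that stabilize Q and have (u^k s)^p in R for some k.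
   Weak normality of R / u R now gives N = R + u N, and Q + u R = R by Nakayama.

   Both properties pass from A to A[t]: A embeds into a product of fields, over which
   X exists by unique factorization, and the coefficients of X are shown to lie in A
   one after the other. Finally, as G(I) is reduced, an element of A[t, 1/t] lies in
   R as soon as one of its powers does. *)

(** * Submodules and noetherian rings *)

(** The hypothesis on R / u R solves the equations of (i) and (ii) only modulo u, and such an
    approximation x of s cannot be refined, since s need not lie in R and R is not complete. If p
    lies in the conductor, then N contains R, so that s - x stays in N and becomes divisible by u
    there: this is the situation of Nakayama's lemma. That p and a nonzero divisor lie in the
    conductor is arranged beforehand by means of (i) for A. In the first case N meets R only in Q,
    so that s - x leaves N, and only a comparison of sizes is left. As u acts injectively on R / Q,
    this module has infinite length at P; hence only quotients modulo u, and N / (Q + R X), are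
    measured.

    Lengths are expressed by chains of submodules, with strictness tested at P, so that no
    localization is built. All modules are predicates on one ring L, in the main application the
    Laurent polynomials over a product of fields, where X = z / y or X = z / d makes sense
    componentwise. *)

Section Submodules.
Variables (L : comNzRingType) (R : L -> Prop).
Implicit Types (V W : L -> Prop) (s : seq L).

Definition is_subring := [/\ R 1, forall x y, R x -> R y -> R (x - y)
  & forall x y, R x -> R y -> R (x * y)].

Definition is_submod V := [/\ V 0, forall x y, V x -> V y -> V (x + y)
  & forall r x, R r -> V x -> V (r * x)].

Definition incl V W := forall x, V x -> W x.

Fixpoint span s x :=
  if s is a :: s' then exists2 r, R r & span s' (x - r * a) else x = 0.

Definition noeth V := forall W, is_submod W -> incl W V ->
  exists s, forall x, W x <-> span s x.

Hypothesis Rs : is_subring.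

Let R1 : R 1. Proof. by case: Rs. Qed.
Let RB x y : R x -> R y -> R (x - y). Proof. by case: Rs => _ + _; apply. Qed.
Let RM x y : R x -> R y -> R (x * y). Proof. by case: Rs => _ _; apply. Qed.

Lemma subring0 : R 0. Proof. by rewrite -(subrr 1); apply: RB. Qed.

Lemma subringN x : R x -> R (- x).
Proof. by rewrite -sub0r; apply: RB; apply: subring0. Qed.

Lemma subringD x y : R x -> R y -> R (x + y).
Proof. by move=> Rx Ry; rewrite -[y]opprK; apply/RB/subringN. Qed.

Lemma subringX x n : R x -> R (x ^+ n).
Proof.
by move=> Rx; elim: n => [|n IH]; rewrite ?expr0 // exprS; apply: RM.
Qed.

Lemma subring_nat n : R n%:R.
Proof.
by elim: n => [|n IH]; [exact: subring0|rewrite -natr1; exact: subringD].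
Qed.

Lemma subringMn x n : R x -> R (x *+ n).
Proof. by move=> Rx; rewrite -mulr_natr; apply: RM (subring_nat n). Qed.

Lemma subring_sum (I : Type) (r : seq I) (P : pred I) (F : I -> L) :
  (forall i, P i -> R (F i)) -> R (\sum_(i <- r | P i) F i).
Proof.
by move=> HF; elim/big_ind: _ => //; [exact: subring0|exact: subringD].
Qed.

Lemma subring_submod : is_submod R.
Proof. by split; [exact: subring0|exact: subringD|exact: RM]. Qed.

Section Submod.
Variable V : L -> Prop.
Hypothesis Vs : is_submod V.
Lemma submod0 : V 0. Proof. by case: Vs. Qed.
Lemma submodD x y : V x -> V y -> V (x + y).
Proof. by case: Vs => _ + _; apply. Qed.
Lemma submodZ r x : R r -> V x -> V (r * x).
Proof. by case: Vs => _ _; apply. Qed.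
Lemma submodN x : V x -> V (- x).
Proof. by rewrite -mulN1r; apply/submodZ/subringN. Qed.
Lemma submodB x y : V x -> V y -> V (x - y).
Proof. by move=> Vx /submodN; apply: submodD. Qed.
Lemma submod_sum (I : Type) (r : seq I) (P : pred I) (F : I -> L) :
  (forall i, P i -> V (F i)) -> V (\sum_(i <- r | P i) F i).
Proof.
by move=> HF; elim/big_ind: _ => //; [exact: submod0|exact: submodD].
Qed.
End Submod.

Lemma span_sub V s x : is_submod V -> (forall a, a \in s -> V a) ->
  span s x -> V x.
Proof.
move=> Vs; elim: s x => [|a s IH] x Hs /=; first by move=> ->; apply: submod0.
case=> r Rr /IH Hx; rewrite -(subrK (r * a) x); apply: submodD => //.
  by apply: Hx => b bs; apply: Hs; rewrite inE bs orbT.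
by apply: submodZ => //; apply: Hs; rewrite mem_head.
Qed.

Lemma span_submod s : is_submod (span s).
Proof.
elim: s => [|a s [H0 HD HZ]]; split=> //=; first by move=> x y -> ->; rewrite addr0.
- by move=> r x _ ->; rewrite mulr0.
- by exists 0; [exact: subring0|rewrite mul0r subr0].
- move=> x y [r Rr Hx] [t Rt Hy]; exists (r + t); first exact: subringD.
  by rewrite mulrDl opprD addrACA; apply: HD.
- move=> r x Rr [t Rt Hx]; exists (r * t); first exact: RM.
  by rewrite -mulrA -mulrBr; apply: HZ.
Qed.

Lemma span_mem s a : a \in s -> span s a.
Proof.
elim: s => // b s IH; rewrite inE => /predU1P[->|/IH Ha] /=.
  by exists 1 => //; rewrite mul1r subrr; apply: submod0; apply: span_submod.
by exists 0; [exact: subring0|rewrite mul0r subr0].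
Qed.

Lemma span_catl s t x : span s x -> span (s ++ t) x.
Proof.
apply: span_sub; first exact: span_submod.
by move=> a sa; apply: span_mem; rewrite mem_cat sa.
Qed.

Lemma span_catr s t x : span t x -> span (s ++ t) x.
Proof.
apply: span_sub; first exact: span_submod.
by move=> a ta; apply: span_mem; rewrite mem_cat ta orbT.
Qed.

Definition addm V W x := exists2 a, V a & W (x - a).
Definition mulm c V x := exists2 a, V a & x = c * a.
Definition capm V W x := V x /\ W x.

Lemma addm_submod V W : is_submod V -> is_submod W -> is_submod (addm V W).
Proof.
move=> Vs Ws; split.
- by exists 0; rewrite ?subr0; apply: submod0.
- move=> x y [a Va Wa] [b Vb Wb]; exists (a + b); first exact: submodD.
  by rewrite opprD addrACA; apply: submodD.
- move=> r x Rr [a Va Wa]; exists (r * a); first exact: submodZ.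
  by rewrite -mulrBr; apply: submodZ.
Qed.

Lemma mulm_submod c V : is_submod V -> is_submod (mulm c V).
Proof.
move=> Vs; split.
- by exists 0; rewrite ?mulr0 //; apply: submod0.
- by move=> _ _ [a Va ->] [b Vb ->]; exists (a + b); rewrite ?mulrDr //; apply: submodD.
- by move=> r _ Rr [a Va ->]; exists (r * a); rewrite 1?mulrCA //; apply: submodZ.
Qed.

Lemma capm_submod V W : is_submod V -> is_submod W -> is_submod (capm V W).
Proof.
move=> Vs Ws; split; first by split; apply: submod0.
- by move=> x y [Vx Wx] [Vy Wy]; split; apply: submodD.
- by move=> r x Rr [Vx Wx]; split; apply: submodZ.
Qed.

Lemma addml V W : is_submod W -> incl V (addm V W).
Proof. by move=> Ws x Vx; exists x; rewrite ?subrr //; apply: submod0. Qed.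

Lemma addmr V W : is_submod V -> incl W (addm V W).
Proof. by move=> Vs x Wx; exists 0; rewrite ?subr0 //; apply: submod0. Qed.

Lemma addm_sub U V W : is_submod W -> incl U W -> incl V W ->
  incl (addm U V) W.
Proof.
move=> Ws UW VW x [a /UW Wa /VW Wb]; rewrite -(subrK a x).
exact: submodD.
Qed.

Lemma seq_choice (T : eqType) (F : T -> nat -> Prop) (s' : seq T) :
  (forall a n m, (n <= m)%N -> F a n -> F a m) ->
  (forall a : T, a \in s' -> exists n, F a n) ->
  exists n, forall a, a \in s' -> F a n.
Proof.
move=> mono; elim: s' => [|a s' IH] H; first by exists 0%N.
have [|n Hn] := IH; first by move=> b bs; apply: H; rewrite inE bs orbT.
have [|m Hm] := H a; first by rewrite mem_head.
exists (maxn n m) => b; rewrite inE => /predU1P[->|/Hn Hb].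
  exact: mono (leq_maxr _ _) Hm.
exact: mono (leq_maxl _ _) Hb.
Qed.

Lemma noeth_acc V (F : nat -> L -> Prop) : noeth V ->
  (forall n, is_submod (F n) /\ incl (F n) V) ->
  (forall n, incl (F n) (F n.+1)) -> exists n, forall m, incl (F m) (F n).
Proof.
move=> nV Fs Fincr.
have Fmono n m : (n <= m)%N -> incl (F n) (F m).
  by move=> /subnK <-; elim: (m - n)%N => // k IHk x /IHk; rewrite addSn; apply: Fincr.
have [||s Hs] := nV (fun x => exists n, F n x); first split.
- by exists 0%N; apply: (submod0 (Fs 0%N).1).
- move=> x y [n Fx] [m Fy]; exists (maxn n m); apply: (submodD (Fs _).1).
    exact: Fmono (leq_maxl _ _) _ Fx.
  exact: Fmono (leq_maxr _ _) _ Fy.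
- by move=> r x Rr [n Fx]; exists n; apply: submodZ => //; apply: (Fs n).1.
- by move=> x [n]; apply: (Fs n).2.
have [a n m||n Hn] := @seq_choice _ (fun a n => F n a) s.
- by move=> nm; apply: Fmono.
- by move=> a sa; apply/Hs/span_mem.
exists n => m x Fx; apply: (span_sub (Fs n).1 Hn); apply/Hs.
by exists m.
Qed.

Lemma noeth_max V (Phi : (L -> Prop) -> Prop) : noeth V ->
  (forall W, Phi W -> is_submod W /\ incl W V) -> (exists W, Phi W) ->
  exists W, Phi W /\ forall W', Phi W' -> incl W W' -> incl W' W.
Proof.
move=> nV PhiV [W0 PhiW0]; apply: contrapT => nomax.
have next (X : {W | Phi W}) : {Y : {W | Phi W} |
    incl (sval X) (sval Y) /\ ~ incl (sval Y) (sval X)}.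
  apply: cid; apply: contrapT => nex; apply: nomax.
  exists (sval X); split; first exact: svalP.
  move=> W' PhiW' XW'; apply: contrapT => nW'.
  by apply: nex; exists (exist _ W' PhiW').
pose F n := iter n (fun X => sval (next X)) (exist _ W0 PhiW0).
have [||n /(_ n.+1)] := @noeth_acc V (fun n => sval (F n)) nV.
- by move=> n; apply: PhiV; apply: svalP.
- by move=> n; case: (svalP (next (F n))).
- by case: (svalP (next (F n))).
Qed.

End Submodules.
Arguments incl {L} V W.

Section NoetherianRings.

Definition noethr (T : comNzRingType) := noeth (fun _ : T => True) (fun=> True).

Lemma subringT (T : comNzRingType) : is_subring (fun _ : T => True).
Proof. by []. Qed.

Lemma span_sumP (L : comNzRingType) (R : L -> Prop) (s : seq L) x : R 0 ->
  span R s x <-> exists c : 'I_(size s) -> L,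
    (forall i, R (c i)) /\ x = \sum_i c i * s`_i.
Proof.
move=> R0; elim: s x => [|a s IH] x /=.
  split=> [->|[c [_ ->]]]; last by rewrite big_ord0.
  by exists (fun=> 0); split=> //; rewrite big_ord0.
split=> [[r Rr /IH[c [Rc ex]]]|[c [Rc ->]]].
  exists (fun i => oapp c r (unlift ord0 i)); split.
    by move=> i; case: unliftP => [j _|_] /=.
  rewrite big_ord_recl unlift_none /=; under eq_bigr do rewrite liftK /=.
  by rewrite -ex addrC subrK.
exists (c ord0) => //; apply/IH; exists (fun i => c (lift ord0 i)).
by split=> //; rewrite big_ord_recl /= addrC addrA addNr add0r.
Qed.

Lemma noetherianP (T : comNzRingType) : noetherian T <-> noethr T.
Proof.
split=> nT.
  (* The unit ideal is not an [idealr]; it is generated by 1. *)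
  move=> W Ws _; have [W1|W1] := pselect (W 1).
    exists [:: 1] => x; split=> [Wx|_]; last first.
      by rewrite -[x]mulr1; apply: (submodZ Ws).
    by exists x => //=; rewrite mulr1 subrr.
  pose B : {pred T} := fun x => `[< W x >].
  have Bcl : idealr_closed B.
    split; first by apply/asboolP; apply: (submod0 Ws).
      by apply/negP => /asboolP.
    move=> a u v /asboolP Wu /asboolP Wv; apply/asboolP.
    by apply: (submodD Ws) => //; apply: (submodZ Ws).
  pose J : idealr T := HB.pack (B : T -> bool) (isIdealr.Build T B Bcl).
  have [s Hs] := nT J; exists s => x; rewrite span_sumP //.
  split=> [Wx|[c [_ ex]]].
    by have /Hs[c ->] : x \in J; [apply/asboolP|exists c].
  by apply/asboolP; rewrite -/(x \in J); apply/Hs; exists c.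
move=> J; have [||s Hs] := nT (fun x => x \in J); first split=> //.
- exact: idealr0.
- by move=> x y xJ yJ; rewrite rpredD.
- by move=> r x _ xJ; rewrite idealMr.
- by [].
exists s => x; rewrite Hs span_sumP //.
by split=> [[c [_ ->]]|[c ->]]; exists c.
Qed.

(** * Hilbert's basis theorem *)

Section HilbertBasis.
Variable T : comNzRingType.
Hypothesis nT : noethr T.
Variable J : {poly T} -> Prop.
Hypothesis Js : is_submod (fun=> True) J.

Let JD f g : J f -> J g -> J (f + g). Proof. by case: Js => _ + _; apply. Qed.
Let JZ f g : J g -> J (f * g). Proof. by case: Js => _ _ H Jg; apply: H. Qed.
Let JZc c g : J g -> J (c *: g). Proof. by rewrite -mul_polyC; apply: JZ. Qed.

Definition lead_ideal n r := exists f, [/\ J f, (size f <= n.+1)%N & f`_n = r].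

Lemma lead_ideal_submod n : is_submod (fun=> True) (lead_ideal n).
Proof.
split.
- by exists 0; split; rewrite ?size_poly0 ?coef0 //; case: Js.
- move=> _ _ [f [Jf sf <-]] [g [Jg sg <-]]; exists (f + g); split.
  + exact: JD.
  + by rewrite (leq_trans (size_polyD _ _)) // geq_max sf sg.
  + by rewrite coefD.
- move=> r _ _ [f [Jf sf <-]]; exists (r *: f); split; first exact: JZc.
  + exact: leq_trans (size_scale_leq _ _) sf.
  + by rewrite coefZ.
Qed.

Lemma lead_ideal_incr n : incl (lead_ideal n) (lead_ideal n.+1).
Proof.
move=> _ [f [Jf sf <-]]; exists ('X * f); split; first exact: JZ.
  by rewrite mulrC (leq_trans (size_polyMleq _ _)) // size_polyX addn2.
by rewrite coefXM.
Qed.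

Definition lifts (G : seq {poly T}) n r :=
  exists g, [/\ span (fun=> True) G g, (size g <= n.+1)%N & g`_n = r].

Let spanZ (G : seq {poly T}) f g :
  span (fun=> True) G g -> span (fun=> True) G (f * g).
Proof. exact: (submodZ (span_submod (subringT _) G)). Qed.

Let spanB (G : seq {poly T}) f g : span (fun=> True) G f ->
  span (fun=> True) G g -> span (fun=> True) G (f + g).
Proof. exact: (submodD (span_submod (subringT _) G)). Qed.

Lemma lift_lead n s : (forall a, a \in s -> lead_ideal n a) ->
  exists G, (forall g, g \in G -> J g) /\
    forall r, span (fun=> True) s r -> lifts G n r.
Proof.
elim: s => [|a s IH] Hs.
  exists [::]; split=> // _ ->; exists 0; split=> //; last by rewrite coef0.
  by rewrite size_poly0.
have [b bs|G [JG HG]] := IH; first by apply: Hs; rewrite inE bs orbT.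
have [f [Jf sf fa]] := Hs a (mem_head _ _).
exists (f :: G); split=> [g|r [t _ /HG[g [gG sg gr]]]].
  by rewrite inE => /predU1P[->|/JG].
exists (g + t *: f); split; last by rewrite coefD coefZ gr fa subrK.
  by exists t%:P => //; rewrite mul_polyC addrK.
rewrite (leq_trans (size_polyD _ _)) // geq_max sg.
exact: leq_trans (size_scale_leq _ _) sf.
Qed.

Lemma lift_leads N : exists G, (forall g, g \in G -> J g) /\
  forall n r, (n <= N)%N -> lead_ideal n r -> lifts G n r.
Proof.
have base n : exists G, (forall g, g \in G -> J g) /\
    forall r, lead_ideal n r -> lifts G n r.
  have [//|s Hs] := nT (lead_ideal_submod n).
  have [a sa|G [JG HG]] := @lift_lead n s; first by apply/Hs/span_mem.
  by exists G; split=> // r /Hs /HG.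
elim: N => [|N [G [JG HG]]].
  by have [G [JG HG]] := base 0%N; exists G; split=> // n r; rewrite leqn0 => /eqP->; apply: HG.
have [G' [JG' HG']] := base N.+1.
exists (G ++ G'); split=> [g|n r].
  by rewrite mem_cat => /orP[/JG|/JG'].
rewrite leq_eqVlt ltnS => /predU1P[->|nN].
  by move=> /HG'[g [gG sg gr]]; exists g; split=> //; apply: span_catr.
by move=> /(HG _ _ nN)[g [gG sg gr]]; exists g; split=> //; apply: span_catl.
Qed.

Lemma hilbert_fg : exists s, forall x, J x <-> span (fun=> True) s x.
Proof.
have [||N HN] := @noeth_acc _ (fun=> True) (subringT T) _ lead_ideal nT.
- by move=> n; split; [exact: lead_ideal_submod|].
- exact: lead_ideal_incr.
have [G [JG HG]] := lift_leads N; exists G => f; split; last first.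
  exact: span_sub.
have [n] := ubnP (size f); elim: n f => // n IH f sf Jf.
have [->|f0] := eqVneq f 0; first exact: (submod0 (span_submod (subringT _) G)).
suff [g [gG sg cg]] : exists g, [/\ span (fun=> True) G g,
    (size g <= size f)%N & g`_(size f).-1 = f`_(size f).-1].
  have Jg : J g by apply: span_sub gG.
  rewrite -[f](subrK g); apply: spanB => //; apply: IH; last first.
    by apply: JD => //; rewrite -scaleN1r; apply: JZc.
  rewrite ltnS in sf; apply: leq_trans sf.
  have sfg : (size (f - g)%R <= size f)%N.
    by rewrite (leq_trans (size_polyD _ _)) // geq_max leqnn size_polyN.
  apply: (@leq_ltn_trans (size f).-1); last by rewrite prednK ?size_poly_gt0.
  apply/leq_sizeP => j; rewrite leq_eqVlt => /predU1P[<-|].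
    by rewrite coefB cg subrr.
  rewrite prednK ?size_poly_gt0 // => fj.
  by rewrite nth_default // (leq_trans sfg).
have Lf : lead_ideal (size f).-1 f`_(size f).-1.
  by exists f; split=> //; rewrite prednK ?size_poly_gt0.
have [le|gt] := leqP (size f).-1 N.
  have [g [gG sg cg]] := HG _ _ le Lf; exists g; split=> //.
  by rewrite prednK ?size_poly_gt0 in sg.
(* Beyond degree N the ideals of leading coefficients no longer grow, so that a lift in degree N is
   shifted by a power of the indeterminate. *)
have [g [gG sg cg]] := HG _ _ (leqnn N) (HN _ _ Lf).
exists ('X^((size f).-1 - N) * g); split; first exact: spanZ.
  rewrite mulrC (leq_trans (size_polyMleq _ _)) // size_polyXn addnS /=.
  have sf0 : (0 < size f)%N by rewrite size_poly_gt0.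
  by move: sg gt sf0; move: (size g) (size f) => a b; lia.
rewrite coefXnM ltnNge leq_subr /=.
by rewrite subKn // ltnW.
Qed.

End HilbertBasis.

Lemma noethr_poly (T : comNzRingType) : noethr T -> noethr {poly T}.
Proof. by move=> nT J Js _; apply: hilbert_fg. Qed.

Definition rangep (S L : comNzRingType) (f : S -> L) x := exists a, x = f a.

Lemma rangep_subring (S L : comNzRingType) (f : {rmorphism S -> L}) :
  is_subring (rangep f).
Proof.
split; first by exists 1; rewrite rmorph1.
- by move=> _ _ [a ->] [b ->]; exists (a - b); rewrite rmorphB.
- by move=> _ _ [a ->] [b ->]; exists (a * b); rewrite rmorphM.
Qed.

Lemma noeth_range (S L : comNzRingType) (f : {rmorphism S -> L}) :
  noethr S -> noeth (rangep f) (rangep f).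
Proof.
move=> nS W Ws Wf; have [||s Hs] := nS (fun a => W (f a)); first split.
- by rewrite rmorph0; apply: (submod0 Ws).
- by move=> x y; rewrite rmorphD; apply: (submodD Ws).
- by move=> r x _; rewrite rmorphM; apply: (submodZ Ws); exists r.
- by [].
exists (map f s) => x; split=> [Wx|].
  have [a xa] := Wf _ Wx; subst x; have /Hs := Wx.
  elim: s a {Hs Wx} => [|b s IH] a /=; first by move=> ->; rewrite rmorph0.
  move=> [r _ /IH]; rewrite rmorphB rmorphM => H.
  by exists (f r) => //; exists r.
apply: span_sub Ws _ => _ /mapP[a sa ->]; apply/Hs.
exact: span_mem.
Qed.

Lemma noethr_inj (S L : comNzRingType) (f : {rmorphism S -> L}) :
  injective f -> noeth (rangep f) (rangep f) -> noethr S.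
Proof.
move=> finj nf W Ws _.
have [||s Hs] := nf (fun x => exists2 a, W a & x = f a); first split.
- by exists 0; rewrite ?rmorph0 //; apply: (submod0 Ws).
- move=> _ _ [a Wa ->] [b Wb ->]; exists (a + b); rewrite ?rmorphD //.
  exact: submodD Ws _ _ _ _.
- move=> _ _ [r ->] [a Wa ->]; exists (r * a); rewrite ?rmorphM //.
  exact: submodZ Ws _ _ _ _.
- by move=> _ [a _ ->]; exists a.
have [t es Wt] : exists2 t, s = map f t & forall a, a \in t -> W a.
  have : forall x, x \in s -> exists2 a, W a & x = f a.
    by move=> x xs; apply/Hs/span_mem => //; exact: rangep_subring.
  elim: s {Hs} => [|x s IH] H; first by exists [::].
  have [y ys|t -> Wt] := IH; first by apply: H; rewrite inE ys orbT.
  have [a Wa ->] := H x (mem_head _ _).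
  by exists (a :: t) => // b; rewrite inE => /predU1P[->|/Wt].
subst s; exists t => x; split=> [Wx|]; last exact: span_sub.
have : span (rangep f) (map f t) (f x) by apply/Hs; exists x.
elim: t x {Hs Wx Wt} => [|b t IH] x /=.
  by rewrite -{1}(rmorph0 f) => /finj.
by move=> [_ [r ->]]; rewrite -rmorphM -rmorphB => /IH; exists r.
Qed.

Lemma noeth_ext (L : comNzRingType) (R R' V V' : L -> Prop) :
  (forall x, R x <-> R' x) -> (forall x, V x <-> V' x) ->
  noeth R V -> noeth R' V'.
Proof.
move=> /(fun h x => propext (h x)) /funext -> /(fun h x => propext (h x)).
by move=> /funext ->.
Qed.

(* A subring generated by finitely many elements over the image of a noetherian
   ring is the image of an iterated polynomial ring. *)
Lemma noeth_fg (S L : comNzRingType) (f : {rmorphism S -> L}) (s : seq L)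
    (R : L -> Prop) : noethr S -> is_subring R -> (forall a, R (f a)) ->
  (forall x, x \in s -> R x) ->
  (forall R', is_subring R' -> (forall a, R' (f a)) ->
    (forall x, x \in s -> R' x) -> incl R R') ->
  noeth R R.
Proof.
move=> nS Rs Rf Rss Rmin.
suff [T [g [nT gR gf gs]]] : exists (T : comNzRingType) (g : {rmorphism T -> L}),
    [/\ noethr T, forall a, R (g a), forall a, rangep g (f a)
      & forall x, x \in s -> rangep g x].
  apply: (noeth_ext _ _ (noeth_range (f := g) nT)) => x.
    by split=> [[a ->//]|]; apply: Rmin => //; apply: rangep_subring.
  by split=> [[a ->//]|]; apply: Rmin => //; apply: rangep_subring.
elim: s Rss {Rmin} => [|x s IH] Rss.
  by exists S, f; split=> // a; exists a.
have [y ys|T [g [nT gR gf gs]]] := IH; first by apply: Rss; rewrite inE ys orbT.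
have gxc : commr_rmorph g x by move=> a; apply: mulrC.
exists {poly T}, (horner_morph gxc : {rmorphism {poly T} -> L}); split.
- exact: noethr_poly.
- move=> p; rewrite /= /horner_morph horner_coef; apply: subring_sum => // i _.
  have [_ _ RM] := Rs; rewrite coef_map; apply: RM => //=.
  by apply: subringX => //; apply: Rss; rewrite mem_head.
- by move=> a; have [b ->] := gf a; exists b%:P; rewrite /= horner_morphC.
- move=> y; rewrite inE => /predU1P[->|/gs[b ->]].
    by exists 'X; rewrite /= horner_morphX.
  by exists b%:P; rewrite /= horner_morphC.
Qed.

End NoetherianRings.

(** * Minimal primes and chains of submodules *)

Section PrimeIdeals.
Variables (L : comNzRingType) (R : L -> Prop).
Hypotheses (Rs : is_subring R) (nR : noeth R R).

Let R1 : R 1. Proof. by case: Rs. Qed.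
Let RM x y : R x -> R y -> R (x * y). Proof. by case: Rs => _ _; apply. Qed.

Definition is_prime (P : L -> Prop) := [/\ is_submod R P, incl P R, ~ P 1
  & forall a b, R a -> R b -> P (a * b) -> P a \/ P b].

Lemma prime_exp P a n : is_prime P -> R a -> P (a ^+ n) -> P a.
Proof.
case=> _ _ P1 Pm Ra; elim: n => [|n IH]; first by rewrite expr0.
by rewrite exprS => /Pm[] //; exact: (subringX Rs).
Qed.

Lemma prime_over J : is_submod R J -> incl J R -> ~ J 1 ->
  exists2 P, is_prime P & incl J P.
Proof.
move=> Js JR J1.
have [||P [[Ps PR P1 JP] Pmax]] := @noeth_max _ _ Rs R (fun W =>
    [/\ is_submod R W, incl W R, ~ W 1 & incl J W]) nR.
- by move=> W [].
- by exists J; split.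
exists P => //; split=> // a b Ra Rb Pab.
have [Pa|nPa] := pselect (P a); [by left|right].
pose W := addm P (mulm a R).
have Ws : is_submod R W.
  by apply: (addm_submod) => //; apply: mulm_submod => //; apply: subring_submod.
have PW : incl P W.
  exact/addml/mulm_submod/(subring_submod Rs).
have Wa : W a.
  by apply: (addmr Ps); exists 1; rewrite ?mulr1.
have [[x Px [r Rr e]]|nW1] := pselect (W 1).
  rewrite -[b]mul1r -(subrK x 1) e mulrDl; apply: (submodD Ps).
    by rewrite mulrAC mulrC; apply: (submodZ Ps).
  by rewrite mulrC; apply: (submodZ Ps).
case: nPa; apply: (Pmax W) => //; split=> //; last by move=> x /JP /PW.
apply: (addm_sub (subring_submod Rs)) => //.
by move=> _ [r Rr ->]; apply: RM.
Qed.

Lemma minimal_prime J : is_submod R J -> incl J R -> ~ J 1 ->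
  exists P, [/\ is_prime P, incl J P &
    forall p, is_prime p -> incl J p -> incl p P -> incl P p].
Proof.
move=> Js JR J1; have [P0 P0p JP0] := prime_over Js JR J1.
pose C p x := R x /\ ~ p x.
pose Phi (X : set L) := (exists p, [/\ is_prime p, incl J p & X = C p]) \/ X = set0.
have [|X [PhiX Xmax]] := @Zorn_bigcup L Phi.
  move=> F FPhi Ftot; have [[X0 [FX0 X0n]]|F0] :=
      pselect (exists X, F X /\ X <> set0); last first.
    right; apply/seteqP; split=> // x [X FX Xx].
    by case: F0; exists X; split=> // X0; rewrite X0 in Xx.
  have FC X x : F X -> X x -> exists p, [/\ is_prime p, incl J p & X = C p].
    by move=> /FPhi[//|->].
  left; exists (fun x => R x /\ forall X, F X -> ~ X x); split; first split.
  - split; first by split=> [|X FX Xx]; [exact: (subring0 Rs)|];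
      have [p [[ps _ _ _] _ eX]] := FC _ _ FX Xx; move: Xx; rewrite eX => -[_];
      apply; apply: (submod0 ps).
      move=> x y [Rx nx] [Ry ny]; split=> [|X FX Xx]; first exact: (subringD Rs).
      have [p [[ps _ _ _] _ eX]] := FC _ _ FX Xx; move: Xx; rewrite eX => -[_].
      apply; apply: (submodD ps); apply: contrapT => npx.
        by apply: (nx X) => //; rewrite eX.
      by apply: (ny X) => //; rewrite eX.
    move=> r x Rr [Rx nx]; split=> [|X FX Xx]; first exact: RM.
    have [p [[ps _ _ _] _ eX]] := FC _ _ FX Xx; move: Xx; rewrite eX => -[_].
    apply; apply: (submodZ ps) => //; apply: contrapT => npx.
    by apply: (nx X) => //; rewrite eX.
  - by move=> x [].
  - move=> [_ /(_ X0 FX0)]; apply; have [[p [[_ _ p1 _] _ eX]]|//] := FPhi _ FX0.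
    by rewrite eX.
  - move=> a b Ra Rb [_ nab]; apply: contrapT => /not_orP[na nb].
    have nX x : R x -> ~ (R x /\ forall X, F X -> ~ X x) -> exists2 X, F X & X x.
      move=> Rx nx; apply: contrapT => nX; apply: nx; split=> // X FX Xx.
      by apply: nX; exists X.
    have [X FX Xa] := nX a Ra na; have [Y FY Yb] := nX b Rb nb.
    have [Z [FZ Za Zb]] : exists Z, [/\ F Z, Z a & Z b].
      have [XY|YX] := Ftot _ _ FX FY.
        by exists Y; split=> //; apply: XY.
      by exists X; split=> //; apply: YX.
    apply: (nab Z) => //; have [p [[_ _ _ pm] _ eZ]] := FC _ _ FZ Za.
    move: Za Zb; rewrite eZ => -[_ pa] [_ pb]; split; first exact: RM.
    by move=> /(pm _ _ Ra Rb)[].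
  - move=> x Jx; split; first exact: JR.
    move=> X FX Xx; have [p [_ Jp eX]] := FC _ _ FX Xx.
    by move: Xx; rewrite eX => -[_]; apply; apply: Jp.
  - apply/seteqP; split=> [x [X FX Xx]|x [Rx nx]].
      have [p [_ _ eX]] := FC _ _ FX Xx.
      split; first by move: Xx; rewrite eX => -[].
      by move=> [_ /(_ X FX)].
    apply: contrapT => nU; apply: nx; split=> // X FX Xx.
    by apply: nU; exists X.
case: PhiX => [[P [Pp JP eX]]|X0]; last first.
  case: (Xmax (C P0)); last by left; exists P0.
  rewrite X0; split=> // /(_ 1); apply; split=> //.
  by case: P0p.
exists P; split=> // p pp Jp pP x Px; apply: contrapT => npx.
case: (Xmax (C p)); last by left; exists p.
rewrite eX; split=> [y [Ry nPy]|]; first by split=> // /pP.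
move=> /(_ x)[]; last by [].
by split=> //; case: Pp => _ + _ _; apply.
Qed.

(** * Lengths of modules at a prime *)

Section Chains.
Variable P : L -> Prop.
Hypothesis Pp : is_prime P.

(* The inclusion of W into V is strict after localization at P. *)
Definition pstrict (W V : L -> Prop) :=
  exists2 g, V g & forall r, R r -> W (r * g) -> P r.

(** A chain witnesses that V / W has length at least n after localization at P. Its last inclusion
    need not be strict, which lets V be enlarged and chains be concatenated freely. *)
Fixpoint chain n W V :=
  if n is m.+1 then exists U, [/\ is_submod R U, incl W U, pstrict W U & chain m U V]
  else incl W V.

Lemma chain_incl n W V : chain n W V -> incl W V.
Proof.
elim: n W => // n IH W [U [_ WU _ /IH UV]] x /WU; exact: UV.
Qed.

Lemma chain_lower n W' W V : incl W' W -> chain n W V -> chain n W' V.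
Proof.
move=> W'W; case: n => [|n] /=; first by move=> WV x /W'W /WV.
move=> [U [Us WU [g Ug Wg] c]]; exists U; split=> //; first by move=> x /W'W /WU.
by exists g => // r Rr /W'W; apply: Wg.
Qed.

Lemma chain_upper n W V V' : incl V V' -> chain n W V -> chain n W V'.
Proof.
move=> VV'; elim: n W => [|n IH] W /=; first by move=> WV x /WV /VV'.
by move=> [U [Us WU st /IH c]]; exists U.
Qed.

Lemma chain_cat a b W V U : chain a W V -> chain b V U -> chain (a + b) W U.
Proof.
elim: a W => [|a IH] W /=; first by move=> WV; apply: chain_lower.
by move=> [X [Xs WX st cX] cV]; exists X; split=> //; apply: IH.
Qed.

Lemma chain_strict n W V : chain n.+1 W V -> pstrict W V.
Proof.
move=> [U [_ _ [g Ug Wg] /chain_incl UV]]; exists g => //; exact: UV.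
Qed.

(** Length is additive along the intersections and the sums with V. A step that is not strict after
    adding V has some r g = k + v with r outside P, and then r g - k makes the step strict after
    intersecting with V. *)
Lemma chain_split n K' K V : is_submod R K' -> is_submod R V -> chain n K' K ->
  exists a b, [/\ (n <= a + b)%N, chain a (capm K' V) (capm K V)
    & chain b (addm K' V) (addm K V)].
Proof.
move=> K's Vs; elim: n K' K's => [|n IH] K' K's /=.
  move=> K'K; exists 0%N, 0%N; split=> //= x; first by move=> [/K'K].
  by move=> [y /K'K Ky Vy]; exists y.
move=> [U [Us K'U [g Ug K'g]] /(IH _ Us)[a [b [nab ca cb]]]].
have capK : incl (capm K' V) (capm U V) by move=> x [/K'U].
have addK : incl (addm K' V) (addm U V) by move=> x [y /K'U]; exists y.
have [st|nst] := pselect (pstrict (capm K' V) (capm U V)).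
  exists a.+1, b; split; first by rewrite addSn ltnS.
    by exists (capm U V); split=> //; apply: capm_submod.
  exact: chain_lower cb.
exists a, b.+1; split; first by rewrite addnS ltnS.
  exact: chain_lower ca.
exists (addm U V); split=> //; first exact: (addm_submod).
exists g; first exact: (addml (R := R)).
move=> r Rr [k K'k Vk]; apply: contrapT => nPr; apply: nst.
exists (r * g - k).
  split=> //; apply: (submodB Rs Us); first exact: (submodZ Us).
  exact: K'U.
move=> t Rt [K't _]; apply: contrapT => nPt.
have /(K'g _ (RM Rt Rr)) : K' (t * r * g).
  rewrite -mulrA -(subrK (t * k) (t * (r * g))) -mulrBr.
  by apply: (submodD K's) => //; apply: (submodZ K's).
by case: Pp => _ _ _ H /(H _ _ Rt Rr)[].
Qed.

Lemma chain_map (F : (L -> Prop) -> L -> Prop) n W V :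
  (forall U, is_submod R U -> incl W U -> is_submod R (F U)) ->
  (forall U U', incl U U' -> incl (F U) (F U')) ->
  (forall U U', is_submod R U -> is_submod R U' -> incl W U -> incl U U' ->
     incl U' V -> pstrict U U' -> pstrict (F U) (F U')) ->
  is_submod R W -> chain n W V -> chain n (F W) (F V).
Proof.
move=> Fs Fm Fst Ws.
suff H W' : is_submod R W' -> incl W W' -> chain n W' V -> chain n (F W') (F V).
  by apply: H.
elim: n W' => [|n IH] W' W's WW' /=; first exact: Fm.
move=> [U [Us W'U st c]]; have WU : incl W U by move=> x /WW' /W'U.
exists (F U); split; [exact: Fs|exact: Fm| |exact: IH].
by apply: Fst => //; apply: chain_incl c.
Qed.

(** A noetherian module has finite length at a minimal prime P of its support. If not, let W be
    maximal with unbounded chains from W to V. Some g has annihilator P modulo W, so that passing to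
    W + R g lowers the length by at most one, although from there chains are bounded. *)
Lemma chain_bounded W0 V : noeth R V -> is_submod R V -> is_submod R W0 ->
  incl W0 V ->
  (forall p g, is_prime p -> incl p P -> V g ->
     (forall r, R r -> W0 (r * g) -> p r) -> incl P p) ->
  exists B, forall n, chain n W0 V -> (n <= B)%N.
Proof.
move=> nV Vs W0s W0V supp.
pose bounded W := exists B, forall n, chain n W V -> (n <= B)%N.
apply: contrapT => unb.
have [||W [[Ws W0W WV Wunb] Wmax]] := @noeth_max _ _ Rs V (fun W =>
    [/\ is_submod R W, incl W0 W, incl W V & ~ bounded W]) nV.
- by move=> W [].
- by exists W0; split.
pose ann g r := R r /\ W (r * g).
have annR g : V g -> is_submod R (ann g) /\ incl (ann g) R.
  move=> Vg; split; last by move=> x [].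
  split.
  - by split; [exact: (subring0 Rs)|rewrite mul0r; apply: (submod0 Ws)].
  - move=> x y [Rx Wx] [Ry Wy]; split; first exact: (subringD Rs).
    by rewrite mulrDl; apply: (submodD Ws).
  - move=> r x Rr [Rx Wx]; split; first exact: RM.
    by rewrite -mulrA; apply: (submodZ Ws).
have [||_ [[g [Vg Pg ->]] gmax]] := @noeth_max _ _ Rs R (fun J => exists g,
    [/\ V g, incl (ann g) P & J = ann g]) nR.
- by move=> _ [g [Vg _ ->]]; apply: annR.
- apply: contrapT => nog; apply: Wunb; exists 0%N => -[//|n] /chain_strict[g Vg Pg].
  by case: nog; exists (ann g), g; split=> // r [Rr Wr]; apply: Pg.
have P1 : ~ P 1 by case: Pp.
have Pm a b : R a -> R b -> P (a * b) -> P a \/ P b by case: Pp => _ _ _; apply.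
have pg : is_prime (ann g).
  split; [exact: (annR g Vg).1|by move=> x []|by move=> /Pg|].
  move=> a b Ra Rb [_ Wab].
  (* In the first case the annihilator of a g contains b, and by maximality it is that of g.
     Otherwise some t outside P kills a g modulo W; then a kills t g, and the same maximality
     applies to t g. *)
  have [Pag|nPag] := pselect (incl (ann (a * g)) P).
    right; apply: (gmax (ann (a * g))).
    - by exists (a * g); split=> //; apply: (submodZ Vs).
    - move=> r [Rr Wr]; split=> //.
      by rewrite mulrCA; apply: (submodZ Ws).
    - by split=> //; rewrite mulrA [b * a]mulrC.
  left; have [t [Rt Wt] nPt] : exists2 t, ann (a * g) t & ~ P t.
    apply: contrapT => nt; apply: nPag => t at_; apply: contrapT => nPt.
    by apply: nt; exists t.
  apply: (gmax (ann (t * g))).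
  - exists (t * g); split=> //; first exact: (submodZ Vs).
    move=> r [Rr]; rewrite mulrA => Wr.
    by have /Pg/(Pm _ _ Rr Rt)[] : ann g (r * t) by split=> //; apply: RM.
  - by move=> r [Rr Wr]; split=> //; rewrite mulrCA; apply: (submodZ Ws).
  - by split=> //; rewrite mulrCA.
have Peq : incl P (ann g).
  by apply: (supp _ g) => // r Rr /W0W; split.
pose W' := addm W (mulm g R).
have gRs : is_submod R (mulm g R) by apply: mulm_submod; apply: subring_submod.
have W's : is_submod R W' by apply: (addm_submod).
have WW' : incl W W' by apply: (addml gRs).
have W'g : W' g by apply: (addmr Ws); exists 1; rewrite ?mulr1.
have W'V : incl W' V.
  apply: (addm_sub Vs) => // _ [r Rr ->].
  by rewrite mulrC; apply: (submodZ Vs).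
have [B HB] : bounded W'.
  apply: contrapT => nb; apply: P1; apply: Pg; split=> //; rewrite mul1r.
  by apply: (Wmax W') => //; split=> // x /W0W /WW'.
apply: Wunb; exists B.+1 => n /(chain_split Ws W's)[a [b [nab ca cb]]].
(* W' / W is generated by g with annihilator P. The first step of a chain contains r g for some r
   outside P, and r then maps W' into that step, which rules out a second strict step. *)
have a1 : (a <= 1)%N.
  case: a ca {nab} => // -[//|a] [U [Us WU [h Uh Wh] cU]].
  have [k [_ [w' Ww' [r' Rr' ek]]] Uk] := @chain_strict a _ _ cU.
  have [_ [w Ww [r Rr eh]]] := @chain_incl a.+1 _ _ cU _ Uh.
  have {}eh : r * g = h - w by rewrite [h - w]eh mulrC.
  have {}ek : k = w' + r' * g by rewrite [r' * g]mulrC -ek addrC subrK.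
  have WUx x : W x -> U x.
    by move=> Wx; apply: WU; split=> //; apply: WW'.
  have nPr : ~ P r.
    move=> /Peq[_ Wr]; apply/P1/Wh => //; rewrite mul1r.
    have Wh' : W h by rewrite -[h](subrK w) -eh; apply: (submodD Ws).
    by split=> //; apply: WW'.
  case: nPr; apply: Uk => //.
  have Urg : U (r * g).
    by rewrite eh; apply: (submodB Rs Us) => //; apply: WUx.
  rewrite ek mulrDr mulrCA; apply: (submodD Us); last exact: (submodZ Us).
  by apply/(submodZ Us)/WUx.
have cb' : chain b W' V.
  apply: (chain_upper _ (chain_lower _ cb)).
    exact: (addm_sub Vs).
  exact: (addmr Ws).
have := HB _ cb'; lia.
Qed.

End Chains.
End PrimeIdeals.

(** * Lifting seminormality *)

Lemma max_bounded (C : nat -> Prop) : C 0%N ->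
  (exists B, forall n, C n -> (n <= B)%N) ->
  exists2 n, C n & forall m, C m -> (m <= n)%N.
Proof.
move=> C0 [B HB]; have exC : exists n, `[< C n >] by exists 0%N; apply/asboolP.
have ubC n : `[< C n >] -> (n <= B)%N by move=> /asboolP/HB.
case: (ex_maxnP exC ubC) => n /asboolP Cn nmax.
by exists n => // m Cm; apply/nmax/asboolP.
Qed.

(* V embeds into a free R-module through multiplication by the elements of qs. *)
Lemma noeth_mul (L : comNzRingType) (R : L -> Prop) (qs : seq L) V :
  is_subring R -> noeth R R -> is_submod R V ->
  (forall q x, q \in qs -> V x -> R (q * x)) ->
  (forall x, V x -> (forall q, q \in qs -> q * x = 0) -> x = 0) ->
  exists s, forall x, V x <-> span R s x.
Proof.
move=> Rs nR; elim: qs V => [|q qs IH] V Vs VR V0.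
  exists [::] => x; split=> [Vx|->]; first exact: V0.
  exact: (submod0 Vs).
have qRs : is_submod R (fun y => V y /\ q * y = 0).
  split; first by rewrite mulr0; split=> //; apply: (submod0 Vs).
  - move=> x y [Vx qx] [Vy qy]; rewrite mulrDr qx qy addr0; split=> //.
    exact: (submodD Vs).
  - by move=> r x Rr [Vx qx]; rewrite mulrCA qx mulr0; split=> //; apply: (submodZ Vs).
have [||s Hs] := IH _ qRs.
- by move=> p x ps [Vx _]; apply: VR => //; rewrite inE ps orbT.
- move=> x [Vx qx] H; apply: V0 => // p; rewrite inE => /predU1P[->//|].
  exact: H.
have [|t Ht] := nR _ (mulm_submod q Vs).
  by move=> _ [x Vx ->]; apply: VR => //; rewrite mem_head.
have [t' et Vt] : exists2 t', t = map ( *%R q) t' & forall a, a \in t' -> V a.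
  have : forall x, x \in t -> exists2 a, V a & x = q * a.
    by move=> x xt; apply/Ht/span_mem.
  elim: t {Ht} => [|x t IHt] H; first by exists [::].
  have [y yt|t' -> Vt] := IHt; first by apply: H; rewrite inE yt orbT.
  have [a Va ->] := H x (mem_head _ _).
  by exists (a :: t') => // b; rewrite inE => /predU1P[->|/Vt].
exists (t' ++ s) => x; split=> [Vx|]; last first.
  apply: (span_sub Vs) => a; rewrite mem_cat => /orP[/Vt//|].
  by move=> /(span_mem Rs)/Hs[].
have /Ht qx : mulm q V (q * x) by exists x.
have [y ty qy] : exists2 y, span R t' y & q * x = q * y.
  rewrite et in qx; elim: (t') (q * x) qx => [|b r IHr] z /=.
    by move=> ->; exists 0; rewrite ?mulr0.
  move=> [c Rc /IHr[y ry ey]]; exists (y + c * b).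
    by exists c => //; rewrite addrK.
  by rewrite mulrDr -ey [q * (c * b)]mulrCA subrK.
rewrite -(subrK y x); apply: (submodD (span_submod Rs _)); last exact: span_catl.
apply: span_catr => //; apply/Hs; split; last by rewrite mulrBr qy subrr.
apply: (submodB Rs Vs) => //; exact: (span_sub Vs Vt).
Qed.

Section LiftSeminormality.
Variables (L : comNzRingType) (R : L -> Prop) (u v : L).
Hypotheses (Rs : is_subring R) (nR : noeth R R).
Hypotheses (Ru : R u) (uv : u * v = 1).
(** As u v = 1, membership of v f in R says that f lies in u R; this is reducedness of R / u R. *)
Hypothesis Gred : forall r n, R r -> R (v * r ^+ n) -> R (v * r).

Let R1 : R 1. Proof. by case: Rs. Qed.
Let RM x y : R x -> R y -> R (x * y). Proof. by case: Rs => _ _; apply. Qed.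
Let RB x y : R x -> R y -> R (x - y). Proof. by case: Rs => _ + _; apply. Qed.
Let RD x y : R x -> R y -> R (x + y). Proof. exact: subringD. Qed.
Let RX n x : R x -> R (x ^+ n). Proof. exact: subringX. Qed.

Let ucancel x : v * (u * x) = x.
Proof. by rewrite mulrA [v * u]mulrC uv mul1r. Qed.

(** The exponent k is lowered one at a time: if x = u^k s and u x lies in R, then (u x)^(K+1) lies
    in u R, one factor u being cancelled by v and the other K being absorbed by the hypothesis.
    Hence u x lies in u R. *)
Lemma almost_integral k K s :
  R (u ^+ k * s) -> (forall n, R (u ^+ K * s ^+ n)) -> R s.
Proof.
elim: k => [|k IH]; first by rewrite mul1r.
move=> Rk RK; apply: IH => //; rewrite exprS -mulrA in Rk.
rewrite -[u ^+ k * s]ucancel; apply: (@Gred _ K.+1) => //.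
have -> : v * (u * (u ^+ k * s)) ^+ K.+1
    = u ^+ (k * K.+1) * (u ^+ K * s ^+ K.+1).
  rewrite !exprMn -exprM exprS -!mulrA ucancel.
  by rewrite mulrCA.
by apply: RM => //; apply: RX.
Qed.

Lemma root_closed k n s : (0 < n)%N -> R (u ^+ k * s) -> R (s ^+ n) -> R s.
Proof.
move=> n0; elim: k => [|k IH]; first by rewrite mul1r.
move=> Rk Rn; apply: IH => //; rewrite exprS -mulrA in Rk.
rewrite -[u ^+ k * s]ucancel; apply: (@Gred _ n) => //.
rewrite -(prednK n0) in Rn *.
have -> : v * (u * (u ^+ k * s)) ^+ n.-1.+1
    = u ^+ n.-1 * u ^+ (k * n.-1.+1) * s ^+ n.-1.+1.
  by rewrite !exprMn -exprM exprS -!mulrA ucancel.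
by do ?apply: RM => //; apply: RX.
Qed.

Section Seminormal.
Hypothesis Lred : forall x : L, x ^+ 2 = 0 -> x = 0.
Hypothesis Gsn : forall y z, R y -> R z -> R (v * (y ^+ 3 - z ^+ 2)) ->
  exists x, [/\ R x, R (v * (y - x ^+ 2)) & R (v * (z - x ^+ 3))].
Variable X : L.
Hypotheses (RX2 : R (X ^+ 2)) (RX3 : R (X ^+ 3)).

(* Q is the conductor of X; since Q X is contained in Q, it is also the
   intersection of R with the R-module M = Q + R X. The elements of N / Q form a
   rank one module over R / Q, commensurable with M / Q. *)
Let Q r := R r /\ R (r * X).
Let J := addm Q (mulm u R).
Let M := addm Q (mulm X R).
Let N s := (exists k, M (u ^+ k * s)) /\ forall q, Q q -> R (s * q).

Let Qs : is_submod R Q.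
Proof.
split; first by split; rewrite ?mul0r; apply: (subring0 Rs).
- by move=> x y [Rx RxX] [Ry RyX]; split; rewrite ?mulrDl; apply: RD.
- by move=> r x Rr [Rx RxX]; split; rewrite -?mulrA; apply: RM.
Qed.

Let QR q : Q q -> R q. Proof. by case. Qed.

Let QX q : Q q -> Q (q * X).
Proof.
by move=> [Rq RqX]; split=> //; rewrite -mulrA -expr2; apply: RM.
Qed.

Let Rsm := subring_submod Rs.
Let Js : is_submod R J. Proof. by apply: addm_submod => //; apply: mulm_submod. Qed.
Let Ms : is_submod R M. Proof. by apply: addm_submod => //; apply: mulm_submod. Qed.

Let QM : incl Q M. Proof. exact: (addml (mulm_submod X Rsm)). Qed.

Let MM a b : M a -> M b -> Q (a * b).
Proof.
move=> [q Qq [r Rr /(canRL (subrK _)) ->]] [q' Qq' [r' Rr' /(canRL (subrK _)) ->]].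
have -> : (X * r + q) * (X * r' + q')
   = (r * r') * X ^+ 2 + r * (q' * X) + r' * (q * X) + q' * q by ring.
have QX2 : Q (X ^+ 2) by split=> //; rewrite -exprSr.
apply: (submodD Qs); first apply: (submodD Qs); first apply: (submodD Qs).
- by apply: (submodZ Qs) => //; apply: RM.
- by apply: (submodZ Qs) => //; apply: QX.
- by apply: (submodZ Qs) => //; apply: QX.
- by apply: (submodZ Qs) => //; apply: QR.
Qed.

Let MR a : M a -> R a -> Q a.
Proof.
move=> [q Qq [r Rr e]] Ra; rewrite -(subrK q a); apply: (submodD Qs) => //.
rewrite e mulrC; apply: QX; split=> //; rewrite mulrC -e.
by apply: RB => //; apply: QR.
Qed.

(** R / Q has no u-torsion: the square of r X is r^2 X^2, which lies in R, so that [root_closed]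
    recovers r X from u^k r X. *)
Let Qreg k r : R r -> Q (u ^+ k * r) -> Q r.
Proof.
move=> Rr [_ RurX]; split=> //; apply: (@root_closed k 2) => //.
  by rewrite mulrA.
by rewrite exprMn; apply: RM => //; apply: RX.
Qed.

Let Mle k j s : M (u ^+ k * s) -> M (u ^+ (j + k) * s).
Proof. by rewrite exprD -mulrA; apply: (submodZ Ms); apply: RX. Qed.

Let Ns : is_submod R N.
Proof.
split.
- split; first by exists 0%N; rewrite mulr0; apply: (submod0 Ms).
  by move=> q _; rewrite mul0r; apply: (subring0 Rs).
- move=> x y [[k Mx] xQ] [[j My] yQ]; split.
    exists (j + k)%N; rewrite mulrDr; apply: (submodD Ms); first exact: Mle.
    by rewrite addnC; apply: Mle.
  by move=> q Qq; rewrite mulrDl; apply: RD; [apply: xQ|apply: yQ].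
- move=> r x Rr [[k Mx] xQ]; split.
    by exists k; rewrite mulrCA; apply: (submodZ Ms).
  by move=> q Qq; rewrite -mulrA; apply: RM => //; apply: xQ.
Qed.

Let NQ s q : N s -> Q q -> Q (s * q).
Proof.
move=> [[k Mk] sQ] Qq; apply: (@Qreg k); first exact: sQ.
by rewrite mulrA; apply: MM => //; apply: QM.
Qed.

Let NN s t : N s -> N t -> Q (s * t).
Proof.
move=> Nst Nt; have [[k Mk] _] := Nst; have [[j Mj] _] := Nt.
have Qst : Q (u ^+ (k + j) * (s * t)) by rewrite exprD mulrACA; apply: MM.
(* Since N maps Q into Q, all u^(k+j) (s t)^n with n > 0 stay in Q; thus s t is almost integral over
   R. *)
apply: (@Qreg (k + j)) => //; apply: (@almost_integral (k + j) (k + j)).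
  exact: QR.
case=> [|n]; first by rewrite mulr1; apply: RX.
rewrite exprSr mulrCA; apply: QR.
elim: n => [|n IH]; first by rewrite mul1r.
by rewrite exprS -!mulrA; do 2!apply: NQ => //.
Qed.

Let MN : incl M N.
Proof.
move=> m Mm; split; first by exists 0%N; rewrite mul1r.
by move=> q Qq; apply/QR/MM => //; apply: QM.
Qed.

Let NR s : N s -> R s -> Q s.
Proof.
move=> [[k Mk] sQ] Rsx; apply: (@Qreg k) => //; apply: MR => //.
by apply: RM => //; apply: RX.
Qed.

Let Nreg s : N s -> (forall q, Q q -> q * s = 0) -> s = 0.
Proof.
move=> Nsx H; have := H _ (NN Nsx Nsx); rewrite -expr2 -exprSr => s3.
by do 2!apply: Lred; rewrite -exprM exprSr s3 mul0r.
Qed.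

Let nN : noeth R N.
Proof.
have [|qs Hqs] := nR Qs; first by move=> q [].
move=> V Vs VN; apply: (@noeth_mul _ _ qs) => //.
  move=> q x qqs Vx; rewrite mulrC; have [_] := VN _ Vx; apply.
  by apply/Hqs/span_mem.
move=> x Vx H; apply: Nreg; first exact: VN.
move=> q /Hqs; have annx : is_submod R (fun q => q * x = 0).
  split; first by rewrite mul0r.
    by move=> a b ax bx; rewrite mulrDl ax bx addr0.
  by move=> r a _ ax; rewrite -mulrA ax mulr0.
exact: (span_sub annx).
Qed.

Let Nbound : exists c, forall s, N s -> M (u ^+ c * s).
Proof.
have [//|s Hs] := nN Ns.
have [a n m /subnK <-||c Hc] := @seq_choice _ (fun a n => M (u ^+ n * a)) s.
- exact: Mle.
- by move=> a sa; have [] : N a by apply/Hs/span_mem.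
exists c => x /Hs.
have ucM : is_submod R (fun x => M (u ^+ c * x)).
  split; first by rewrite mulr0; apply: (submod0 Ms).
    by move=> a b Ma Mb; rewrite mulrDr; apply: (submodD Ms).
  by move=> r a Rr Ma; rewrite mulrCA; apply: (submodZ Ms).
exact: (span_sub ucM).
Qed.

(** Solutions of (i) are unique in the reduced ring R / u R. *)
Let cube_unique a b : R a -> R b -> R (v * (a ^+ 2 - b ^+ 2)) ->
  R (v * (a ^+ 3 - b ^+ 3)) -> R (v * (a - b)).
Proof.
move=> Ra Rb H2 H3; apply: (@Gred _ 3); first exact: RB.
have -> : v * (a - b) ^+ 3 = v * (a ^+ 3 - b ^+ 3) *+ 4
   - (v * (a ^+ 2 - b ^+ 2)) * (a + b) *+ 3 by ring.
apply: RB; first exact: subringMn.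
by apply: subringMn => //; apply: RM => //; apply: RD.
Qed.

Section MinimalPrime.
Variable P : L -> Prop.
Hypotheses (Pp : is_prime R P) (JP : incl J P).
Hypothesis Pmin : forall p, is_prime R p -> incl J p -> incl p P -> incl P p.

Let Ps : is_submod R P. Proof. by case: Pp. Qed.
Let PR : incl P R. Proof. by case: Pp. Qed.

(** The pair (s^2, s^3) lies in Q and is solved by s, possibly outside R, and by x in R modulo u.
    The factor q brings s q and x q into R, where uniqueness identifies them modulo u. As x^2
    differs from s^2 by an element of u R, it lies in J, whence x lies in P. *)
Let approx s : N s ->
  exists2 x, P x & forall q, Q q -> R (v * ((s - x) * q)).
Proof.
move=> Nsx; have Qs2 : Q (s ^+ 2) by rewrite expr2; apply: NN.
have Qs3 : Q (s ^+ 3) by rewrite exprS; apply: NQ.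
have [|x [Rx H2 H3]] := Gsn (QR Qs2) (QR Qs3).
  by rewrite -!exprM subrr mulr0; apply: (subring0 Rs).
exists x.
  apply: (@prime_exp _ R Rs _ _ 2) => //; apply: JP.
  exists (s ^+ 2) => //; exists (v * (x ^+ 2 - s ^+ 2)).
    by rewrite -opprB mulrN; apply: subringN.
  by rewrite mulrA uv mul1r.
move=> q Qq; rewrite mulrBl.
have Rq := QR Qq; have Rsq : R (s * q) by apply/QR/NQ.
apply: cube_unique => //; first exact: RM.
  by rewrite !exprMn -mulrBl mulrA; apply: RM => //; apply: RX.
by rewrite !exprMn -mulrBl mulrA; apply: RM => //; apply: RX.
Qed.

Let V := addm Q (mulm u N).
Let W0 := addm Q (mulm u M).

Let Vs : is_submod R V. Proof. by apply: addm_submod => //; apply: mulm_submod. Qed.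
Let W0s : is_submod R W0. Proof. by apply: addm_submod => //; apply: mulm_submod. Qed.

Let QN : incl Q N. Proof. by move=> q Qq; apply/MN/QM. Qed.

Let VN : incl V N.
Proof.
apply: (addm_sub Ns) => // _ [s Nsx ->]; exact: (submodZ Ns).
Qed.

Let QW0 : incl Q W0. Proof. exact: (addml (mulm_submod u Ms)). Qed.

Let W0V : incl W0 V.
Proof. by move=> x [q Qq [m Mm e]]; exists q => //; exists m => //; apply: MN. Qed.

(** Q and a power of u send N into M, so that a prime containing the annihilator of an element of N
    / M contains J, and minimality of P applies. *)
Let chainMN : exists2 n, chain R P n M N &
  forall m, chain R P m M N -> (m <= n)%N.
Proof.
apply: max_bounded; first exact: MN.
apply: chain_bounded => // p g pp pP Ng Hg.
apply: Pmin => // _ [q Qq [r Rr /(canRL (subrK _)) ->]].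
have [c Hc] := Nbound; have [ps _ _ _] := pp.
apply: (submodD ps); last first.
  by apply: Hg; [exact: QR|rewrite mulrC; apply/QM/NQ].
rewrite mulrC; apply: (submodZ ps) => //; apply: (@prime_exp _ R Rs _ _ c) => //.
by apply: Hg; [exact: RX|exact: Hc].
Qed.

Let JR : incl J R.
Proof. by apply: (addm_sub Rsm) => // _ [r Rr ->]; apply: RM. Qed.

Let chainJR : exists2 n, chain R P n J R &
  forall m, chain R P m J R -> (m <= n)%N.
Proof.
apply: max_bounded; first exact: JR.
apply: chain_bounded => // p g pp pP Rg Hg; apply: Pmin => // x Jx.
by apply: Hg; [exact: JR|rewrite mulrC; apply: (submodZ Js)].
Qed.

(* M / Q is isomorphic to R / Q. *)
Let chain_JR_M n : chain R P n J R -> chain R P n W0 M.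
Proof.
move=> /(chain_map (F := fun K => addm Q (mulm X K))) c.
apply: (chain_lower _ (c _ _ _ _)) => //.
- move=> _ [q Qq [m [q' Qq' [r Rr em]] /(canRL (subrK _)) ->]].
  exists (q + u * q'); first by apply: (submodD Qs) => //; apply: (submodZ Qs).
  exists (u * r); last by rewrite (canRL (subrK _) em); ring.
  apply: (addmr Qs); by exists r.
- by move=> U Us _; apply: addm_submod => //; apply: mulm_submod.
- move=> U U' UU' x [q Qq [k Uk e]]; exists q => //; exists k => //; exact: UU'.
- move=> U U' Us U's JU UU' U'R [g U'g Hg].
  exists (X * g); first by apply: (addmr Qs); exists g.
  move=> r Rr [q Qq [k Uk e]]; apply: Hg => //.
  rewrite -(subrK k (r * g)); apply: (submodD Us) => //; apply: JU.
  apply: (addml (mulm_submod u Rsm)); split.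
    by apply: RB; [apply: RM => //; apply: U'R|apply/U'R/UU'].
  have -> : (r * g - k) * X = r * (X * g) - X * k by ring.
  rewrite -e opprB addrC subrK.
  exact: QR.
Qed.

(** Multiplication by u maps N / M onto (Q + u N) / (Q + u M), and preimages under a surjection keep
    inclusions strict. *)
Let chain_W0V_MN n : chain R P n W0 V -> chain R P n M N.
Proof.
move=> /(chain_map (F := fun K s => N s /\ K (u * s))) c.
apply: (chain_lower _ (chain_upper _ (c _ _ _ _))) => //.
- by move=> m Mm; split; [exact: MN|apply: (addmr Qs); exists m].
- by move=> s [].
- move=> U Us _; split.
  + by rewrite mulr0; split; apply: submod0; eassumption.
  + move=> x y [Nx Ux] [Ny Uy]; rewrite mulrDr.
    by split; [apply: (submodD Ns)|apply: (submodD Us)].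
  + move=> r x Rr [Nx Ux]; rewrite mulrCA.
    by split; [apply: (submodZ Ns)|apply: (submodZ Us)].
- by move=> U U' UU' x [Nx /UU'].
- move=> U U' Us U's W0U UU' U'V [g U'g Hg].
  have [q Qq [s Nsx e]] := U'V _ U'g.
  exists s; first by split=> //; rewrite -e; apply: (submodB Rs U's) => //;
    apply/UU'/W0U/QW0.
  move=> r Rr [_ Urs]; apply: Hg => //; rewrite (canRL (subrK _) e) mulrDr.
  rewrite mulrCA; apply: (submodD Us) => //; apply: (submodZ Us) => //.
  exact/W0U/QW0.
Qed.

(* N / (Q + u N) embeds into P / J, by sending s to its approximation x. *)
Let chain_VN_JP n : chain R P n V N -> chain R P n J P.
Proof.
move=> /(chain_map (F := fun K x => P x /\ exists2 s, K s &
  forall q, Q q -> R (v * ((s - x) * q)))) c.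
apply: (chain_lower _ (chain_upper _ (c _ _ _ _))) => //.
- move=> x Jx; split; first exact: JP.
  have [q Qq [r Rr /(canRL (subrK _)) ->]] := Jx.
  exists q; first exact: (addml (mulm_submod u Ns)).
  move=> q' Qq'; have -> : v * ((q - (u * r + q)) * q') = - (v * u * r * q') by ring.
  rewrite [v * u]mulrC uv mul1r; apply: subringN => //; apply: RM => //; exact: QR.
- by move=> s [].
- move=> U Us _; split.
  + split; first exact: (submod0 Ps).
    exists 0; first exact: (submod0 Us).
    by move=> q _; rewrite subrr mul0r mulr0; apply: (subring0 Rs).
  + move=> x y [Px [s Usx Hs]] [Py [t Ut Ht]]; split; first exact: (submodD Ps).
    exists (s + t); first exact: (submodD Us).
    by move=> q Qq; rewrite opprD addrACA mulrDl mulrDr; apply: RD;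
      [apply: Hs|apply: Ht].
  + move=> r x Rr [Px [s Usx Hs]]; split; first exact: (submodZ Ps).
    exists (r * s); first exact: (submodZ Us).
    by move=> q Qq; rewrite -mulrBr -mulrA mulrCA; apply: RM => //; apply: Hs.
- by move=> U U' UU' x [Px [s /UU' Usx Hs]]; split=> //; exists s.
- move=> U U' Us U's VU UU' U'N [g U'g Hg].
  have [x Px Hx] := approx (U'N _ U'g).
  exists x; first by split=> //; exists g.
  move=> r Rr [_ [k Uk Hk]]; apply: Hg => //.
  rewrite -(subrK k (r * g)); apply: (submodD Us) => //; apply: VU.
  apply: (addmr Qs); exists (v * (r * g - k)); last by rewrite mulrA uv mul1r.
  (* Both r g and k are approximated by r x, so that their difference maps Q into u R; dividing it
     by u does not leave N. *)
  have Nrgk : N (r * g - k).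
    by apply: (submodB Rs Ns); [apply: (submodZ Ns) => //; apply: U'N|apply/U'N/UU'].
  have [[j Mj] _] := Nrgk; split.
    by exists j.+1; rewrite exprSr -mulrA [u * _]mulrA uv mul1r.
  move=> q Qq; have -> : v * (r * g - k) * q
    = r * (v * ((g - x) * q)) - v * ((k - r * x) * q) by ring.
  by apply: RB; [apply: RM => //; apply: Hx|apply: Hk].
Qed.

(* A chain of maximal length from Q + u M through M to N is split at Q + u N. Its
   lower part is no longer than a maximal chain from M to N, so that its upper
   part is at least as long as a maximal chain from J to R; but the latter part
   also embeds into P / J. *)
Lemma no_minimal_prime : False.
Proof.
have [lam clam maxlam] := chainJR; have [l cl maxl] := chainMN.
have c := chain_cat (chain_JR_M clam) cl.
have [a [b [le_ab ca cb]]] := chain_split Rs Pp W0s Vs c.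
have {}ca : chain R P a W0 V.
  apply: chain_lower (chain_upper _ ca); last by move=> x [].
  by move=> x W0x; split=> //; apply: W0V.
have {}cb : chain R P b V N.
  apply: chain_lower (chain_upper _ cb); first exact: (addmr W0s).
  by apply: (addm_sub Ns).
(* This is the extra step that yields the contradiction: the approximations stay in P, strictly
   below R. *)
have cPR : chain R P 1 P R.
  exists R; split=> //; exists 1 => // r _; by rewrite mulr1.
have := maxlam _ (chain_cat (chain_VN_JP cb) cPR).
have := maxl _ (chain_W0V_MN ca); lia.
Qed.

End MinimalPrime.

Theorem lift_seminormal : exists2 r, R r /\ R (r * X) & exists2 s, R s & r + u * s = 1.
Proof.
apply: contrapT => H.
have [||P [Pp JP Pmin]] := minimal_prime Rs nR Js.
- by apply: (addm_sub Rsm) => // _ [r Rr ->]; apply: RM.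
- move=> [q Qq [r Rr e]]; apply: H; exists q => //; exists r => //.
  by rewrite -e addrC subrK.
exact: (no_minimal_prime Pp JP Pmin).
Qed.

End Seminormal.
End LiftSeminormality.

(** * Lifting weak normality *)

(** The middle binomial coefficients are divisible by p. The cofactor h is kept in the subring
    because this subring is later the stabilizer of an ideal containing p; the error term then lies
    in that ideal. *)
Lemma frobenius_expansion (L : comNzRingType) (R : L -> Prop) p x y :
  is_subring R -> prime p -> R x -> R y ->
  exists2 h, R h & (x + y) ^+ p = x ^+ p + y ^+ p + p%:R * (x * y) * h.
Proof.
move=> Rs pp Rx Ry; have RM a b : R a -> R b -> R (a * b) by case: Rs => _ _; apply.
exists (\sum_(i < p.-1) (x ^+ (p.-1 - i.+1) * y ^+ i) *+ ('C(p, i.+1) %/ p)).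
  apply: (subring_sum Rs) => i _; apply: (subringMn Rs); apply: RM; exact: subringX.
have [[|n] ep] : exists n, p = n.+1 by exists p.-1; rewrite prednK ?prime_gt0.
  by rewrite ep in pp.
rewrite ep exprDn big_ord_recl big_ord_recr /= subn0 subnn expr0 mul1r mulr1 bin0 binn.
rewrite !mulr1n -[RHS]addrA; congr (_ + _); rewrite addrC mulr_sumr.
congr (_ + _); apply: eq_bigr => i _.
have /dvdnP[k ek] : (n.+2 %| 'C(n.+2, i.+1))%N.
  apply: prime_dvd_bin; first by rewrite -ep.
  by have := ltn_ord i; lia.
rewrite /bump /= add1n ek mulnK // mulnC mulrnA.
have -> : (n.+2 - i.+1 = (n.+1 - i.+1).+1)%N by have := ltn_ord i; lia.
rewrite exprS [in LHS]exprS -[in LHS](mulr_natl _ n.+2) [in RHS]mulrnAr; congr (_ *+ _).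
move: (x ^+ _) (y ^+ _) (n.+2%:R : L) => a b c; ring.
Qed.

(** * Nakayama's lemma and regular elements *)

Section Nakayama.
Variables (L : comNzRingType) (R : L -> Prop) (u : L).
Hypotheses (Rs : is_subring R) (Ru : R u).

(** Generators are eliminated one at a time. From a = w + u (c a + y) follows (1 - u c) a = w + u y,
    and writing b = (1 - u c) b + u c b removes a from the expressions of the other generators b.
    The factors 1 - u c multiply up to some 1 - u t. *)
Lemma nakayama (s : seq L) W : is_submod R W ->
  (forall a, a \in s -> addm W (mulm u (span R s)) a) ->
  exists2 t, R t & forall a, a \in s -> W ((1 - u * t) * a).
Proof.
have RM a b : R a -> R b -> R (a * b) by case: Rs => _ _; apply.
have RB a b : R a -> R b -> R (a - b) by case: Rs => _ + _; apply.
have R1 : R 1 by case: Rs.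
move=> Ws; elim: s => [|a s IH] Hs; first by exists 0 => //; apply: subring0.
have Ss := span_submod Rs s.
have WSs : is_submod R (addm W (mulm u (span R s))).
  by apply: addm_submod => //; apply: mulm_submod.
have [w Ww [z [c Rc Sy] /(canRL (subrK _)) ea]] := Hs a (mem_head _ _).
set y := z - c * a in Sy.
have ea' : (1 - u * c) * a = w + u * y by rewrite /y {1}ea; rewrite mulrBl mul1r {1}ea; ring.
have Rc1 : R (1 - u * c) by apply: RB => //; apply: RM.
have uS x : span R s x -> addm W (mulm u (span R s)) (u * x).
  by move=> Sx; apply: (addmr Ws); exists x.
have Wadd x : W x -> addm W (mulm u (span R s)) x.
  exact: (addml (mulm_submod u Ss)).
have [b bs|t Rt Ht] := IH.
  have [w' Ww' [z' [c' Rc' Sy'] /(canRL (subrK _)) eb]] : addm W (mulm u (span R (a :: s))) b.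
    by apply: Hs; rewrite inE bs orbT.
  set y' := z' - c' * a in Sy'.
  have E1 : (1 - u * c) * b = (1 - u * c) * w' + c' * (u * w)
      + u * (u * c' * y) + u * ((1 - u * c) * y').
    transitivity ((1 - u * c) * w' + u * c' * ((1 - u * c) * a)
        + u * ((1 - u * c) * y')); last by rewrite ea'; ring.
    by rewrite eb /y'; ring.
  have -> : b = (1 - u * c) * b + u * (c * b) by ring.
  rewrite E1.
  do 4?apply: (submodD WSs).
  + by apply: Wadd; apply: (submodZ Ws).
  + by apply: Wadd; do 2!apply: (submodZ Ws) => //.
  + by apply: uS; apply: (submodZ Ss) => //; apply: RM.
  + by apply: uS; apply: (submodZ Ss).
  + by apply: uS; apply: (submodZ Ss) => //; apply: span_mem.
have Rt1 : R (1 - u * t) by apply: RB => //; apply: RM.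
exists (t + c - u * (t * c)).
  by apply: RB; [exact: (subringD Rs)|apply: (RM) => //; apply: (RM)].
have e1 : 1 - u * (t + c - u * (t * c)) = (1 - u * t) * (1 - u * c) by ring.
move=> b; rewrite e1 inE => /predU1P[->|bs]; last first.
  by rewrite [_ * (1 - u * c)]mulrC -mulrA; apply: (submodZ Ws) => //; apply: Ht.
rewrite -mulrA ea' mulrDr mulrCA; apply: (submodD Ws); first exact: (submodZ Ws).
apply: (submodZ Ws) => //.
have W' : is_submod R (fun x => W ((1 - u * t) * x)).
  split; first by rewrite mulr0; apply: (submod0 Ws).
    by move=> x1 x2 H1 H2; rewrite mulrDr; apply: (submodD Ws).
  by move=> r x1 Rr H1; rewrite mulrCA; apply: (submodZ Ws).
exact: (span_sub W' Ht).
Qed.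
End Nakayama.

(* The statement is about the ideal Q of the reduced ring R / U. If a kills q but
   not q1 in Q, then Ann (Ann q) is strictly smaller than Ann (Ann (q + a q1)). *)
Lemma regular_element (L : comNzRingType) (R U Q : L -> Prop) :
  is_subring R -> noeth R R -> is_submod R U ->
  (forall r, R r -> U (r ^+ 2) -> U r) -> is_submod R Q -> incl Q R ->
  (forall r, R r -> (forall q, Q q -> U (r * q)) -> U r) ->
  exists2 q, Q q & forall r, R r -> U (q * r) -> U r.
Proof.
move=> Rs nR Us Urad Qs QR annQ.
have RM x y : R x -> R y -> R (x * y) by case: Rs => _ _; apply.
pose AA q x := R x /\ forall a, R a -> U (q * a) -> U (x * a).
have [||_ [[q Qq ->] qmax]] := @noeth_max L R Rs R (fun J => exists2 q, Q q & J = AA q) nR.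
- move=> _ [q Qq ->]; split; last by move=> x [].
  split.
  + split; first exact: subring0.
    by move=> a _ _; rewrite mul0r; apply: (submod0 Us).
  + move=> x y [Rx Hx] [Ry Hy]; split; first exact: subringD.
    by move=> a Ra qa; rewrite mulrDl; apply: (submodD Us); [apply: Hx|apply: Hy].
  + move=> r x Rr [Rx Hx]; split; first exact: RM.
    by move=> a Ra qa; rewrite -mulrA; apply: (submodZ Us) => //; apply: Hx.
- by exists (AA 0), 0 => //; apply: (submod0 Qs).
exists q => // a Ra Uqa; apply: annQ => // q1 Qq1.
have Rq1 := QR _ Qq1; have Rq := QR _ Qq.
have Qq2 : Q (q + a * q1) by apply: (submodD Qs) => //; apply: (submodZ Qs).
have : AA q (q + a * q1).
  apply: (qmax (AA (q + a * q1))); first by exists (q + a * q1).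
    move=> x [Rx Hx]; split=> // b Rb Hb; apply: Hx => //.
    apply: Urad; first exact: RM.
    have -> : (q * b) ^+ 2
      = (q * b) * ((q + a * q1) * b) - (q1 * b ^+ 2) * (q * a) by ring.
    apply: (submodB Rs Us); apply: (submodZ Us) => //; first exact: RM.
    by apply: RM => //; apply: subringX.
  by split=> //; apply: QR.
move=> [_ /(_ a Ra Uqa) H]; apply: Urad; first exact: RM.
have -> : (a * q1) ^+ 2 = q1 * ((q + a * q1) * a - q * a) by ring.
by apply: (submodZ Us) => //; apply: (submodB Rs Us).
Qed.

Section LiftWeakNormality.
Variables (L : comNzRingType) (R : L -> Prop) (u v : L).
Hypotheses (Rs : is_subring R) (nR : noeth R R).
Hypotheses (Ru : R u) (uv : u * v = 1).
Hypothesis Gred : forall r n, R r -> R (v * r ^+ n) -> R (v * r).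

Let R1 : R 1. Proof. by case: Rs. Qed.
Let RM x y : R x -> R y -> R (x * y). Proof. by case: Rs => _ _; apply. Qed.
Let RB x y : R x -> R y -> R (x - y). Proof. by case: Rs => _ + _; apply. Qed.
Let RD x y : R x -> R y -> R (x + y). Proof. exact: subringD. Qed.
Let RX n x : R x -> R (x ^+ n). Proof. exact: subringX. Qed.

Let vK x : u * (v * x) = x. Proof. by rewrite mulrA uv mul1r. Qed.

(* w is almost integral, hence integral over the noetherian ring R; multiplying an
   integral equation of degree n by u^(n (k+1)) shows that u^(k+1) w is nilpotent
   modulo u R. *)
Lemma integral_closed k d w : R d -> (forall x, d * x = 0 -> x = 0) ->
  R (u ^+ k * w) -> (forall n, R (d * w ^+ n)) -> R w.
Proof.
move=> Rd dreg; elim: k => [|k IH]; first by rewrite mul1r.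
move=> Rk Rdw; apply: IH => //.
pose F n x := exists2 c : nat -> L, forall i, R (c i) &
  x = \sum_(i < n) c i * (d * w ^+ i).
have [||n HF] := @noeth_acc L R Rs R F nR.
- move=> n; split; first split.
  + by exists (fun=> 0); [move=> _; apply: subring0|rewrite big1 // => i _; rewrite mul0r].
  + move=> x y [c Rc ->] [c' Rc' ->]; exists (fun i => c i + c' i).
      by move=> i; apply: RD.
    by rewrite -big_split; apply: eq_bigr => i _; rewrite mulrDl.
  + move=> r x Rr [c Rc ->]; exists (fun i => r * c i); first by move=> i; apply: RM.
    by rewrite mulr_sumr; apply: eq_bigr => i _; rewrite mulrA.
  + move=> x [c Rc ->]; apply: subring_sum => // i _; exact: RM.
- move=> n x [c Rc ->]; exists (fun i => if (i < n)%N then c i else 0).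
    by move=> i; case: ifP => // _; apply: subring0.
  rewrite big_ord_recr /= ltnn mul0r addr0.
  by apply: eq_bigr => i _; rewrite ltn_ord.
have [c Rc ew] : F n (d * w ^+ n).
  apply: (HF n.+1); exists (fun i => (i == n)%:R).
    by move=> i; apply: subring_nat.
  rewrite big_ord_recr /= eqxx mul1r big1 ?add0r // => i _.
  by rewrite ltn_eqF ?mul0r.
have {}ew : w ^+ n = \sum_(i < n) c i * w ^+ i.
  apply/eqP; rewrite -subr_eq0; apply/eqP/dreg; rewrite mulrBr ew mulr_sumr.
  by apply/eqP; rewrite subr_eq0; apply/eqP/eq_bigr => i _; rewrite mulrCA.
have -> : u ^+ k * w = v * (u ^+ k.+1 * w).
  by rewrite exprS -!mulrA [v * _]mulrCA [v * _]mulrCA mulrCA vK.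
apply: (Gred (n := n)) => //.
rewrite exprMn ew mulr_sumr mulr_sumr; apply: subring_sum => // i _.
have -> : v * ((u ^+ k.+1) ^+ n * (c i * w ^+ i))
    = c i * (u ^+ (k.+1 * (n - i)).-1 * (u ^+ k.+1 * w) ^+ i).
  have -> : (u ^+ k.+1) ^+ n = u * u ^+ (k.+1 * (n - i)).-1 * (u ^+ k.+1) ^+ i.
    rewrite -exprS prednK ?muln_gt0 ?subn_gt0 //= -!exprM -exprD -mulnDr subnK //.
    exact: ltnW.
  rewrite exprMn -[RHS]vK; ring.
by do ?apply: RM => //; apply: RX.
Qed.

Section WeaklyNormal.
Variable p : nat.
Hypothesis pp : prime p.
Hypothesis Gwn : forall y z w d, R y -> R z -> R w -> R d ->
  (forall r, R r -> R (v * (d * r)) -> R (v * r)) ->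
  R (v * (z ^+ p - y * d ^+ p)) -> R (v * (p%:R * z - d * w)) ->
  exists x, [/\ R x, R (v * (y - x ^+ p)) & R (v * (w - p%:R * x))].
Variables (X d : L).
Hypothesis RXp : R (X ^+ p).
Let Q r := R r /\ forall i, R (r * X ^+ i).
Hypotheses (Qp : Q p%:R) (Qd : Q d) (dreg : forall x, d * x = 0 -> x = 0).

Let Qs : is_submod R Q.
Proof.
split; first by split=> [|i]; rewrite ?mul0r; apply: (subring0 Rs).
- by move=> x y [Rx RxX] [Ry RyX]; split=> [|i]; rewrite ?mulrDl; apply: RD.
- by move=> r x Rr [Rx RxX]; split=> [|i]; rewrite -?mulrA; apply: RM.
Qed.

Let QR q : Q q -> R q. Proof. by case. Qed.

Let Qreg r : R r -> Q (u * r) -> Q r.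
Proof.
move=> Rr [_ RurX]; split=> // i.
apply: (@root_closed _ _ _ _ Rs Ru uv Gred 1 p); first exact: prime_gt0.
  by rewrite mulrA expr1.
by rewrite exprMn exprAC; apply: RM => //; apply: RX.
Qed.

(** The multiplier ring of Q in L: it contains R and X, and Q is an ideal of it. *)
Let E s := forall q, Q q -> Q (s * q).

Let Es : is_subring E.
Proof.
split; first by move=> q; rewrite mul1r.
- move=> x y Ex Ey q Qq; rewrite mulrBl.
  by apply: (submodB Rs Qs); [apply: Ex|apply: Ey].
- by move=> x y Ex Ey q Qq; rewrite -mulrA; apply/Ex/Ey.
Qed.

Let ER r : R r -> E r. Proof. by move=> Rr q; apply: (submodZ Qs). Qed.

Let EX : E X.
Proof.
move=> q [Rq RqX]; split=> [|i]; first by have := RqX 1%N; rewrite expr1 mulrC.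
by have := RqX i.+1; rewrite exprS mulrA [q * X]mulrC.
Qed.

Let N s := E s /\ exists k, R ((u ^+ k * s) ^+ p).

Let Nle k j s : R ((u ^+ k * s) ^+ p) -> R ((u ^+ (j + k) * s) ^+ p).
Proof. by move=> H; rewrite exprD -mulrA exprMn; apply: RM => //; do 2!apply: RX. Qed.

(** Only closure under sums is delicate: the p-th power of a sum differs from the sum of the p-th
    powers by p x y h with h in E, and this lies in Q because p does. *)
Let Ns : is_submod R N.
Proof.
split.
- split; first by apply: ER; apply: subring0.
  by exists 0%N; rewrite mulr0 expr0n; apply: subring_nat.
- move=> x y [Ex [k Hx]] [Ey [j Hy]]; split; first exact: (subringD Es).
  exists (k + j)%N; rewrite mulrDr.
  have EuM z i : E z -> E (u ^+ i * z).
    by move=> Ez; have [_ _ EM] := Es; apply: EM => //; apply/ER/RX.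
  have [h Eh ->] := frobenius_expansion Es pp (EuM _ (k + j)%N Ex) (EuM _ (k + j)%N Ey).
  have Rx' : R ((u ^+ (k + j) * x) ^+ p) by rewrite addnC; apply: Nle.
  apply: RD; first by apply: RD => //; apply: Nle.
  rewrite mulrC; apply/QR/Eh; rewrite mulrC.
  have Exy : E (u ^+ (k + j) * x * (u ^+ (k + j) * y)).
    by have [_ _ EM] := Es; apply: EM; apply: EuM.
  exact: Exy.
- move=> r x Rr [Ex [k Hx]]; have [_ _ EM] := Es; split; first by apply: EM => //; apply: ER.
  by exists k; rewrite mulrCA exprMn; apply: RM => //; apply: RX.
Qed.

Let NR r : R r -> N r.
Proof. by move=> Rr; split; [exact: ER|exists 0%N; rewrite mul1r; apply: RX]. Qed.

Let NX i : N (X ^+ i).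
Proof.
split; first exact: (subringX Es).
by exists 0%N; rewrite mul1r exprAC; apply: RX.
Qed.

Let Np s : N s -> R (s ^+ p).
Proof.
move=> [Ess [k Rk]]; apply: (@integral_closed (k * p) d) => //; first exact: QR.
  by rewrite exprM -exprMn.
by move=> n; rewrite -exprM mulrC; apply: QR; apply: (subringX Es _ Ess).
Qed.

(** By [Qreg], an element v s q of R lies in Q as soon as u (v s q) = s q does. *)
Let Ndiv s : N s -> (forall q, Q q -> R (v * (s * q))) -> N (v * s).
Proof.
move=> [Ess [k Rk]] Hs; split.
  move=> q Qq; apply: Qreg; rewrite -mulrA; first exact: Hs.
  by rewrite vK; apply: Ess.
by exists k.+1; rewrite exprSr -mulrA vK.
Qed.

Let nN : exists t, forall x, N x <-> span R t x.
Proof.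
apply: (@noeth_mul _ _ [:: d]) => //.
  by move=> q x; rewrite inE => /eqP-> [Ex _]; rewrite mulrC; apply/QR/Ex.
by move=> x _ H; apply: dreg; apply: H; rewrite mem_head.
Qed.

(* v r stabilizes Q, so that it is integral over R. *)
Let annQ r : R r -> (forall q, Q q -> R (v * (r * q))) -> R (v * r).
Proof.
move=> Rr /(Ndiv (NR Rr))[Ew _].
apply: (@integral_closed 1 d) => //; first exact: QR.
  by rewrite expr1 vK.
by move=> n; rewrite mulrC; apply: QR; apply: (subringX Es _ Ew).
Qed.

(** It serves as the denominator in (ii), which has to be a nonzero divisor of R / u R and to
    multiply N into R. *)
Let regular_mod_u : exists2 q, Q q &
  forall r, R r -> R (v * (q * r)) -> R (v * r).
Proof.
apply: (regular_element Rs nR _ _ Qs QR annQ) => [|r]; last exact: Gred.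
split; first by rewrite mulr0; apply: subring0.
  by move=> x y; rewrite mulrDr; apply: RD.
by move=> r x Rr Rx; rewrite mulrCA; apply: RM.
Qed.

Let root_unique a b : R a -> R b -> R (v * (a ^+ p - b ^+ p)) ->
  R (v * (p%:R * (a - b))) -> R (v * (a - b)).
Proof.
move=> Ra Rb H1 H2; have Re : R (a - b) by apply: RB.
have [h Rh] := frobenius_expansion Rs pp Rb Re.
rewrite addrC subrK => e; apply: (Gred (n := p)) => //.
have -> : v * (a - b) ^+ p
    = v * (a ^+ p - b ^+ p) - (v * (p%:R * (a - b))) * (b * h) by rewrite e; ring.
by apply: RB => //; do ?apply: RM => //.
Qed.

Let approx s : N s -> exists2 x, R x & N (v * (s - x)).
Proof.
move=> Nsx; have [q0 Qq0 q0reg] := regular_mod_u.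
have [Ess _] := Nsx; have Rq0 := QR Qq0.
have Rps : R (p%:R * s) by rewrite mulrC; apply/QR/Ess.
(* For y = s^p, z = s q0, w = p s and d = q0 the equations of (ii) hold exactly, and all four
   elements lie in R even if s does not. *)
have [||x [Rx H1 H2]] := Gwn (Np Nsx) (QR (Ess _ Qq0)) Rps Rq0 q0reg.
- by rewrite exprMn subrr mulr0; apply: subring0.
- by rewrite mulrCA [q0 * _]mulrCA [q0 * s]mulrC mulrCA subrr mulr0; apply: subring0.
exists x => //; apply: Ndiv.
  by apply: (submodB Rs Ns) => //; apply: NR.
move=> q Qq; have Rq := QR Qq; rewrite mulrBl; apply: root_unique.
- exact/QR/Ess.
- exact: RM.
- by rewrite !exprMn -mulrBl mulrA; apply: RM => //; apply: RX.
- have -> : v * (p%:R * (s * q - x * q)) = v * (p%:R * s - p%:R * x) * q by ring.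
  exact: RM.
Qed.

Theorem lift_weakly_normal : exists2 r, R r /\ R (r * X) & exists2 s, R s & r + u * s = 1.
Proof.
have [t Ht] := nN; have [|b Rb Hb] := @nakayama _ _ u Rs Ru t R (subring_submod Rs).
  move=> a ta; have [|x Rx Nx] := @approx a; first by apply/Ht/span_mem.
  exists x => //; exists (v * (a - x)); last by rewrite vK.
  exact/Ht.
have R1ub : R (1 - u * b) by apply: RB => //; apply: RM.
exists (1 - u * b); last by exists b => //; rewrite subrK.
split=> //; have /Ht := NX 1; rewrite expr1.
have bs : is_submod R (fun x => R ((1 - u * b) * x)).
  split; first by rewrite mulr0; apply: subring0.
    by move=> x y; rewrite mulrDr; apply: RD.
  by move=> r x Rr H; rewrite mulrCA; apply: RM.
exact: (span_sub bs).
Qed.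

End WeaklyNormal.
End LiftWeakNormality.

(** * Polynomial rings *)

Section FractionField.
Variable D : comNzRingType.
Hypothesis Dint : forall x y : D, x * y = 0 -> (x == 0) || (y == 0).

(* The proof argument lets the copy of D carry the integral domain structure. *)
Definition domain_of (_ : forall x y : D, x * y = 0 -> (x == 0) || (y == 0)) : Type := D.
Local Notation T := (domain_of Dint).
HB.instance Definition _ := GRing.ComNzRing.copy T D.

Definition domain_unit (x : T) : bool := `[< exists y, y * x = 1 >].
Definition domain_inv (x : T) : T :=
  if pselect (exists y, y * x = 1) is left e then sval (cid e) else x.

Fact domain_mulVx : {in domain_unit, left_inverse 1 domain_inv *%R}.
Proof.
move=> x /asboolP ex; rewrite /domain_inv; case: pselect => // e.
by case: (cid e).
Qed.

Fact domain_unitPl (x y : T) : y * x = 1 -> domain_unit x.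
Proof. by move=> e; apply/asboolP; exists y. Qed.

Fact domain_inv_out : {in [predC domain_unit], domain_inv =1 id}.
Proof.
by move=> x; rewrite inE => /asboolP nx; rewrite /domain_inv; case: pselect.
Qed.

HB.instance Definition _ :=
  GRing.ComNzRing_hasMulInverse.Build T domain_mulVx domain_unitPl domain_inv_out.
HB.instance Definition _ := GRing.ComUnitRing_isIntegral.Build T Dint.

Lemma domain_in_field : exists (F : fieldType) (f : {rmorphism D -> F}),
  forall x, f x = 0 -> x = 0.
Proof.
exists {fraction T}, (@FracField.tofrac T : {rmorphism T -> {fraction T}}).
by move=> x /eqP; rewrite tofrac_eq0 => /eqP.
Qed.
End FractionField.

(** * Homomorphisms to fields, and products of fields *)

Section Separation.
Local Open Scope quotient_scope.
Variable A : comNzRingType.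
Hypotheses (nA : noethr A) (Ared : reduced A).

(** As A is reduced, 0 is an ideal without powers of a. A maximal ideal of this kind is prime, and
    the fraction field of its quotient does not kill a. *)
Lemma separating_field (a : A) : a != 0 ->
  exists (F : fieldType) (f : {rmorphism A -> F}), f a != 0.
Proof.
move=> a0.
have [||P [[Ps Pa] Pmax]] := @noeth_max A _ (subringT A) _
  (fun W => is_submod (fun=> True) W /\ forall n, ~ W (a ^+ n)) nA.
- by move=> W [].
- exists (fun x => x = 0); split; last by move=> n /Ared /eqP; apply/negP.
  by split=> // [x y -> ->|r x _ ->]; rewrite ?addr0 ?mulr0.
have meets x : ~ P x -> exists n r, P (a ^+ n - r * x).
  move=> nPx; apply: contrapT => H; apply: nPx.
  have Ws : is_submod (fun=> True) (addm P (mulm x (fun=> True))).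
    by apply: addm_submod => //; apply: mulm_submod.
  apply: (Pmax (addm P (mulm x (fun=> True)))).
  - split=> // n [p Pp [r _ e]]; apply: H; exists n, r.
    by rewrite mulrC -e opprB addrC subrK.
  - by apply: (@addml _ (fun=> True)); apply: mulm_submod.
  - by apply: (addmr Ps); exists 1; rewrite ?mulr1.
pose B : {pred A} := fun x => `[< P x >].
have Bcl : idealr_closed B.
  split; first by apply/asboolP; apply: (submod0 Ps).
    by apply/negP => /asboolP; rewrite -(expr0 a); apply: Pa.
  move=> r x y /asboolP Px /asboolP Py; apply/asboolP.
  by apply: (submodD Ps) => //; apply: (submodZ Ps).
have Bpr : prime_idealr_closed B.
  move=> x y /asboolP Pxy; apply/orP; apply: contrapT => /not_orP[nx ny].
  have [|n [r Pn]] := meets x; first by move=> Px; apply: nx; apply/asboolP.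
  have [|m [s Pm]] := meets y; first by move=> Py; apply: ny; apply/asboolP.
  apply: (Pa (n + m)%N).
  have -> : a ^+ (n + m) = a ^+ m * (a ^+ n - r * x) + (r * x) * (a ^+ m - s * y)
     + (r * s) * (x * y) by rewrite exprD; ring.
  by apply: (submodD Ps); [apply: (submodD Ps)|]; apply: (submodZ Ps).
pose I : prime_idealr A := HB.pack (B : A -> bool) (isIdealr.Build A B Bcl)
  (isPrimeIdealrClosed.Build A B Bpr).
have [F [f finj]] := domain_in_field (@Quotient.rquot_IdomainAxiom A I).
exists F, (f \o (\pi_{ideal_quot I} : {rmorphism A -> {ideal_quot I}})) => /=.
apply/eqP => /finj /eqP; rewrite -(rmorph0 \pi_{ideal_quot I}) /=.
rewrite eqmodE /= Quotient.equivE subr0 => /asboolP.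
by rewrite -(expr1 a); apply: Pa.
Qed.

(** The map g allows two demands on each field. If g(a) is a multiple of both a and a coefficient of
    the denominator d, then a and d survive together: the family of fields is jointly injective, and
    division by d is possible in every one. *)
Lemma separating_fields (g : A -> A) : (forall a, a != 0 -> g a != 0) ->
  exists (F : {a : A | a != 0} -> fieldType) (f : forall j, {rmorphism A -> F j}),
    forall j, f j (g (val j)) != 0.
Proof.
move=> Hg; pose H (j : {a : A | a != 0}) := cid (separating_field (@Hg (val j) (valP j))).
exists (fun j => sval (H j)), (fun j => sval (cid (svalP (H j)))) => j.
by case: (cid (svalP (H j))).
Qed.

End Separation.

(* The index j0 witnesses that the product is not the zero ring. *)
Definition prod_ring (J : Type) (F : J -> comNzRingType) (j0 : J) : Type :=
  forall j, F j.

Section ProductRing.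
Variables (J : Type) (F : J -> comNzRingType) (j0 : J).
Local Notation K := (prod_ring F j0).
Implicit Types x y : K.

HB.instance Definition _ := Choice.copy K (forall j, F j : choiceType).

Let ext x y : (forall j, x j = y j) -> x = y.
Proof. by move=> e; apply: functional_extensionality_dep. Qed.

Fact prod_addA : associative (fun x y : K => (fun j => x j + y j) : K).
Proof. by move=> x y z; apply: ext => j; rewrite addrA. Qed.
Fact prod_addC : commutative (fun x y : K => (fun j => x j + y j) : K).
Proof. by move=> x y; apply: ext => j; rewrite addrC. Qed.
Fact prod_add0 : left_id ((fun=> 0) : K) (fun x y : K => (fun j => x j + y j) : K).
Proof. by move=> x; apply: ext => j; rewrite add0r. Qed.
Fact prod_addN : left_inverse ((fun=> 0) : K) (fun x : K => (fun j => - x j) : K)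
  (fun x y : K => (fun j => x j + y j) : K).
Proof. by move=> x; apply: ext => j; rewrite addNr. Qed.
HB.instance Definition _ :=
  GRing.isZmodule.Build K prod_addA prod_addC prod_add0 prod_addN.

Fact prod_mulA : associative (fun x y : K => (fun j => x j * y j) : K).
Proof. by move=> x y z; apply: ext => j; rewrite mulrA. Qed.
Fact prod_mulC : commutative (fun x y : K => (fun j => x j * y j) : K).
Proof. by move=> x y; apply: ext => j; rewrite mulrC. Qed.
Fact prod_mul1 : left_id ((fun=> 1) : K) (fun x y : K => (fun j => x j * y j) : K).
Proof. by move=> x; apply: ext => j; rewrite mul1r. Qed.
Fact prod_mulD : left_distributive (fun x y : K => (fun j => x j * y j) : K) +%R.
Proof. by move=> x y z; apply: ext => j; rewrite mulrDl. Qed.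
Fact prod_1neq0 : ((fun=> 1) : K) != 0.
Proof.
apply/eqP => /(congr1 (fun x : K => x j0)) /eqP; apply/negP; exact: oner_neq0.
Qed.
HB.instance Definition _ := GRing.Zmodule_isComNzRing.Build K
  prod_mulA prod_mulC prod_mul1 prod_mulD prod_1neq0.

Definition prod_proj j (x : K) : F j := x j.

Fact prod_proj_zmod j : zmod_morphism (prod_proj j). Proof. by []. Qed.
Fact prod_proj_monoid j : monoid_morphism (prod_proj j). Proof. by []. Qed.
HB.instance Definition _ j := GRing.isZmodMorphism.Build K (F j) (prod_proj j)
  (prod_proj_zmod j).
HB.instance Definition _ j := GRing.isMonoidMorphism.Build K (F j) (prod_proj j)
  (prod_proj_monoid j).

Lemma prod_projP x y : (forall j, prod_proj j x = prod_proj j y) -> x = y.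
Proof. exact: ext. Qed.

Variables (A : comNzRingType) (f : forall j, {rmorphism A -> F j}).
Definition prod_map (a : A) : K := fun j => f j a.

Fact prod_map_zmod : zmod_morphism prod_map.
Proof. by move=> a b; apply: ext => j; rewrite /prod_map rmorphB. Qed.
Fact prod_map_monoid : monoid_morphism prod_map.
Proof.
split; first by apply: ext => j; rewrite /prod_map rmorph1.
by move=> a b; apply: ext => j; rewrite /prod_map rmorphM.
Qed.
HB.instance Definition _ := GRing.isZmodMorphism.Build A K prod_map prod_map_zmod.
HB.instance Definition _ := GRing.isMonoidMorphism.Build A K prod_map prod_map_monoid.
End ProductRing.

Lemma square_cube_inj (K : comNzRingType) (s t : K) :
  (forall x : K, x ^+ 2 = 0 -> x = 0) -> s ^+ 2 = t ^+ 2 -> s ^+ 3 = t ^+ 3 -> s = t.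
Proof.
move=> Kred e2 e3; apply/eqP; rewrite -subr_eq0; apply/eqP.
have H : (s - t) ^+ 3 = 0.
  have -> : (s - t) ^+ 3 = (s ^+ 3 - t ^+ 3) *+ 4 - (s ^+ 2 - t ^+ 2) * (s + t) *+ 3 by ring.
  by rewrite e2 e3 !subrr mul0r !mul0rn subrr.
by do 2!apply: (Kred); rewrite -exprM exprSr H mul0r.
Qed.

Lemma nilp_eq0 (K : comNzRingType) : (forall x : K, x ^+ 2 = 0 -> x = 0) -> reduced K.
Proof.
move=> Kred x n; have [m] := ubnP n; elim: m n => // m IH n nm xn.
case: n nm xn => [|[|n]] nm xn; rewrite ?expr1 // in xn.
  by rewrite -[x]mulr1 -(expr0 x) xn mulr0.
apply: (IH n.+1) => //; apply: Kred; rewrite -exprM muln2 -addnn.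
by rewrite addSn addnS -addSn -addSn exprD xn mul0r.
Qed.

(** * Polynomials with coefficients in a subring *)

Section PolyCoef.
Variables (K : comNzRingType) (S : K -> Prop).
Implicit Types (f g : {poly K}).

Definition coefs_in (P : K -> Prop) f := forall i, P f`_i.

Hypothesis Ss : is_subring S.
Let SM x y : S x -> S y -> S (x * y). Proof. by case: Ss => _ _; apply. Qed.
Let SB x y : S x -> S y -> S (x - y). Proof. by case: Ss => _ + _; apply. Qed.

Lemma coefs_subring : is_subring (coefs_in S).
Proof.
split.
- by move=> i; rewrite coef1; apply: subring_nat.
- by move=> f g Sf Sg i; rewrite coefB; apply: SB.
- by move=> f g Sf Sg i; rewrite coefM; apply: subring_sum => // k _; apply: SM.
Qed.

Lemma coefsC c : S c -> coefs_in S c%:P.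
Proof. by move=> Sc i; rewrite coefC; case: eqP => // _; apply: subring0. Qed.

Lemma coefsZ c f : S c -> coefs_in S f -> coefs_in S (c *: f).
Proof. by move=> Sc Sf i; rewrite coefZ; apply: SM. Qed.

Lemma coefs_submod P : is_submod S P -> is_submod (coefs_in S) (coefs_in P).
Proof.
move=> Ps; split.
- by move=> i; rewrite coef0; apply: (submod0 Ps).
- by move=> f g Pf Pg i; rewrite coefD; apply: (submodD Ps).
- move=> f g Sf Pg i; rewrite coefM; apply: (submod_sum Ps) => k _.
  exact: (submodZ Ps).
Qed.

Lemma poly_shift f : f = (f`_0)%:P + drop_poly 1 f * 'X.
Proof.
rewrite -{1}(poly_take_drop 1 f) expr1; congr (_ + _).
by apply/polyP => -[|i]; rewrite coef_take_poly coefC.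
Qed.

Lemma coefsXn (P : K -> Prop) f n : coefs_in P (f * 'X^n) -> coefs_in P f.
Proof. by move=> H i; have := H (i + n)%N; rewrite coefMXn ltnNge leq_addl addnK. Qed.

(** The coefficients of f are solved for in increasing order from those of y f; every further one
    costs one more factor y_0. *)
Lemma low_coef y f k : coefs_in S y -> coefs_in S (y * f) ->
  S (y`_0 ^+ k.+1 * f`_k).
Proof.
move=> Sy Syf; have [m] := ubnP k; elim: m k => // m IH k km.
have := Syf k; rewrite coefM big_ord_recl subn0 => /(SM (subringX Ss k (Sy 0%N))).
rewrite mulrDr mulrA -exprSr mulr_sumr => H.
rewrite -[X in S X](addrK (\sum_(i < k) y`_0 ^+ k * (y`_(lift ord0 i) * f`_(k - lift ord0 i)))).
apply: SB => //; apply: subring_sum => // i _.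
rewrite mulrCA; apply: SM => //=.
rewrite /bump /= add1n; have ik := ltn_ord i.
have -> : y`_0 ^+ k = y`_0 ^+ i * y`_0 ^+ (k - i.+1).+1.
  by rewrite -exprD; congr (_ ^+ _); lia.
rewrite -mulrA; apply: SM; first exact: subringX.
by apply: IH; lia.
Qed.

Lemma low_coef_denom y f : coefs_in S y -> coefs_in S (y * f) ->
  coefs_in S (y`_0 ^+ size f *: f).
Proof.
move=> Sy Syf i; rewrite coefZ; have [le|lt] := leqP (size f) i.
  by rewrite [f`_i]nth_default // mulr0; apply: subring0.
rewrite -(subnK lt) exprD -mulrA; apply: SM; first exact: subringX.
exact: low_coef.
Qed.

Hypothesis nS : noeth S S.

(** As for associated primes: a conductor that is maximal among those of the multiples of f outside
    S[X] is prime. *)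
Lemma prime_conductor f : ~ coefs_in S f -> exists2 a, S a &
  is_prime S (fun c => S c /\ coefs_in S (c *: (a *: f))).
Proof.
move=> Sf; pose C a c := S c /\ coefs_in S (c *: (a *: f)).
have Cs a : is_submod S (C a).
  split.
  - split; first exact: subring0.
    by rewrite scale0r => i; rewrite coef0; apply: subring0.
  - move=> x y [Sx Hx] [Sy Hy]; split; first exact: subringD.
    by rewrite scalerDl => i; rewrite coefD; apply: subringD.
  - move=> r x Sr [Sx Hx]; split; first exact: SM.
    by rewrite -scalerA; apply: coefsZ.
have S1 : S 1 by case: Ss.
have [||_ [[a [Sa Caf ->]] amax]] := @noeth_max K S Ss S
  (fun J => exists a, [/\ S a, ~ coefs_in S (a *: f) & J = C a]) nS.
- by move=> _ [a [Sa _ ->]]; split; [exact: Cs|move=> x []].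
- by exists (C 1), 1; rewrite scale1r.
exists a => //; split; [exact: Cs|by move=> x []|by move=> [_]; rewrite scale1r|].
move=> b c Sb Sc [Sbc Hbc]; have [Cb|nCb] := pselect (C a b); [by left|right].
apply: (amax (C (b * a))).
- exists (b * a); split=> //; first exact: SM.
  by move=> H; apply: nCb; split=> //; rewrite scalerA.
- move=> x [Sx Hx]; split=> //.
  by rewrite -(scalerA b a) scalerA mulrC -scalerA; apply: coefsZ.
- by split=> //; rewrite -(scalerA b a) scalerA mulrC.
Qed.

Let cs := coefs_subring.
Let csM f g : coefs_in S f -> coefs_in S g -> coefs_in S (f * g).
Proof. by case: cs => _ _; apply. Qed.
Let csB f g : coefs_in S f -> coefs_in S g -> coefs_in S (f - g).
Proof. by case: cs => _ + _; apply. Qed.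

Lemma conductor_shift f c : S f`_0 -> S c ->
  coefs_in S (c *: drop_poly 1 f) <-> coefs_in S (c *: f).
Proof.
move=> Sf0 Sc; split=> H i; last first.
  by have := H i.+1; rewrite !coefZ coef_drop_poly addn1.
case: i => [|i]; first by rewrite coefZ; apply: SM.
by have := H i; rewrite !coefZ coef_drop_poly addn1.
Qed.

(* The constant coefficient f_0 of f lies in S by assumption, and in the prime
   conductor P of f by low_coef, so that (f - f_0) / X satisfies the same hypotheses
   with the same conductor. *)
Lemma poly_seminormal : (forall s, S (s ^+ 2) -> S (s ^+ 3) -> S s) ->
  forall f, coefs_in S (f ^+ 2) -> coefs_in S (f ^+ 3) -> coefs_in S f.
Proof.
move=> sn f f2 f3; apply: contrapT => /prime_conductor[a Sa].
have {f2}: coefs_in S ((a *: f) ^+ 2).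
  by rewrite exprZn; apply: coefsZ => //; apply: subringX.
have {f3}: coefs_in S ((a *: f) ^+ 3).
  by rewrite exprZn; apply: coefsZ => //; apply: subringX.
move: (a *: f) => {a Sa f} f.
have [n] := ubnP (size f); elim: n f => // n IH f sf f3 f2 Pp.
have Sf0 : S f`_0.
  by apply: sn; [move: (f2 0%N)|move: (f3 0%N)]; rewrite !exprS ?expr0 !mulr1 !coef0M.
have Pf0 : coefs_in S (f`_0 *: f).
  have [||//] := @prime_exp _ S Ss _ f`_0 (2 * size f) Pp => //; split.
    exact: subringX.
  rewrite exprM; have -> : f`_0 ^+ 2 = (f ^+ 2)`_0 by rewrite !expr2 coef0M.
  by apply: low_coef_denom => //; rewrite -exprSr.
have eX : drop_poly 1 f * 'X = f - (f`_0)%:P by rewrite {2}[f]poly_shift addrC addKr.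
have f0P : (f`_0)%:P * f = f`_0 *: f by rewrite mul_polyC.
have [s0|s0] := posnP (size f).
  have f00' : f = 0 by apply/eqP; rewrite -size_poly_eq0 s0.
  case: Pp => _ _ + _; apply; split; first by case: Ss.
  by rewrite f00' scaler0 => i; rewrite coef0; apply: subring0.
apply: (IH (drop_poly 1 f)).
- by rewrite size_drop_poly; move: sf s0; case: (size f) => // k; rewrite subn1.
- apply: (@coefsXn _ _ 3); rewrite -exprMn eX.
  have -> : (f - (f`_0)%:P) ^+ 3 = f ^+ 3 - (f`_0)%:P * f ^+ 2 *+ 3
      + (f`_0)%:P * ((f`_0)%:P * f) *+ 3 - (f`_0)%:P ^+ 3 by ring.
  rewrite f0P; have Sc := coefsC Sf0.
  apply: csB; last exact: (subringX cs).
  apply: (subringD cs); first apply: csB => //.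
    by apply: (subringMn cs); apply: csM.
  by apply: (subringMn cs); apply: csM.
- apply: (@coefsXn _ _ 2); rewrite -exprMn eX.
  have -> : (f - (f`_0)%:P) ^+ 2 = f ^+ 2 - ((f`_0)%:P * f) *+ 2 + (f`_0)%:P ^+ 2 by ring.
  rewrite f0P; apply: (subringD cs); last by apply: (subringX cs); apply: coefsC.
  by apply: csB => //; apply: (subringMn cs).
- have -> // : (fun c => S c /\ coefs_in S (c *: drop_poly 1 f)) =
    (fun c => S c /\ coefs_in S (c *: f)).
  apply: funext => c; apply: propext.
  by split=> -[Sc H]; split=> //; apply/(conductor_shift Sf0 Sc).
Qed.

(** This is reducedness of (S / P)[X]. The constant coefficient is in P because P is prime, and it
    can be subtracted and the rest divided by X without losing the hypotheses. *)
Lemma coefs_prime_exp P n f : is_prime S P -> (0 < n)%N -> coefs_in S f ->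
  coefs_in P (f ^+ n) -> coefs_in P f.
Proof.
move=> Pp n0; have [Ps _ _ _] := Pp; have CPs := coefs_submod Ps.
have [m] := ubnP (size f); elim: m f => // m IH f sf Sf Pf.
have Pf0 : P f`_0.
  apply: (@prime_exp _ S Ss _ _ n) => //.
  by have := Pf 0%N; rewrite -!horner_coef0 horner_exp.
have [s0|s0] := posnP (size f).
  have -> : f = 0 by apply/eqP; rewrite -size_poly_eq0 s0.
  exact: (submod0 CPs).
have Sf0 : coefs_in S (f`_0)%:P by apply: coefsC.
have Pf0P : coefs_in P (f`_0)%:P.
  by move=> i; rewrite coefC; case: eqP => // _; apply: (submod0 Ps).
suff : coefs_in P (drop_poly 1 f).
  move=> H [|i]; first exact: Pf0.
  by have := H i; rewrite coef_drop_poly addn1.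
have eX : drop_poly 1 f * 'X = f - (f`_0)%:P by rewrite {2}[f]poly_shift addrC addKr.
apply: IH.
- by rewrite size_drop_poly; move: sf s0; case: (size f) => // k; rewrite subn1.
- by move=> i; rewrite coef_drop_poly.
- apply: (@coefsXn _ _ n); rewrite -exprMn eX.
  rewrite -[X in coefs_in P X](subrK (f ^+ n)); apply: (submodD CPs) => //.
  rewrite subrXX addrAC subrr add0r mulrC.
  have Sf' : coefs_in S (f - (f`_0)%:P) by apply: csB.
  apply: (submodZ CPs); last exact: (submodN cs CPs).
  by apply: (subring_sum cs) => i _; apply: csM; apply: (subringX cs).
Qed.

(** As in [poly_seminormal], f is replaced by (f - f_0) / X without changing its prime conductor P.
    The p-th power of f - f_0 stays in S[X] because p lies in P and f maps P[X] into itself: for b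
    in P, the polynomial b f has coefficients in S and (b f)^p = b^p f^p lies in P[X], so
    [coefs_prime_exp] applies. *)
Lemma poly_weakly_normal p : prime p ->
  (forall s c, S c -> (forall a, S a -> c * a = 0 -> a = 0) -> S (c * s) ->
     S (s ^+ p) -> S (p%:R * s) -> S s) ->
  forall f c, S c -> (forall a, S a -> c * a = 0 -> a = 0) ->
  coefs_in S (c *: f) -> coefs_in S (f ^+ p) -> coefs_in S (p%:R *: f) ->
  coefs_in S f.
Proof.
move=> pp wn f c Sc creg cf fp pf; apply: contrapT => /prime_conductor[a Sa].
have {cf}: coefs_in S (c *: (a *: f)).
  by rewrite scalerA mulrC -scalerA; apply: coefsZ.
have {pf}: coefs_in S (p%:R *: (a *: f)).
  by rewrite scalerA mulrC -scalerA; apply: coefsZ.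
have {fp}: coefs_in S ((a *: f) ^+ p).
  by rewrite exprZn; apply: coefsZ => //; apply: subringX.
move: (a *: f) => {a Sa f} f.
have [n] := ubnP (size f); elim: n f => // n IH f sf fp pf cf.
set P := fun _ => _ /\ _ => Pp; have [Ps PS P1 _] := Pp.
have CPs := coefs_submod Ps.
have Pc : P c by [].
have Pprime : P p%:R by split=> //; apply: subring_nat.
have Sf0 : S f`_0.
  apply: (wn _ c) => //; last 1 [by have := pf 0%N; rewrite coefZ].
  - by have := cf 0%N; rewrite coefZ.
  - by have := fp 0%N; rewrite -!horner_coef0 horner_exp.
have [s0|s0] := posnP (size f).
  have f00' : f = 0 by apply/eqP; rewrite -size_poly_eq0 s0.
  apply: P1; split; first by case: Ss.
  by rewrite f00' scaler0 => i; rewrite coef0; apply: subring0.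
pose E g := forall h, coefs_in P h -> coefs_in P (g * h).
have Es : is_subring E.
  split; first by move=> h; rewrite mul1r.
  - by move=> x y Ex Ey h Ph; rewrite mulrBl; apply: (submodB cs CPs);
      [apply: Ex|apply: Ey].
  - by move=> x y Ex Ey h Ph; rewrite -mulrA; apply/Ex/Ey.
have ES g : coefs_in S g -> E g by move=> Sg h; apply: (submodZ CPs).
have Ef : E f.
  move=> h Ph; rewrite -[h]coefK poly_def mulr_sumr.
  apply: (submod_sum CPs) => i _.
  have -> : f * (h`_i *: 'X^i) = 'X^i * (h`_i *: f) by rewrite -!scalerAr mulrC.
  apply: (submodZ CPs); first by move=> k; rewrite coefXn; apply: subring_nat.
  apply: (@coefs_prime_exp P p) => //; first exact: prime_gt0.
    by case: (Ph i).
  rewrite exprZn -mul_polyC mulrC; apply: (submodZ CPs) => // k; rewrite coefC.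
  case: eqP => _; last exact: (submod0 Ps).
  rewrite -(prednK (prime_gt0 pp)) exprSr; apply: (submodZ Ps) => //.
  exact/(subringX Ss)/PS.
have eX : drop_poly 1 f * 'X = f + - (f`_0)%:P by rewrite {2}[f]poly_shift addrC addKr.
have Sc0 : coefs_in S (- (f`_0)%:P) by apply/(subringN cs)/coefsC.
apply: (IH (drop_poly 1 f)).
- by rewrite size_drop_poly; move: sf s0; case: (size f) => // k; rewrite subn1.
- apply: (@coefsXn _ _ p); rewrite -exprMn eX.
  have [h Eh ->] := frobenius_expansion Es pp Ef (ES _ Sc0).
  apply: (subringD cs); first by apply: (subringD cs) => //; apply: (subringX cs).
  move=> i; apply: PS; move: i; rewrite mulrC; apply: Eh; rewrite mulrC.
  have [_ _ EM] := Es; apply: (EM _ _ Ef (ES _ Sc0)) => i.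
  rewrite -polyC_natr coefC; case: eqP => // _; exact: (submod0 Ps).
- by apply/conductor_shift => //; apply: subring_nat.
- exact/conductor_shift.
- have -> // : (fun c => S c /\ coefs_in S (c *: drop_poly 1 f)) = P.
  apply: funext => b; apply: propext.
  by split=> -[Sb H]; split=> //; apply/(conductor_shift Sf0 Sb).
Qed.

Hypothesis Kred : forall x : K, x ^+ 2 = 0 -> x = 0.

(** The polynomial denominator d is traded for a constant one. If b is nonzero and b d_i is the
    lowest nonzero coefficient of b d, then [low_coef_denom] puts a power of b d_i into the
    conductor of f. So b cannot kill the conductor, as a power of b d_i would vanish, and
    [regular_element] applies. *)
Lemma poly_denominator d f : coefs_in S d ->
  (forall a, S a -> (forall i, a * d`_i = 0) -> a = 0) ->
  coefs_in S (d * f) ->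
  exists c, [/\ S c, forall a, S a -> c * a = 0 -> a = 0 & coefs_in S (c *: f)].
Proof.
move=> Sd dreg Sdf; pose C c := S c /\ coefs_in S (c *: f).
have Cs : is_submod S C.
  split.
  - split; first exact: subring0.
    by rewrite scale0r => i; rewrite coef0; apply: subring0.
  - move=> x y [Sx Hx] [Sy Hy]; split; first exact: subringD.
    by rewrite scalerDl; apply: (subringD cs).
  - move=> r x Sr [Sx Hx]; split; first exact: SM.
    by rewrite -scalerA; apply: coefsZ.
have [|||||q [Sq Cq] qreg] := @regular_element K S (fun x => x = 0) C Ss nS.
- by split=> // [x y -> ->|r x _ ->]; rewrite ?addr0 ?mulr0.
- by move=> r _; apply: Kred.
- exact: Cs.
- by move=> x [].
- move=> b Sb bC; apply: contrapT => b0.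
  have exi : exists i, b * d`_i != 0.
    apply: contrapT => H; apply: b0; apply: dreg => // i.
    by apply: contrapT => /eqP ni; apply: H; exists i.
  case: (ex_minnP exi) => i ni imin.
  pose d' := drop_poly i (b *: d).
  have ed : b *: d = d' * 'X^i.
    rewrite -{1}(poly_take_drop i (b *: d)); suff -> : take_poly i (b *: d) = 0.
      by rewrite add0r.
    apply/polyP => k; rewrite coef_take_poly coef0 coefZ; case: ifP => // ki.
    apply: contrapT => /eqP /imin; lia.
  have d'0 : d'`_0 = b * d`_i by rewrite coef_drop_poly add0n coefZ.
  have Cd' : C (d'`_0 ^+ size f).
    split; first by rewrite d'0; apply: (subringX Ss); apply: SM.
    apply: low_coef_denom.
      by move=> k; rewrite coef_drop_poly coefZ; apply: SM.
    apply: (@coefsXn _ _ i); rewrite mulrAC -ed -scalerAl; exact: coefsZ.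
  case/negP: ni; apply/eqP; apply: (nilp_eq0 Kred (n := (size f).+1)).
  by rewrite exprSr -d'0 {2}d'0 mulrCA mulrA bC // mul0r.
exists q; split=> // a Sa; exact: qreg.
Qed.

End PolyCoef.

Lemma root_inj p (K : comNzRingType) (s t : K) : prime p ->
  (forall x : K, x ^+ 2 = 0 -> x = 0) -> s ^+ p = t ^+ p ->
  p%:R * s = p%:R * t -> s = t.
Proof.
move=> pp Kred ep e1; apply/eqP; rewrite -subr_eq0; apply/eqP.
apply: (nilp_eq0 Kred (n := p)).
have [h _] := frobenius_expansion (subringT K) pp (x := t) (y := s - t) I I.
rewrite addrC subrK ep => /eqP; rewrite -addrA -subr_eq0 opprD addrA subrr sub0r.
rewrite oppr_eq0 [t * _]mulrC mulrA mulrBr e1 subrr !mul0r addr0.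
by move=> /eqP.
Qed.

Lemma joint_red (J : Type) (F : J -> fieldType) (K : comNzRingType)
    (pr : forall j, {rmorphism K -> F j}) :
  (forall x y : K, (forall j, pr j x = pr j y) -> x = y) ->
  forall x : K, x ^+ 2 = 0 -> x = 0.
Proof.
move=> prP x x2; apply: prP => j; apply/eqP; rewrite rmorph0.
have : pr j x ^+ 2 == 0 by rewrite -rmorphXn x2 rmorph0.
by rewrite expf_eq0.
Qed.

Lemma range_seminormal (A K : comNzRingType) (iota : {rmorphism A -> K}) :
  injective iota -> (forall x : K, x ^+ 2 = 0 -> x = 0) -> seminormal_cond A ->
  forall s, rangep iota (s ^+ 2) -> rangep iota (s ^+ 3) -> rangep iota s.
Proof.
move=> iota_inj Kred sn s [a ea] [b eb]; have [|x [ax bx]] := sn a b.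
  by apply: iota_inj; rewrite !rmorphXn -ea -eb -!exprM.
exists x; apply: (square_cube_inj Kred); first by rewrite ea ax rmorphXn.
by rewrite eb bx rmorphXn.
Qed.

(** * Passage from A to its polynomial ring *)

Section PolyRing.
Variable A : comNzRingType.
Hypotheses (nA : noethr A) (Ared : reduced A).

Lemma poly_field_seminormal (F : fieldType) (y z : {poly F}) :
  y ^+ 3 = z ^+ 2 -> exists2 X, X ^+ 2 = y & X ^+ 3 = z.
Proof.
have [->|y0] := eqVneq y 0.
  move=> /esym/eqP; rewrite expr0n /= expf_eq0 /= => /eqP->.
  by exists 0; rewrite expr0n mulr0n.
move=> e; have yz : y %| z.
  by rewrite -(@dvdp_pexp2r _ y z 2) // -e exprS dvdp_mull.
exists (z %/ y).
  by apply: (mulIf (expf_neq0 2 y0)); rewrite -exprMn divpK // -e.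
apply: (mulIf (expf_neq0 3 y0)); rewrite -exprMn divpK // e.
by rewrite exprSr mulrC.
Qed.

Lemma poly_field_weakly_normal (F : fieldType) p (y z w d : {poly F}) :
  (0 < p)%N -> d != 0 -> z ^+ p = y * d ^+ p -> p%:R * z = d * w ->
  exists X, [/\ X ^+ p = y, p%:R * X = w & d * X = z].
Proof.
move=> p0 d0 e1 e2; have dz : d %| z.
  by rewrite -(@dvdp_pexp2r _ d z p) // e1 dvdp_mull.
exists (z %/ d); split.
- by apply: (mulIf (expf_neq0 p d0)); rewrite -exprMn divpK.
- by apply: (mulfI d0); rewrite mulrCA mulrC [d * _]mulrC divpK // mulrC.
- by rewrite mulrC divpK.
Qed.

Section Embedding.
Variables (J : Type) (F : J -> fieldType) (f : forall j, {rmorphism A -> F j}).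
Hypothesis fsep : forall a : A, (forall j, f j a = 0) -> a = 0.
Variables (K : comNzRingType) (pr : forall j, {rmorphism K -> F j}).
Hypothesis prP : forall x y : K, (forall j, pr j x = pr j y) -> x = y.
Hypothesis pr_surj : forall x : (forall j, F j), exists k, forall j, pr j k = x j.
Variable iota : {rmorphism A -> K}.
Hypothesis pr_iota : forall j a, pr j (iota a) = f j a.
Let S := rangep iota.

Lemma iota_inj : injective iota.
Proof.
move=> a b e; apply/eqP; rewrite -subr_eq0; apply/eqP/fsep => j.
by rewrite rmorphB -!pr_iota e subrr.
Qed.

Let prod_red : forall x : K, x ^+ 2 = 0 -> x = 0 := joint_red prP.

Lemma poly_prodP (g h : {poly K}) :
  (forall j, map_poly (pr j) g = map_poly (pr j) h) -> g = h.
Proof.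
move=> e; apply/polyP => i; apply: prP => j.
by have := congr1 (fun q : {poly _} => q`_i) (e j); rewrite !coef_map.
Qed.

Lemma map_proj_map j (y : {poly A}) :
  map_poly (pr j) (map_poly iota y) = map_poly (f j) y.
Proof. by apply/polyP => i; rewrite !coef_map /= pr_iota. Qed.

(** A family of polynomials over the factors comes from K[X] only if its degrees are bounded; in the
    applications the bound comes from a power of the family that is the image of a fixed
    polynomial. *)
Lemma poly_prod_lift n (X : forall j, {poly F j}) :
  (forall j, (size (X j) <= n)%N) ->
  exists g : {poly K}, forall j, map_poly (pr j) g = X j.
Proof.
move=> sX; have [k Hk] := choice (fun i => pr_surj (fun j => (X j)`_i)).
exists (\poly_(i < n) k i) => j.
apply/polyP => i; rewrite coef_map coef_poly; case: ltnP => // ni.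
  exact: Hk.
by rewrite raddf0 nth_default // (leq_trans (sX j)).
Qed.

Lemma size_root (T : fieldType) (g : {poly T}) n m : (0 < n)%N ->
  (size (g ^+ n) <= m)%N -> (size g <= m)%N.
Proof.
move=> n0; have [->|g0] := eqVneq g 0; first by rewrite size_poly0.
apply: leq_trans; have := size_exp g n.
have : (0 < size g)%N by rewrite size_poly_gt0.
have : (0 < size (g ^+ n))%N by rewrite size_poly_gt0 expf_neq0.
by move: n0; case: n (size g) (size (g ^+ _)) => // n [|a] [|b] //=; nia.
Qed.

Lemma range_coefs (g : {poly K}) : coefs_in S g -> exists x, g = map_poly iota x.
Proof.
move=> /choice[a Ha]; exists (\poly_(i < size g) a i); apply/polyP => i.
rewrite coef_map coef_poly; case: ltnP => // gi.
by rewrite raddf0 nth_default.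
Qed.

Lemma coefs_range x : coefs_in S (map_poly iota x).
Proof. by move=> i; rewrite coef_map; exists x`_i. Qed.

Lemma map_iota_inj : injective (map_poly iota).
Proof.
move=> x y e; apply/polyP => i; apply: iota_inj.
by have := congr1 (fun q : {poly _} => q`_i) e; rewrite !coef_map.
Qed.

Let Ss : is_subring S := rangep_subring iota.
Let nS : noeth S S := noeth_range (f := iota) nA.

Lemma embedded_seminormal (y z : {poly A}) : seminormal_cond A ->
  y ^+ 3 = z ^+ 2 -> exists x, y = x ^+ 2 /\ z = x ^+ 3.
Proof.
move=> sn e; have H j : exists X, X ^+ 2 = map_poly (f j) y /\ X ^+ 3 = map_poly (f j) z.
  have [|X X2 X3] := @poly_field_seminormal _ (map_poly (f j) y) (map_poly (f j) z).
    by rewrite -!rmorphXn e.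
  by exists X.
have [|g Hg] := @poly_prod_lift (size y) (fun j => sval (cid (H j))).
  move=> j; case: (cid (H j)) => /= X [X2 _].
  by apply: (@size_root _ _ 2) => //; rewrite X2 size_poly.
have g2 : g ^+ 2 = map_poly iota y.
  apply: poly_prodP => j; rewrite rmorphXn /= Hg map_proj_map.
  by case: (cid (H j)) => X [].
have g3 : g ^+ 3 = map_poly iota z.
  apply: poly_prodP => j; rewrite rmorphXn /= Hg map_proj_map.
  by case: (cid (H j)) => X [].
have [|x ex] := @range_coefs g.
  apply: (poly_seminormal Ss nS).
  - exact: (range_seminormal iota_inj prod_red sn).
  - by rewrite g2; apply: coefs_range.
  - by rewrite g3; apply: coefs_range.
by exists x; split; apply: map_iota_inj; rewrite rmorphXn /= -ex.
Qed.

Lemma embedded_weakly_normal p (y z w d : {poly A}) : weakly_normal_cond A ->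
  prime p -> (forall a, (forall i, a * d`_i = 0) -> a = 0) ->
  (forall j, map_poly (f j) d != 0) ->
  z ^+ p = y * d ^+ p -> p%:R * z = d * w -> exists x, y = x ^+ p /\ w = p%:R * x.
Proof.
move=> wn pp dreg d0 e1 e2.
have H j : exists X, [/\ X ^+ p = map_poly (f j) y, p%:R * X = map_poly (f j) w
    & map_poly (f j) d * X = map_poly (f j) z].
  apply: (poly_field_weakly_normal (prime_gt0 pp) (d0 j)).
    by rewrite -!rmorphXn -rmorphM e1.
  by rewrite -rmorphM -e2 rmorphM rmorph_nat.
have [|g Hg] := @poly_prod_lift (size y) (fun j => sval (cid (H j))).
  move=> j; case: (cid (H j)) => /= X [X2 _ _].
  by apply: (@size_root _ _ p); [exact: prime_gt0|rewrite X2 size_poly].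
have gp : g ^+ p = map_poly iota y.
  apply: poly_prodP => j; rewrite rmorphXn /= Hg map_proj_map.
  by case: (cid (H j)) => X [].
have gw : p%:R *: g = map_poly iota w.
  rewrite -mul_polyC polyC_natr; apply: poly_prodP => j.
  rewrite rmorphM rmorph_nat /= Hg map_proj_map.
  by case: (cid (H j)) => X [].
have gd : map_poly iota d * g = map_poly iota z.
  apply: poly_prodP => j; rewrite rmorphM /= Hg !map_proj_map.
  by case: (cid (H j)) => X [].
have [|||c [[c' ec] creg cg]] := poly_denominator Ss nS prod_red (d := map_poly iota d) (f := g).
- exact: coefs_range.
- move=> _ [a ->] Ha; rewrite (dreg a) ?rmorph0 // => i; apply: iota_inj.
  by have := Ha i; rewrite coef_map -rmorphM rmorph0.
- by rewrite gd; apply: coefs_range.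
have [|x ex] := @range_coefs g.
  apply: (poly_weakly_normal Ss nS pp _ (c := c)) => //.
  + move=> s b [b' eb] breg [z' ez] [y' ey] [w' ew].
    have [||||x [yx wx]] := wn y' z' w' b' p.
    * move=> a1 a2 ba; apply/eqP; rewrite -subr_eq0; apply/eqP/iota_inj.
      rewrite rmorph0; apply: breg; first by exists (a1 - a2).
      by rewrite eb -rmorphM mulrBr ba subrr rmorph0.
    * exact: pp.
    * by apply: iota_inj; rewrite rmorphM !rmorphXn -ez -ey -eb exprMn mulrC.
    * by apply: iota_inj; rewrite !rmorphM rmorph_nat -ez -eb -ew mulrCA.
    exists x; apply: (root_inj pp prod_red).
      by rewrite ey yx rmorphXn.
    by rewrite ew wx rmorphM rmorph_nat.
  + by exists c'.
  + by rewrite gp; apply: coefs_range.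
  + by rewrite gw; apply: coefs_range.
exists x; split; apply: map_iota_inj; first by rewrite rmorphXn /= -ex.
by rewrite rmorphM rmorph_nat /= -ex -gw -mul_polyC polyC_natr.
Qed.

End Embedding.

Lemma product_of_fields (J : Type) (j0 : J) (F : J -> fieldType)
    (f : forall j, {rmorphism A -> F j}) :
  exists (K : comNzRingType) (pr : forall j, {rmorphism K -> F j})
    (iota : {rmorphism A -> K}),
    [/\ forall x y : K, (forall j, pr j x = pr j y) -> x = y,
      forall x : (forall j, F j), exists k, forall j, pr j k = x j &
      forall j a, pr j (iota a) = f j a].
Proof.
exists (prod_ring (fun j => F j : comNzRingType) j0).
exists (fun j => @prod_proj J (fun j => F j) j0 j), (prod_map j0 f).
by split=> // [x y|x]; [exact: prod_projP|exists x].
Qed.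

Let one_index : {a : A | a != 0} := exist _ 1 (oner_neq0 A).

Lemma seminormal_poly : seminormal_cond A -> seminormal_cond {poly A}.
Proof.
move=> sn y z e; have [|F [f Hf]] := separating_fields nA Ared (g := id) => //.
have [K [pr [iota [prP pr_surj pr_iota]]]] := product_of_fields one_index f.
apply: (embedded_seminormal _ prP pr_surj pr_iota) => // a fa.
by apply: contrapT => /eqP a0; have := Hf (exist _ a a0); rewrite fa eqxx.
Qed.

Lemma weakly_normal_poly p (y z w d : {poly A}) : weakly_normal_cond A ->
  prime p -> (forall a, (forall i, a * d`_i = 0) -> a = 0) ->
  z ^+ p = y * d ^+ p -> p%:R * z = d * w -> exists x, y = x ^+ p /\ w = p%:R * x.
Proof.
move=> wn pp dreg e1 e2.
(* For nonzero a some a d_i is nonzero. A field in which it survives keeps both a and the polynomial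
   d nonzero. *)
have Hg a : exists b, a != 0 -> b != 0 /\ exists i, b = a * d`_i.
  have [->|a0] := eqVneq a 0; first by exists 0.
  have [[i bi]|H] := pselect (exists i, a * d`_i != 0).
    by exists (a * d`_i); split=> //; exists i.
  case/eqP: a0; apply: dreg => i; apply: contrapT => /eqP bi.
  by apply: H; exists i.
have [g {}Hg] := choice Hg.
have [a a0|F [f Hf]] := separating_fields nA Ared (g := g); first by case: (Hg a a0).
have [K [pr [iota [prP pr_surj pr_iota]]]] := product_of_fields one_index f.
apply: (embedded_weakly_normal _ prP pr_surj pr_iota wn pp dreg _ e1 e2).
  move=> a fa; apply: contrapT => /eqP a0; have := Hf (exist _ a a0).
  have [_ [i /= ->]] := Hg a a0.
  by rewrite rmorphM fa mul0r eqxx.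
move=> j; apply/eqP => d0; have := Hf j.
have [_ [i /= ->]] := Hg (val j) (valP j).
rewrite rmorphM -coef_map d0 coef0 mulr0 eqxx //.
Qed.

End PolyRing.

(** * Rees rings *)

Section LaurentRing.
Variable K : comNzRingType.
Implicit Types (f g : laurent K) (a b : K) (m n : int).

Definition monom a n : laurent K := << a *g n >>.

Lemma mcoeff_monom a m n : (monom a m)@_n = a *+ (m == n).
Proof. exact: mcoeffU. Qed.

Lemma monomM a b m n : monom a m * monom b n = monom (a * b) (m + n).
Proof. exact: laurentMUU. Qed.

Lemma monom0 n : monom 0 n = 0.
Proof. exact: monalgU0. Qed.

Lemma monom1 : monom 1 0 = 1. Proof. by []. Qed.

Lemma laurentP f g : (forall n, f@_n = g@_n) -> f = g.
Proof. by move=> e; apply/malgP. Qed.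

Lemma mcoeff_monomM a m f n : (monom a m * f)@_n = a * f@_(n - m).
Proof.
have ef : f = \sum_(k <- msupp f) monom f@_k k by exact: monalgE.
rewrite [in LHS]ef [in RHS]ef mulr_sumr.
rewrite (raddf_sum (mcoeff n)) (raddf_sum (mcoeff (n - m))) mulr_sumr.
apply: eq_bigr => k _; rewrite monomM /= !mcoeff_monom mulrnAr.
by congr (_ *+ (_ : bool)); rewrite -subr_eq0 -[RHS]subr_eq0; congr (_ == _); lia.
Qed.

Lemma monomX a m k : monom a m ^+ k = monom (a ^+ k) (m *+ k).
Proof.
elim: k => [|k IH]; first by rewrite !expr0 mulr0n monom1.
by rewrite !exprS IH monomM mulrS.
Qed.

Lemma laurent_bound f : exists B : nat, forall n, f@_n != 0 -> (`|n| <= B)%N.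
Proof.
exists (\max_(n <- msupp f) `|n|)%N => n; rewrite mcoeff_neq0 => nf.
exact: (@leq_bigmax_seq _ (enum_fset (msupp f)) xpredT (fun n : int => absz n) n).
Qed.

End LaurentRing.

Section PolyLaurent.
Variables (A K : comNzRingType) (iota : {rmorphism A -> K}).

Definition const_laurent : A -> laurent K := in_alg (laurent K) \o iota.
HB.instance Definition _ := GRing.RMorphism.on const_laurent.

Lemma const_laurentE a : const_laurent a = monom (iota a) 0.
Proof.
by apply: laurentP => n; rewrite mcoeffZ mcoeff_monom mcoeff_laurent1 eq_sym mulr_natr.
Qed.

Fact const_laurent_comm : commr_rmorph const_laurent (monom 1 1).
Proof. by move=> a; apply: mulrC. Qed.

Definition poly_laurent : {rmorphism {poly A} -> laurent K} :=
  horner_morph const_laurent_comm.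

Lemma mcoeff_poly_laurent p n :
  (poly_laurent p)@_n = if n is Posz i then iota p`_i else 0.
Proof.
rewrite /poly_laurent /= /horner_morph horner_coef.
rewrite (raddf_sum (mcoeff n)).
have eq_term (i : nat) : mcoeff n ((map_poly const_laurent p)`_i * monom 1 1 ^+ i)
    = iota p`_i *+ (Posz i == n).
  rewrite coef_map /= -/(const_laurent _) const_laurentE monomX monomM expr1n mulr1 add0r.
  by rewrite mcoeff_monom; congr (_ *+ (_ == _)); lia.
transitivity (\sum_(i < size (map_poly const_laurent p)) iota p`_i *+ (Posz i == n)).
  by apply: eq_bigr => i _; apply: eq_term.
case: n eq_term => n _; last by rewrite big1.
have [sn|ns] := ltnP n (size (map_poly const_laurent p)).
  rewrite (bigD1 (Ordinal sn)) //= eqxx big1 ?addr0 // => i ni.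
  by rewrite [Posz _ == _](_ : _ = false) //; apply: contraNF ni => /eqP[e]; apply/eqP/val_inj.
rewrite big1.
  have /(congr1 (mcoeff (0 : int))) : (map_poly const_laurent p)`_n = 0 by rewrite nth_default.
  by rewrite coef_map /= -/(const_laurent _) const_laurentE mcoeff_monom eqxx mcoeff0 => /esym.
by move=> i _; rewrite [Posz _ == _](_ : _ = false) //; apply/negP => /eqP[e]; have := ltn_ord i; rewrite e ltnNge ns.
Qed.

Lemma poly_laurent_inj : injective iota -> injective poly_laurent.
Proof.
move=> inj p q e; apply/polyP => i; apply: inj.
by have := congr1 (mcoeff (i : int)) e; rewrite !mcoeff_poly_laurent.
Qed.

End PolyLaurent.

(** All large N are allowed, so that several elements can be shifted by multiples of a common N that
    respect an equation between them. *)
Lemma laurent_poly (K : comNzRingType) (f : laurent K) : exists B : nat,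
  forall N, (B <= N)%N -> exists p : {poly K}, monom 1 (Posz N) * f = poly_laurent idfun p.
Proof.
have [B HB] := laurent_bound f; exists B => N BN.
exists (\poly_(i < N + B.+1) f@_(Posz i - Posz N)); apply: laurentP => n.
rewrite mcoeff_monomM mul1r mcoeff_poly_laurent.
case: n => n /=.
  rewrite coef_poly; case: ltnP => // nN.
  by apply: contrapT => /eqP /HB; lia.
by apply: contrapT => /eqP /HB; lia.
Qed.

Lemma monomK (K : comNzRingType) n (f : laurent K) : monom 1 (- n) * (monom 1 n * f) = f.
Proof. by rewrite mulrA monomM mulr1 addNr monom1 mul1r. Qed.

Lemma poly_red (K : comNzRingType) : (forall x : K, x ^+ 2 = 0 -> x = 0) ->
  forall p : {poly K}, p ^+ 2 = 0 -> p = 0.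
Proof.
move=> Kred p p2; apply: contrapT => /eqP p0.
have l0 : lead_coef p * lead_coef p != 0.
  by apply/eqP => /Kred /eqP; rewrite lead_coef_eq0; apply/negP.
have := lead_coef_proper_mul l0; rewrite -(expr2 p) p2 lead_coef0 => e.
by rewrite -e eqxx in l0.
Qed.

Lemma laurent_red (K : comNzRingType) : (forall x : K, x ^+ 2 = 0 -> x = 0) ->
  forall f : laurent K, f ^+ 2 = 0 -> f = 0.
Proof.
move=> Kred f f2; have [N /(_ N (leqnn N))[p ep]] := laurent_poly f.
rewrite -(monomK N f) ep (_ : p = 0) ?rmorph0 ?mulr0 //.
apply: (poly_red Kred); apply: (@poly_laurent_inj _ _ (idfun : {rmorphism K -> K})) => //.
by rewrite rmorph0 rmorphXn /= -ep exprMn f2 mulr0.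
Qed.

Section ReesNoetherian.
Variables (A : comNzRingType) (I : idealr A).

Lemma ideal_exp1 x : x \in ideal_exp I 1 -> x \in I.
Proof.
move=> /asboolP[n [a [b [aI _ ->]]]].
by apply: rpred_sum => i _; rewrite mulrC idealMr.
Qed.

Lemma ideal_generators : noethr A -> exists2 s : seq A,
  forall x, x \in s -> x \in I & forall x, x \in I -> span (fun=> True) s x.
Proof.
move=> nA; have [||s Hs] := nA (fun x => x \in I); first split.
- exact: idealr0.
- by move=> x y xI yI; rewrite rpredD.
- by move=> r x _ xI; rewrite idealMr.
- by [].
by exists s => x; [move=> xs; apply/Hs/span_mem|move=> /Hs].
Qed.

Lemma ideal_exp_monom (L : comNzRingType) (f : {rmorphism A -> L}) (T : L)
    (R : L -> Prop) (s : seq A) :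
  is_subring R -> (forall a, R (f a)) -> (forall x, x \in s -> R (f x * T)) ->
  (forall x, x \in I -> span (fun=> True) s x) ->
  forall n a, a \in ideal_exp I n -> R (f a * T ^+ n).
Proof.
move=> Rs Rf RsT Is.
have RM x y : R x -> R y -> R (x * y) by case: Rs => _ _; apply.
have RI x : x \in I -> R (f x * T).
  move=> /Is; have RTs : is_submod (fun=> True) (fun x => R (f x * T)).
    split; first by rewrite rmorph0 mul0r; apply: subring0.
      by move=> a b Ra Rb; rewrite rmorphD mulrDl; apply: subringD.
    by move=> r a _ Ra; rewrite rmorphM -mulrA; apply: RM.
  exact: (span_sub RTs).
elim=> [|n IH] a; first by rewrite expr0 mulr1.
move=> /asboolP[m [b [c [bI cI ->]]]]; rewrite rmorph_sum mulr_suml.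
apply: subring_sum => // i _; rewrite rmorphM exprS mulrACA.
by apply: RM; [apply: RI|apply: IH].
Qed.

End ReesNoetherian.

(** * Identification of G(I) with R / u R *)

Section QuotientTransfer.
Variables (L : comNzRingType) (R : L -> Prop) (v : L).
Hypothesis Rs : is_subring R.
Variables (T G : comNzRingType) (pi : {rmorphism T -> G}) (eps : {rmorphism T -> L}).
Let U f := R (v * f).
Hypotheses (R_eps : forall x, R (eps x)) (pi_surj : forall g, exists x, g = pi x).
(** Together with [gr_zero] and the surjectivity of [pi], this says that [eps] induces an
    isomorphism from G to the quotient of R by U = u R. *)
Hypothesis gr_lift : forall f, R f -> exists x, U (f - eps x).
Hypothesis gr_zero : forall x, U (eps x) <-> pi x = 0.

Let RM x y : R x -> R y -> R (x * y). Proof. by case: Rs => _ _; apply. Qed.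

Let Us : is_submod R U.
Proof.
split; rewrite /U; first by rewrite mulr0; apply: (subring0 Rs).
  by move=> x y; rewrite mulrDr; apply: (subringD Rs).
by move=> r x Rr Ux; rewrite mulrCA; apply: RM.
Qed.

Let UD x y : U x -> U y -> U (x + y). Proof. exact: (submodD Us). Qed.
Let UB x y : U x -> U y -> U (x - y). Proof. exact: (submodB Rs Us). Qed.

Let UX n f g : R f -> R g -> U (f - g) -> U (f ^+ n - g ^+ n).
Proof.
move=> Rf Rg Ufg; rewrite subrXX mulrC; apply: (submodZ Us) => //.
by apply: (subring_sum Rs) => i _; apply: RM; apply: (subringX Rs).
Qed.

Lemma quotient_reduced : reduced G -> forall r n, R r -> U (r ^+ n) -> U (r).
Proof.
move=> Gred r n Rr Urn; have [x Ux] := gr_lift Rr.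
rewrite -(subrK (eps x) r); apply: UD => //; apply/gr_zero/(Gred _ n).
rewrite -rmorphXn; apply/gr_zero; rewrite rmorphXn.
by rewrite -[X in U X](subKr (r ^+ n)); apply: UB => //; apply: UX.
Qed.

Lemma quotient_seminormal : seminormal_cond G -> forall y z, R y -> R z ->
  U ((y ^+ 3 - z ^+ 2)) ->
  exists x, [/\ R x, U ((y - x ^+ 2)) & U ((z - x ^+ 3))].
Proof.
move=> sn y z Ry Rz Uyz; have [a Ua] := gr_lift Ry; have [b Ub] := gr_lift Rz.
have [|g [ga gb]] := sn (pi a) (pi b).
  apply/eqP; rewrite -subr_eq0; apply/eqP; rewrite -!rmorphXn -rmorphB.
  apply/gr_zero; rewrite rmorphB !rmorphXn.
  have -> : eps a ^+ 3 - eps b ^+ 2 = (y ^+ 3 - z ^+ 2) - (y ^+ 3 - eps a ^+ 3)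
    + (z ^+ 2 - eps b ^+ 2) by ring.
  by apply: UD; [apply: UB => //|]; apply: UX.
have [c ec] := pi_surj g; exists (eps c); split=> //.
  rewrite -(subrK (eps a) y) -addrA; apply: UD => //.
  by rewrite -rmorphXn -rmorphB; apply/gr_zero; rewrite rmorphB rmorphXn ga ec subrr.
rewrite -(subrK (eps b) z) -addrA; apply: UD => //.
by rewrite -rmorphXn -rmorphB; apply/gr_zero; rewrite rmorphB rmorphXn gb ec subrr.
Qed.

Lemma quotient_weakly_normal : weakly_normal_cond G -> forall p, prime p ->
  forall y z w d, R y -> R z -> R w -> R d ->
  (forall r, R r -> U ((d * r)) -> U (r)) ->
  U ((z ^+ p - y * d ^+ p)) -> U ((p%:R * z - d * w)) ->
  exists x, [/\ R x, U ((y - x ^+ p)) & U ((w - p%:R * x))].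
Proof.
move=> wn p pp y z w d Ry Rz Rw Rd dreg U1 U2.
have [y' Uy] := gr_lift Ry; have [z' Uz] := gr_lift Rz.
have [w' Uw] := gr_lift Rw; have [d' Ud] := gr_lift Rd.
have UM f f' g g' : R f -> R f' -> R g -> R g' -> U (f - f') -> U (g - g') ->
    U (f * g - f' * g').
  move=> Rf Rf' Rg Rg' U3 U4.
  have -> : f * g - f' * g' = g * (f - f') + f' * (g - g') by ring.
  by apply: UD; apply: (submodZ Us).
have RX n f : R f -> R (f ^+ n) by apply: (subringX Rs).
have [||||g [gy gw]] := wn (pi y') (pi z') (pi w') (pi d') p.
- move=> g1 g2; have [a ->] := pi_surj g1; have [b ->] := pi_surj g2 => /= e.
  apply/eqP; rewrite -subr_eq0 -rmorphB; apply/eqP/gr_zero/dreg => //.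
  have : U (eps (d' * (a - b))).
    by apply/gr_zero; rewrite rmorphM rmorphB mulrBr e subrr.
  rewrite rmorphM => H; rewrite -[d * _](subrK (eps d' * eps (a - b))).
  by apply: UD => //; rewrite -mulrBl mulrC; apply: (submodZ Us).
- exact: pp.
- apply/eqP; rewrite -subr_eq0; apply/eqP; rewrite -!rmorphXn -rmorphM -rmorphB.
  apply/gr_zero; rewrite rmorphB rmorphM !rmorphXn.
  have -> : eps z' ^+ p - eps y' * eps d' ^+ p
    = (z ^+ p - y * d ^+ p) - (z ^+ p - eps z' ^+ p)
      + (y * d ^+ p - eps y' * eps d' ^+ p) by ring.
  apply: UD; first by apply: UB => //; apply: UX.
  by apply: UM => //; try apply: RX => //; apply: UX.
- apply/eqP; rewrite -subr_eq0; apply/eqP; rewrite -(rmorph_nat pi) -!rmorphM -rmorphB.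
  apply/gr_zero; rewrite rmorphB !rmorphM rmorph_nat.
  have -> : p%:R * eps z' - eps d' * eps w' = (p%:R * z - d * w)
    - p%:R * (z - eps z') + (d * w - eps d' * eps w') by ring.
  apply: UD; last exact: UM.
  by apply: UB => //; apply: (submodZ Us) => //; apply: (subring_nat Rs).
have [c ec] := pi_surj g; exists (eps c); split=> //.
  rewrite -(subrK (eps y') y) -addrA; apply: UD => //.
  by rewrite -rmorphXn -rmorphB; apply/gr_zero; rewrite rmorphB rmorphXn gy ec subrr.
rewrite -(subrK (eps w') w) -addrA; apply: UD => //.
rewrite -(rmorph_nat eps) -rmorphM -rmorphB; apply/gr_zero.
by rewrite rmorphB rmorphM rmorph_nat gw ec subrr.
Qed.

End QuotientTransfer.

Section ExtendedRees.
Variables (A : comNzRingType) (I : idealr A).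
Hypothesis nA : noethr A.
Variables (K : comNzRingType) (iota : {rmorphism A -> K}).
Hypothesis iota_inj : injective iota.

(* The extended Rees ring of I, seen in the Laurent polynomials over an
   extension of A; u is the inverse of the indeterminate. *)
Definition ext_rees_in (f : laurent K) := forall n : int,
  exists2 a, a \in ideal_expz I n & f@_n = iota a.

Local Notation R := ext_rees_in.
Local Notation u := (monom (1 : K) (-1)).
Local Notation v := (monom (1 : K) 1).

Lemma ext_rees_in_subring : is_subring R.
Proof.
have sum (T : Type) (r : seq T) (F : T -> K) n :
    (forall t, exists2 a, a \in ideal_expz I n & F t = iota a) ->
    exists2 a, a \in ideal_expz I n & \sum_(t <- r) F t = iota a.
  move=> /(_ _)/cid2 HF; exists (\sum_(t <- r) s2val (HF t)).
    by apply: ideal_expz_sum => t _; case: (HF t).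
  by rewrite rmorph_sum; apply: eq_bigr => t _; case: (HF t).
split.
- move=> n; rewrite mcoeff_laurent1; exists (n == 0)%:R; last by rewrite rmorph_nat.
  by case: eqP => [->|_] //; apply: ideal_expz0.
- move=> f g Rf Rg n; have [a aI ea] := Rf n; have [b bI eb] := Rg n.
  exists (a - b); last by rewrite mcoeffB rmorphB ea eb.
  by rewrite -[- b]mulN1r; apply: ideal_expzD => //; apply: ideal_expzMr.
- move=> f g Rf Rg n; rewrite mcoeff_laurentM; apply: (@sum _ _ _ n) => i; apply: sum => j.
  case: eqP => [<-|_]; last by exists 0; rewrite ?rmorph0 //; apply: ideal_expz0.
  have [a aI ->] := Rf i; have [b bI ->] := Rg j.
  by exists (a * b); rewrite ?rmorphM //; apply: ideal_expzM.
Qed.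

Let Rs := ext_rees_in_subring.
Let RM x y : R x -> R y -> R (x * y). Proof. by case: Rs => _ _; apply. Qed.

Lemma ext_rees_in_monom a n : a \in ideal_expz I n -> R (monom (iota a) n).
Proof.
move=> aI k; rewrite mcoeff_monom; case: eqP => [<-|_]; first by exists a.
by exists 0; rewrite ?rmorph0 //; apply: ideal_expz0.
Qed.

Lemma ext_rees_in_u : R u.
Proof. by rewrite -(rmorph1 iota); apply: ext_rees_in_monom. Qed.

Lemma ext_rees_uv : u * v = 1.
Proof. by rewrite monomM mulr1 addNr monom1. Qed.

Lemma ext_rees_in_v f : R (v * f) <->
  forall n : int, exists2 a, a \in ideal_expz I (n + 1) & f@_n = iota a.
Proof.
split=> H n.
  by have := H (n + 1); rewrite mcoeff_monomM mul1r addrK.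
by have := H (n - 1); rewrite mcoeff_monomM mul1r subrK.
Qed.

Lemma ext_rees_in_noeth : noeth R R.
Proof.
have [s sI Is] := ideal_generators I nA.
pose c : {rmorphism A -> laurent K} := const_laurent iota.
have cE a : c a = monom (iota a) 0 := const_laurentE iota a.
apply: (@noeth_fg _ _ c (u :: [seq monom (iota x) 1 | x <- s])) => //.
- by move=> a; rewrite cE; apply: ext_rees_in_monom.
- move=> x; rewrite inE => /predU1P[->|/mapP[a /sI aI ->]]; first exact: ext_rees_in_u.
  apply: ext_rees_in_monom; rewrite -[a]mulr1.
  exact: mem_ideal_mul.
- move=> R' R's R'A R's' f Rf.
  have R'u : R' u by apply: R's'; rewrite mem_head.
  have -> : f = \sum_(k <- msupp f) monom f@_k k by exact: monalgE.
  apply: subring_sum => // k _; have [a aI ->] := Rf k.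
  have -> : monom (iota a) k = c a * monom 1 k.
    by rewrite cE monomM mulr1 add0r.
  case: k aI => n aI.
    have -> : monom 1 n = v ^+ n :> laurent K by rewrite monomX expr1n; congr monom; lia.
    apply: (ideal_exp_monom R's R'A _ Is) => // x xs.
    rewrite cE monomM mulr1 add0r; apply: R's'.
    by rewrite inE; apply/orP; right; apply/mapP; exists x.
  have [_ _ R'M] := R's; apply: R'M => //.
  have -> : monom 1 (Negz n) = u ^+ n.+1 :> laurent K.
    by rewrite monomX expr1n; congr monom; lia.
  exact: subringX.
Qed.

Lemma ext_rees_in_poly p :
  R (poly_laurent iota p) <-> forall n : nat, p`_n \in ideal_exp I n.
Proof.
split=> H n.
  have [a aI] := H n; rewrite mcoeff_poly_laurent => /iota_inj ->.
  exact: aI.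
rewrite mcoeff_poly_laurent; case: n => n; first by exists p`_n => //; apply: H.
by exists 0; rewrite ?rmorph0 //; apply: ideal_expz0.
Qed.

Lemma ext_rees_in_vpoly p :
  R (v * poly_laurent iota p) <-> forall n : nat, p`_n \in ideal_exp I n.+1.
Proof.
rewrite ext_rees_in_v; split=> H n.
  have [a aI] := H n; rewrite mcoeff_poly_laurent => /iota_inj ->.
  by move: aI; rewrite -[(_ + _)%R]/(Posz (n + 1)) addn1.
rewrite mcoeff_poly_laurent; case: n => n.
  by exists p`_n => //; rewrite -[(_ + _)%R]/(Posz (n + 1)) addn1; apply: H.
by exists 0; rewrite ?rmorph0 //; apply: ideal_expz0.
Qed.

Section Graded.
Local Open Scope quotient_scope.
Local Notation G := (assoc_graded I).

Lemma assoc_graded_proj : exists pi : {rmorphism rees I -> G},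
  (forall g, exists x, g = pi x) /\ forall x, pi x = 0 <-> x \in rees_ideal I.
Proof.
exists (\pi_{ideal_quot (rees_ideal I)} : {rmorphism rees I -> G}); split.
  by move=> g; exists (repr g); rewrite /= reprK.
move=> x; rewrite -(rmorph0 \pi_{ideal_quot (rees_ideal I)}); split=> [/eqP|xI].
  by rewrite eqmodE /= Quotient.equivE subr0.
by apply/eqP; rewrite eqmodE /= Quotient.equivE subr0.
Qed.

Let eps : {rmorphism rees I -> laurent K} := poly_laurent iota \o val.

Let R_eps x : R (eps x).
Proof. by apply/ext_rees_in_poly; have /asboolP := reesP x. Qed.

Let gr_lift f : R f -> exists x, R (v * (f - eps x)).
Proof.
move=> Rf; have [B HB] := laurent_bound f.
have exa (n : int) : exists a, a \in ideal_expz I n /\ f@_n = iota a.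
  by have [a aI e] := Rf n; exists a.
have [a Ha] := choice exa.
(* The part of f in nonnegative degrees represents f, because the rest lies in u R. *)
have pI : \poly_(i < B.+1) a i \in rees_pred I.
  apply/asboolP => n; rewrite coef_poly; case: ifP => _; last exact: ideal_exp0.
  exact: (Ha n).1.
exists (Rees pI); apply/ext_rees_in_v => n.
rewrite mcoeffB mcoeff_poly_laurent /=; case: n => n.
  exists 0; first exact: ideal_expz0.
  rewrite coef_poly rmorph0; case: ltnP => nB; first by rewrite (Ha n).2 subrr.
  by rewrite rmorph0 subr0; apply: contrapT => /eqP /HB; rewrite /= leqNgt nB.
(* In degree -(n+1) membership in u R asks for the power of I with exponent -n, which is A. *)
exists (a (Negz n)); last by rewrite subr0 (Ha _).2.
by have -> : Negz n + 1 = - (n : int); [lia|case: n].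
Qed.

Let eps_zero x : R (v * eps x) <-> x \in rees_ideal I.
Proof.
rewrite ext_rees_in_vpoly; split; first by move=> H; apply/rees_idealP.
by move=> /rees_idealP.
Qed.

Lemma graded_reduced : reduced G -> forall r n, R r -> R (v * r ^+ n) -> R (v * r).
Proof.
have [pi [pi_surj pi0]] := assoc_graded_proj; move=> Gred.
apply: (quotient_reduced Rs R_eps gr_lift _ Gred) => x.
rewrite eps_zero; apply: iff_sym; exact: pi0.
Qed.

Lemma graded_seminormal : seminormal_cond G -> forall y z, R y -> R z ->
  R (v * (y ^+ 3 - z ^+ 2)) ->
  exists x, [/\ R x, R (v * (y - x ^+ 2)) & R (v * (z - x ^+ 3))].
Proof.
have [pi [pi_surj pi0]] := assoc_graded_proj; move=> Gsn.
apply: (quotient_seminormal Rs R_eps pi_surj gr_lift _ Gsn) => x.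
rewrite eps_zero; apply: iff_sym; exact: pi0.
Qed.

Lemma graded_weakly_normal : weakly_normal_cond G -> forall p, prime p ->
  forall y z w d, R y -> R z -> R w -> R d ->
  (forall r, R r -> R (v * (d * r)) -> R (v * r)) ->
  R (v * (z ^+ p - y * d ^+ p)) -> R (v * (p%:R * z - d * w)) ->
  exists x, [/\ R x, R (v * (y - x ^+ p)) & R (v * (w - p%:R * x))].
Proof.
have [pi [pi_surj pi0]] := assoc_graded_proj; move=> Gwn.
apply: (quotient_weakly_normal Rs R_eps pi_surj gr_lift _ Gwn) => x.
rewrite eps_zero; apply: iff_sym; exact: pi0.
Qed.

End Graded.
End ExtendedRees.

(** * Local rings and Krull's intersection theorem *)

Section LocalRing.
Variables (A : comNzRingType) (m : idealr A).
Hypotheses (nA : noethr A) (mloc : local_ring m).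

Lemma sub_maximal W : is_submod (fun=> True) W -> ~ W 1 -> forall x, W x -> x \in m.
Proof.
move=> Ws W1.
have [||N [[Ns WN N1] Nmax]] := @noeth_max A _ (subringT A) _
  (fun N => [/\ is_submod (fun=> True) N, incl W N & ~ N 1]) nA.
- by move=> N [].
- by exists W; split.
pose B : {pred A} := fun x => `[< N x >].
have Bcl : idealr_closed B.
  split; first by apply/asboolP; apply: (submod0 Ns).
    by apply/negP => /asboolP.
  move=> r x y /asboolP Px /asboolP Py; apply/asboolP.
  by apply: (submodD Ns) => //; apply: (submodZ Ns).
pose J : idealr A := HB.pack (B : A -> bool) (isIdealr.Build A B Bcl).
have Jmax : maximal_ideal J.
  move=> H JH x; apply/idP/idP => [Hx|]; last exact: JH.
  apply/asboolP; apply: (Nmax (fun x => x \in H)) => //; first split.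
  - split; first exact: idealr0.
      by move=> a b aH bH; rewrite rpredD.
    by move=> r a _ aH; rewrite idealMr.
  - by move=> a /WN Na; apply: JH; apply/asboolP.
  - by rewrite idealr1.
  - by move=> a Na; apply: JH; apply/asboolP.
by move=> x /WN Nx; rewrite -(mloc.2 J Jmax); apply/asboolP.
Qed.

Lemma ideal_sub_maximal (I : idealr A) x : x \in I -> x \in m.
Proof.
apply: (sub_maximal (W := fun x => x \in I)); last by rewrite idealr1.
split; first exact: idealr0.
  by move=> a b aI bI; rewrite rpredD.
by move=> r a _ aI; rewrite idealMr.
Qed.

Lemma local_unit b : b \in m -> exists c, c * (1 - b) = 1.
Proof.
move=> bm; apply: contrapT => nc.
have bs : is_submod (fun=> True) (mulm (1 - b) (fun=> True)) by apply: mulm_submod.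
have b1m : 1 - b \in m.
  apply: (sub_maximal bs); last by exists 1; rewrite ?mulr1.
  by move=> [c _ e]; apply: nc; exists c; rewrite mulrC -e.
by have := rpredD b1m bm; rewrite subrK idealr1.
Qed.

(* Krull's intersection theorem, from the chain of the submodules of the
   extended Rees ring generated by a, a t, ..., a t^n. *)
Lemma ideal_exp_separated (I : idealr A) a :
  (forall n, a \in ideal_exp I n) -> a = 0.
Proof.
move=> aI; pose idA : {rmorphism A -> A} := idfun; pose R := ext_rees_in I idA.
have Rs := ext_rees_in_subring I idA.
have nR : noeth R R := @ext_rees_in_noeth A I nA A idA.
have [_ _ RM] := Rs.
pose F n x := exists2 c : nat -> laurent A, forall i, R (c i) &
  x = \sum_(i < n) c i * monom a i.
have [||n HF] := @noeth_acc _ R Rs R F nR.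
- move=> n; split; first split.
  + by exists (fun=> 0); [move=> _; apply: subring0|rewrite big1 // => i _; rewrite mul0r].
  + move=> x y [c Rc ->] [c' Rc' ->]; exists (fun i => c i + c' i).
      by move=> i; apply: (subringD Rs); [apply: Rc|apply: Rc'].
    by rewrite -big_split; apply: eq_bigr => i _; rewrite mulrDl.
  + move=> r x Rr [c Rc ->]; exists (fun i => r * c i).
      by move=> i; apply: (RM) => //; apply: Rc.
    by rewrite mulr_sumr; apply: eq_bigr => i _; rewrite mulrA.
  + move=> x [c Rc ->]; apply: (subring_sum Rs) => i _; apply: RM; first exact: Rc.
    exact: (@ext_rees_in_monom A I A idA a (Posz i) (aI i)).
- move=> n x [c Rc ->]; exists (fun i => if (i < n)%N then c i else 0).
    by move=> i; case: ifP => _; [apply: Rc|apply: (subring0 Rs)].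
  rewrite big_ord_recr /= ltnn mul0r addr0.
  by apply: eq_bigr => i _; rewrite ltn_ord.
have [c Rc /(congr1 (mcoeff (n : int)))] : F n (monom a n).
  apply: (HF n.+1); exists (fun i => (i == n)%:R).
    by move=> i; apply: (subring_nat Rs).
  rewrite big_ord_recr /= eqxx mul1r big1 ?add0r // => i _.
  by rewrite ltn_eqF ?mul0r.
rewrite mcoeff_monom eqxx mulr1n (raddf_sum (mcoeff (n : int))).
(* In degree n the relation expresses a through the coefficients of the c_i in degree n - i > 0,
   which lie in I. Hence a = b a with b in I, and 1 - b is a unit. *)
have cI (i : 'I_n) : exists2 b, b \in I & mcoeff (n : int) (c i * monom a i) = b * a.
  have [b bI eb] := Rc i (Posz n - Posz i); exists b.
    apply: (@ideal_exp1 _ I); apply: (@ideal_exp_le _ _ _ (n - i)).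
      by rewrite subn_gt0.
    by move: bI; rewrite subzn // ltnW.
  by rewrite mulrC mcoeff_monomM eb mulrC.
have {cI} : exists2 b, b \in I & \sum_(i < n) mcoeff (n : int) (c i * monom a i) = b * a.
  elim/big_ind: _ => [|x y [b bI ->] [b' bI' ->]|i _].
  - by exists 0; rewrite ?idealr0 ?mul0r.
  - by exists (b + b'); rewrite ?rpredD ?mulrDl.
  - exact: cI.
move=> [b bI ->] /eqP; rewrite -subr_eq0 -{1}[a]mul1r -mulrBl => /eqP e.
have [d ed] := local_unit (ideal_sub_maximal bI).
by rewrite -[a]mul1r -ed -mulrA e mulr0.
Qed.

End LocalRing.

Lemma rees_noeth (A : comNzRingType) (I : idealr A) : noethr A -> noethr (rees I).
Proof.
move=> nA; pose f : {rmorphism rees I -> {poly A}} := val.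
apply: (@noethr_inj _ _ f val_inj); have [s sI Is] := ideal_generators I nA.
have f_pred p : rangep f p <-> p \in rees_pred I.
  by split=> [[x ->]|pI]; [exact: reesP|exists (Rees pI)].
apply: (@noeth_fg _ _ (polyC : {rmorphism A -> {poly A}}) [seq x%:P * 'X | x <- s]) => //.
- exact: rangep_subring.
- by move=> a; apply/f_pred/asboolP => -[|n]; rewrite coefC //; exact: (ideal_exp0 I n.+1).
- move=> _ /mapP[a /sI aI ->]; apply/f_pred/asboolP => n.
  rewrite coefCM coefX; case: eqP => [->|_]; last by rewrite mulr0; apply: ideal_exp0.
  by apply: mem_ideal_mul.
- move=> R' R's R'A R's' p /f_pred/asboolP pI.
  rewrite -[p]coefK poly_def; apply: (subring_sum R's) => i _.
  rewrite -mul_polyC; apply: (ideal_exp_monom R's R'A _ Is) => // x xs.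
  by apply: R's'; apply/mapP; exists x.
Qed.

Lemma ext_rees_noeth (A : comNzRingType) (I : idealr A) :
  noethr A -> noethr (ext_rees I).
Proof.
move=> nA; pose f : {rmorphism ext_rees I -> laurent A} := val.
apply: (@noethr_inj _ _ f val_inj).
have := @ext_rees_in_noeth A I nA A (idfun : {rmorphism A -> A}).
have f_in p : ext_rees_in I idfun p <-> rangep f p.
  split=> [Rp|[x -> n]].
    have pI : p \in ext_rees_pred I.
      by apply/asboolP => n; have [a aI ->] := Rp n.
    by exists (ExtRees pI).
  by have /asboolP/(_ n) := ext_reesP x; exists (ext_rees_val x)@_n.
exact: noeth_ext.
Qed.

(** * Descent from G(I) to A *)

Section Transfer.
Variables (A : comNzRingType) (m I : idealr A).
Hypotheses (nA : noethr A) (mloc : local_ring m).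
Local Notation G := (assoc_graded I).
Hypothesis Gred : reduced G.

(** If x^2 = 0 and x lies in I^n, then x t^n is nilpotent modulo u, hence lies in u R, so that x
    lies in I^(n+1). Krull's intersection theorem then gives x = 0. *)
Lemma base_reduced : reduced A.
Proof.
apply: nilp_eq0 => x x2; apply: (ideal_exp_separated nA mloc (I := I)).
elim=> // n xI; pose idA : {rmorphism A -> A} := idfun.
have := @graded_reduced A I A idA (fun x y e => e) Gred (monom x n) 2.
have Rx : ext_rees_in I idA (monom x n) by exact: (@ext_rees_in_monom A I A idA x (Posz n) xI).
move=> /(_ Rx); rewrite monomX x2 monom0 mulr0.
move=> /(_ (subring0 (ext_rees_in_subring I idA)))/ext_rees_in_v/(_ (n : int))[a].
by rewrite mcoeff_monom eqxx mulr1n -[_ + _]/(Posz (n + 1)) addn1 => aI ->.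
Qed.

Section Extension.
Variables (K : comNzRingType) (iota : {rmorphism A -> K}).
Hypothesis iota_inj : injective iota.
Hypothesis Kred : forall x : K, x ^+ 2 = 0 -> x = 0.

Local Notation R := (ext_rees_in I iota).
Local Notation u := (monom (1 : K) (-1)).

Let mcoeff_u f n : (u * f)@_n = f@_(n + 1).
Proof. by rewrite mcoeff_monomM mul1r opprK. Qed.

(** In degree 0 the relation r + u s = 1 reads r_0 + s_1 = 1 with s_1 in I. As A is local, r_0 is a
    unit, and r_0 X lies in A. *)
Lemma range_of_conductor X : (exists2 r, R r /\ R (r * monom X 0) & exists2 s, R s & r + u * s = 1) ->
  exists x, X = iota x.
Proof.
move=> [r [Rr RrX] [s Rs /(congr1 (mcoeff (0 : int)))]].
rewrite mcoeffD mcoeff_u mcoeff_laurent1 eqxx.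
have [a _ ea] := Rr 0; have [b bI ->] := Rs (0 + 1).
rewrite ea -(rmorph1 iota) -rmorphD => /iota_inj e.
have bm : b \in m by apply: (ideal_sub_maximal nA mloc (I := I)); apply: ideal_exp1.
have [c ec] := local_unit nA mloc bm.
have [a' _] := RrX 0; rewrite mulrC mcoeff_monomM subr0 ea => e'.
exists (c * a'); rewrite rmorphM -e' mulrCA -rmorphM.
have -> : a = 1 - b by rewrite -e addrK.
by rewrite ec rmorph1 mulr1.
Qed.

Let Rs := ext_rees_in_subring I iota.
Let nR := @ext_rees_in_noeth A I nA K iota.
Let Ru := ext_rees_in_u I iota.
Let uv := ext_rees_uv K.
Let Rred := graded_reduced iota_inj Gred.

Lemma ext_rees_in_const a : R (monom (iota a) 0).
Proof. exact: ext_rees_in_monom. Qed.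

Lemma range_square_cube X : seminormal_cond G -> rangep iota (X ^+ 2) ->
  rangep iota (X ^+ 3) -> rangep iota X.
Proof.
move=> Gsn [y ey] [z ez]; apply: range_of_conductor.
have X2 n : monom X 0 ^+ n = monom (X ^+ n) 0 by rewrite monomX mul0rn.
apply: (lift_seminormal Rs nR Ru uv Rred (laurent_red Kred)).
- exact: (graded_seminormal iota_inj Gsn).
- by rewrite X2 ey; apply: ext_rees_in_const.
- by rewrite X2 ez; apply: ext_rees_in_const.
Qed.

(** Descending induction on the exponent: s^(2n) and s^(3n) have larger exponents than s^n, and (i)
    takes them to s^n. *)
Lemma range_large_powers N s : seminormal_cond A ->
  (forall n, (N <= n)%N -> rangep iota (s ^+ n)) -> rangep iota s.
Proof.
move=> sn H; rewrite -(expr1 s).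
suff : forall k n, (N <= n + k)%N -> (0 < n)%N -> rangep iota (s ^+ n).
  by apply; [exact: (leq_addl 1 N)|].
elim=> [|k IH] n; first by rewrite addn0 => Nn _; apply: H.
move=> Nn n0; apply: (range_seminormal iota_inj Kred sn).
  by rewrite -exprM; apply: IH; nia.
by rewrite -exprM; apply: IH; nia.
Qed.

(** The hypotheses have to be strengthened until conductor elements appear. By reduction of
    exponents modulo p, d^p X^i lies in A for all i. For p X^i the same reduction works only for its
    n-th powers with n >= p, and seminormality of A descends from these. *)
Lemma range_root p X d : weakly_normal_cond G -> seminormal_cond A ->
  prime p -> rangep iota (X ^+ p) -> rangep iota (p%:R * X) ->
  rangep iota (iota d * X) -> (forall x, iota d * x = 0 -> x = 0) -> rangep iota X.
Proof.
move=> Gwn sn pp [y ey] [w ew] [z ez] dreg; apply: range_of_conductor.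
have Ss := rangep_subring iota; have [_ _ SM] := Ss.
have mX n : monom X 0 ^+ n = monom (X ^+ n) 0 by rewrite monomX mul0rn.
have const x : rangep iota x -> R (monom x 0).
  by move=> [a ->]; apply: ext_rees_in_const.
have p0 := prime_gt0 pp.
have iota_range a : rangep iota (iota a) by exists a.
have XE i : X ^+ i = iota y ^+ (i %/ p) * X ^+ (i %% p).
  by rewrite -ey -exprM -exprD mulnC -divn_eq.
have yX i s : rangep iota (s * X ^+ (i %% p)) -> rangep iota (s * X ^+ i).
  by move=> H; rewrite XE mulrCA; apply: SM => //; apply: (subringX Ss).
have scaled c i n : rangep iota (iota c * X) -> (i <= n)%N ->
    rangep iota (iota c ^+ n * X ^+ i).
  move=> H /subnK <-; rewrite exprD -mulrA -exprMn.
  by apply: SM; apply: (subringX Ss).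
have pX i : rangep iota (p%:R * X ^+ i).
  apply: (@range_large_powers p) => // n pn.
  rewrite exprMn -exprM; apply: yX; rewrite -(rmorph_nat iota).
  apply: scaled; first by rewrite rmorph_nat; exists w.
  by rewrite (leq_trans _ pn) // ltnW // ltn_mod.
have dX i : rangep iota (iota d ^+ p * X ^+ i).
  apply: yX; apply: scaled; first by exists z.
  by rewrite ltnW // ltn_mod.
apply: (lift_weakly_normal Rs nR Ru uv Rred pp _ (d := monom (iota d ^+ p) 0)).
- exact: (graded_weakly_normal iota_inj Gwn).
- by rewrite mX ey; apply: ext_rees_in_const.
- split; first exact: (subring_nat Rs).
  move=> i; rewrite mX; have -> : p%:R * monom (X ^+ i) 0 = monom (p%:R * X ^+ i) 0.
    apply: laurentP => n; rewrite mulr_natl mcoeffMn !mcoeff_monom mulr_natl.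
    by rewrite mulrnAC.
  exact: const.
- split; first by rewrite -rmorphXn; apply: ext_rees_in_const.
  by move=> i; rewrite mX monomM addr0; apply: const.
- move=> f df; apply: laurentP => n; rewrite mcoeff0.
  have : iota d ^+ p * f@_n = 0.
    by rewrite -[n]subr0 -mcoeff_monomM df mcoeff0.
  elim: (p) => [|k IH]; first by rewrite mul1r.
  by rewrite exprS -mulrA => /dreg.
Qed.

End Extension.

Let Ared := base_reduced.

Let one_index : {a : A | a != 0} := exist _ 1 (oner_neq0 A).

Lemma base_seminormal : seminormal_cond G -> seminormal_cond A.
Proof.
move=> Gsn y z e; have [|F [f Hf]] := separating_fields nA Ared (g := id) => //.
have [K [pr [iota [prP pr_surj pr_iota]]]] := product_of_fields one_index f.
have fsep a : (forall j, f j a = 0) -> a = 0.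
  by move=> fa; apply: contrapT => /eqP a0; have := Hf (exist _ a a0); rewrite fa eqxx.
have inj : injective iota.
  move=> a b eab; apply/eqP; rewrite -subr_eq0; apply/eqP/fsep => j.
  by rewrite rmorphB -!pr_iota eab subrr.
(* Where y maps to 0, so does z, and the quotient is 0 by the convention for the inverse of 0. *)
have [X HX] := pr_surj (fun j => f j z / f j y).
have ej j : f j y ^+ 3 = f j z ^+ 2 by rewrite -!rmorphXn e.
have X2 : X ^+ 2 = iota y.
  apply: prP => j; rewrite rmorphXn HX pr_iota exprMn -ej.
  have [->|fy] := eqVneq (f j y) 0; first by rewrite expr0n mul0r.
  by rewrite exprVn -expfB.
have X3 : X ^+ 3 = iota z.
  apply: prP => j; rewrite rmorphXn HX pr_iota exprMn exprVn ej.
  have [->|fz] := eqVneq (f j z) 0; first by rewrite expr0n mul0r.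
  by rewrite -expfB.
have [||x ex] := range_square_cube inj (joint_red prP) (X := X) Gsn.
- by exists y.
- by exists z.
by exists x; split; apply: inj; rewrite rmorphXn -ex.
Qed.

Lemma base_weakly_normal : seminormal_cond A -> weakly_normal_cond G ->
  weakly_normal_cond A.
Proof.
move=> sn Gwn y z w d p dreg pp e1 e2.
have d_neq0 a : a != 0 -> a * d != 0.
  apply: contraNneq => ad; apply/eqP/dreg; by rewrite mulr0 mulrC.
have [//|F [f Hf]] := separating_fields nA Ared (g := fun a => a * d).
have [K [pr [iota [prP pr_surj pr_iota]]]] := product_of_fields one_index f.
have fsep a : (forall j, f j a = 0) -> a = 0.
  move=> fa; apply: contrapT => /eqP a0; have := Hf (exist _ a a0).
  by rewrite rmorphM /= fa mul0r eqxx.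
have fd j : f j d != 0.
  by apply: contraNneq (Hf j) => fd; rewrite rmorphM fd mulr0.
have inj : injective iota.
  move=> a b eab; apply/eqP; rewrite -subr_eq0; apply/eqP/fsep => j.
  by rewrite rmorphB -!pr_iota eab subrr.
have [X HX] := pr_surj (fun j => f j z / f j d).
have Xp : X ^+ p = iota y.
  apply: prP => j; rewrite rmorphXn HX pr_iota exprMn -rmorphXn e1 rmorphM rmorphXn.
  by rewrite exprVn mulfK // expf_neq0 ?fd.
have pX : p%:R * X = iota w.
  apply: prP => j; rewrite rmorphM rmorph_nat HX pr_iota mulrA.
  by rewrite -(rmorph_nat (f j)) -rmorphM e2 rmorphM [f j d * _]mulrC mulfK ?fd.
have dX : iota d * X = iota z.
  by apply: prP => j; rewrite rmorphM HX !pr_iota mulrCA mulfV ?fd // mulr1.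
have [||||x ex] := range_root inj (joint_red prP) (X := X) (d := d) Gwn sn pp.
- by exists y.
- by exists w.
- by exists z.
- move=> x dx; apply: prP => j; rewrite rmorph0; apply/eqP.
  have /eqP := congr1 (pr j) dx; rewrite rmorphM rmorph0 pr_iota mulf_eq0.
  by rewrite (negPf (fd j)).
exists x; split; apply: inj; first by rewrite rmorphXn -ex.
by rewrite rmorphM rmorph_nat -ex.
Qed.

End Transfer.

(** * Ascent from A to the Rees rings *)

Section ReesNormality.
Variables (A : comNzRingType) (m I : idealr A).
Hypotheses (nA : noethr A) (mloc : local_ring m) (Gred : reduced (assoc_graded I)).

Let Ared : reduced A := base_reduced nA mloc Gred.
Let Ared2 (x : A) : x ^+ 2 = 0 -> x = 0. Proof. exact: Ared. Qed.
Let idA : {rmorphism A -> A} := idfun.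
Let R := ext_rees_in I idA.
Let rees_poly : {rmorphism rees I -> {poly A}} := val.
Let ext_rees_laurent : {rmorphism ext_rees I -> laurent A} := val.
Let rees_poly_inj : injective rees_poly. Proof. exact: val_inj. Qed.
Let ext_rees_inj : injective ext_rees_laurent. Proof. exact: val_inj. Qed.

Lemma ext_rees_power_closed (f : laurent A) n : (0 < n)%N -> R (f ^+ n) -> R f.
Proof.
move=> n0; have [B HB] := laurent_bound f.
have idA_inj : injective idA by [].
(* For this B all terms of u^B f have degree at most 0, where R admits every coefficient from A. *)
apply: (@root_closed _ _ _ _ (ext_rees_in_subring I idA) (ext_rees_in_u I idA)
  (ext_rees_uv A) (graded_reduced idA_inj Gred) B n) => // k.
rewrite monomX expr1n mcoeff_monomM mul1r.
have [->|/HB kB] := eqVneq f@_(k - (-1) *+ B) 0.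
  by exists 0; rewrite ?rmorph0 //; apply: ideal_expz0.
exists f@_(k - (-1) *+ B) => //; case: k kB => // -[|k] kB //.
by move: kB; lia.
Qed.

Lemma ext_reesE (x : ext_rees I) : R (ext_rees_laurent x).
Proof.
by move=> n; have /asboolP/(_ n) := ext_reesP x; exists (ext_rees_val x)@_n.
Qed.

Lemma ext_rees_val_ex f : R f -> exists x : ext_rees I, f = ext_rees_laurent x.
Proof.
move=> Rf; have fI : f \in ext_rees_pred I.
  by apply/asboolP => n; have [a aI ->] := Rf n.
by exists (ExtRees fI).
Qed.

Lemma ext_rees_root n (f : laurent A) (x : ext_rees I) : (0 < n)%N ->
  f ^+ n = ext_rees_laurent x -> exists x', f = ext_rees_laurent x'.
Proof.
move=> n0 e; apply: ext_rees_val_ex; apply: (ext_rees_power_closed n0).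
by rewrite e; apply: ext_reesE.
Qed.

Lemma rees_root n (h : {poly A}) (x : rees I) : (0 < n)%N ->
  h ^+ n = rees_poly x -> exists x', h = rees_poly x'.
Proof.
move=> n0 e; have idA_inj : injective idA by [].
have hI : h \in rees_pred I.
  apply/asboolP; apply/(ext_rees_in_poly I idA_inj)/(ext_rees_power_closed n0).
  rewrite -rmorphXn e; apply/ext_rees_in_poly => //.
  by have /asboolP := reesP x.
by exists (Rees hI).
Qed.

Lemma rees_reduced : reduced (rees I).
Proof.
apply: nilp_eq0 => x x2; apply: rees_poly_inj; apply: (poly_red Ared2).
by rewrite -rmorphXn x2 rmorph0.
Qed.

Lemma ext_rees_reduced : reduced (ext_rees I).
Proof.
apply: nilp_eq0 => x x2; apply: ext_rees_inj; apply: (laurent_red Ared2).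
by rewrite -rmorphXn x2 rmorph0.
Qed.

Lemma rees_seminormal : seminormal_cond A -> seminormal_cond (rees I).
Proof.
move=> sn y z e.
have [|h [hy hz]] := seminormal_poly nA Ared sn (y := rees_poly y) (z := rees_poly z).
  by rewrite -!rmorphXn e.
have [x ex] := rees_root (isT : 0 < 2)%N (esym hy).
exists x; split; apply: rees_poly_inj.
  by rewrite rmorphXn -ex.
by rewrite rmorphXn -ex.
Qed.

Lemma rees_weakly_normal : weakly_normal_cond A -> weakly_normal_cond (rees I).
Proof.
move=> wn y z w d p dreg pp e1 e2.
have [|||h [hy hw]] := weakly_normal_poly nA Ared (y := rees_poly y) (z := rees_poly z)
  (w := rees_poly w) (d := rees_poly d) wn pp.
(* The denominator is tested against constants only; these belong to the Rees ring, where d is a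
   nonzero divisor. *)
- move=> a Ha; have a0 : a *: (1 : rees I) = 0.
    apply: dreg; rewrite mulr0 -scalerAr mulr1; apply: rees_poly_inj.
    apply/polyP => i; rewrite /= coefZ coef0; exact: Ha.
  by have := congr1 (fun x : rees I => (rees_poly x)`_0) a0; rewrite /= coefZ coef1 mulr1 coef0.
- by rewrite -!rmorphXn -rmorphM e1.
- by rewrite -rmorphM -e2 rmorphM rmorph_nat.
have [x ex] := rees_root (prime_gt0 pp) (esym hy).
exists x; split; apply: rees_poly_inj.
  by rewrite rmorphXn -ex.
rewrite rmorphM rmorph_nat -ex.
exact: hw.
Qed.

Let pl : {rmorphism {poly A} -> laurent A} := poly_laurent idfun.
Let pl_inj : injective pl.
Proof. by apply: poly_laurent_inj. Qed.

Let monom_pow N k : monom (1 : A) (Posz N) ^+ k = monom 1 (Posz (k * N)).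
Proof. by rewrite monomX expr1n; congr monom; lia. Qed.

Lemma ext_rees_seminormal : seminormal_cond A -> seminormal_cond (ext_rees I).
Proof.
move=> sn y z e; have {}e : (ext_rees_laurent y) ^+ 3 = (ext_rees_laurent z) ^+ 2.
  by rewrite -!rmorphXn e.
have [By Hy] := laurent_poly (ext_rees_laurent y).
have [Bz Hz] := laurent_poly (ext_rees_laurent z).
(* Shifting y by 2N and z by 3N keeps y^3 = z^2; a root of the shifted pair is then shifted back by
   N. *)
pose N := maxn By Bz.
have [|p ep] := Hy (2 * N)%N; first by rewrite /N; lia.
have [|q eq] := Hz (3 * N)%N; first by rewrite /N; lia.
have [|h [hp hq]] := seminormal_poly nA Ared sn (y := p) (z := q).
  apply: pl_inj; rewrite !rmorphXn -[pl p]ep -[pl q]eq !exprMn e !monom_pow.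
  by rewrite !mulnA.
pose f := monom 1 (- Posz N) * pl h.
have fX k : f ^+ k = monom 1 (- Posz (k * N)) * pl (h ^+ k).
  by rewrite exprMn rmorphXn monomX expr1n; congr (monom _ _ * _); lia.
have f2 : f ^+ 2 = ext_rees_laurent y by rewrite fX -hp -[pl p]ep monomK.
have f3 : f ^+ 3 = ext_rees_laurent z by rewrite fX -hq -[pl q]eq monomK.
have [x ex] := ext_rees_root (isT : 0 < 2)%N f2.
exists x; split; apply: ext_rees_inj.
  by rewrite rmorphXn -ex.
by rewrite rmorphXn -ex.
Qed.

Lemma ext_rees_weakly_normal : weakly_normal_cond A -> weakly_normal_cond (ext_rees I).
Proof.
move=> wn y z w d p dreg pp.
move=> /(congr1 ext_rees_laurent); rewrite rmorphM !rmorphXn => e1.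
move=> /(congr1 ext_rees_laurent); rewrite !rmorphM rmorph_nat => e2.
have p0 := prime_gt0 pp.
have [By Hy] := laurent_poly (ext_rees_laurent y).
have [Bz Hz] := laurent_poly (ext_rees_laurent z).
have [Bw Hw] := laurent_poly (ext_rees_laurent w).
have [Bd Hd] := laurent_poly (ext_rees_laurent d).
pose N := (By + Bz + Bw + Bd)%N.
(* The shifts p N, 2N, N and N of y, z, w and d make both equations of (ii) homogeneous, and the
   root has shift N. *)
have [|y' ey] := Hy (p * N)%N; first by rewrite /N; nia.
have [|z' ez] := Hz (N + N)%N; first by rewrite /N; lia.
have [|w' ew] := Hw N; first by rewrite /N; lia.
have [|d' ed] := Hd N; first by rewrite /N; lia.
have NN : monom (1 : A) (Posz (N + N)) = monom 1 (Posz N) * monom 1 (Posz N).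
  by rewrite monomM mulr1.
have [|||h [hy hw]] := weakly_normal_poly nA Ared (y := y') (z := z') (w := w')
  (d := d') wn pp.
- move=> a Ha; have a0 : a *: (1 : ext_rees I) = 0.
    apply: dreg; rewrite mulr0 -scalerAr mulr1; apply: ext_rees_inj.
    rewrite /= -(monomK N (a *: _)); rewrite -scalerAr [monom 1 N * _]ed.
    rewrite [a *: _](_ : _ = 0) ?mulr0 //; apply: laurentP => n.
    rewrite mcoeffZ mcoeff_poly_laurent mcoeff0; case: n => n; last by rewrite mulr0.
    exact: Ha.
  have := congr1 (fun x : ext_rees I => (ext_rees_laurent x)@_0) a0.
  by rewrite /= mcoeffZ mcoeff_laurent1 eqxx mulr1 mcoeff0.
- apply: pl_inj; rewrite rmorphM !rmorphXn -[pl z']ez -[pl y']ey -[pl d']ed.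
  rewrite !exprMn e1 NN exprMn !monom_pow; ring.
- apply: pl_inj; rewrite !rmorphM rmorph_nat -[pl z']ez -[pl w']ew -[pl d']ed.
  rewrite mulrCA e2 NN; ring.
pose f := monom 1 (- Posz N) * pl h.
have fp : f ^+ p = ext_rees_laurent y.
  rewrite exprMn monomX expr1n -rmorphXn -hy -[pl y']ey.
  have -> : - Posz N *+ p = - Posz (p * N) by lia.
  exact: monomK.
have fw : p%:R * f = ext_rees_laurent w.
  rewrite mulrCA -(rmorph_nat pl) -rmorphM -hw -[pl w']ew; exact: monomK.
have [x ex] := ext_rees_root p0 fp.
exists x; split; apply: ext_rees_inj.
  by rewrite rmorphXn -ex.
by rewrite rmorphM rmorph_nat -ex.
Qed.

End ReesNormality.

Theorem theorem3p8 (A : comNzRingType) (m I : idealr A) :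
  noetherian A -> local_ring m -> krull_dim_ge A 1 ->
  (seminormal (assoc_graded I) ->
     [/\ seminormal (rees I), seminormal (ext_rees I) & seminormal A]) /\
  (weakly_normal (assoc_graded I) ->
     [/\ weakly_normal (rees I), weakly_normal (ext_rees I)
       & weakly_normal A]).
Proof.
move=> noethA mloc _; have nA := (noetherianP A).1 noethA.
have nR : noetherian (rees I) by apply/noetherianP/rees_noeth.
have nE : noetherian (ext_rees I) by apply/noetherianP/ext_rees_noeth.
split=> [[_ Gred Gsn]|[_ Gred Gsn Gwn]].
  have sn := base_seminormal nA mloc Gred Gsn.
  split; split=> //.
  - exact: (rees_reduced nA mloc Gred).
  - exact: (rees_seminormal nA mloc Gred sn).
  - exact: (ext_rees_reduced nA mloc Gred).
  - exact: (ext_rees_seminormal nA mloc Gred sn).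
  - exact: (base_reduced nA mloc Gred).
have sn := base_seminormal nA mloc Gred Gsn.
have wn := base_weakly_normal nA mloc Gred sn Gwn.
split; split=> //.
- exact: (rees_reduced nA mloc Gred).
- exact: (rees_seminormal nA mloc Gred sn).
- exact: (rees_weakly_normal nA mloc Gred wn).
- exact: (ext_rees_reduced nA mloc Gred).
- exact: (ext_rees_seminormal nA mloc Gred sn).
- exact: (ext_rees_weakly_normal nA mloc Gred wn).
- exact: (base_reduced nA mloc Gred).
Qed.
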